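(* Let $F\in D(G_\gamma)$ with $0\le\gamma<+\infty$, let $f:\mathbb N^*\to\mathbb R_+$ and $s>0$ be fixed, and let $k=k(n)$ be integers with $1\le k<n$, $k\to\infty$, $k/n\to0$ as $n\to\infty$. Let $E_1,E_2,\dots$ be independent standard exponential random variables, let $v(s)=\Gamma(2s+1)-\Gamma(s+1)^2$, and let $$F_j^{(s)}=\frac{E_j^s-\Gamma(s+1)}{v(s)^{1/2}},\qquad \mathcal L(f,s)=\sum_{j=1}^\infty f(j)j^{-s}F_j^{(s)}$$ (the $F_j^{(s)}$ are independent and centred with variance one; the series is considered when $\sum_j f(j)^2j^{-2s}<\infty$). All limits are as $n\to\infty$; $\to_{\mathbb P}$ denotes convergence in probability and $\leadsto$ convergence in distribution. The quantities $T_n(f,s)$, $a_n(f,s)$, $\sigma_n(f,s)$, $B_n(f,s)$, $p_n(\lambda)$, $b_n(\lambda)$ and the function $a(\cdot)$ are defined in the context. **(A) Case $0<\gamma<+\infty$.** Suppose that for every $\lambda>1$ $$\sum_{j=1}^k f(j)\,s\left\{\frac{\gamma}{j}E_j+\left(p_n(\lambda)+\frac{E_j}{j}b_n(\lambda)\right)\right\}^{s-1}\left(p_n(\lambda)+\frac{E_j}{j}b_n(\lambda)\right)\to_{\mathbb P}0.$$ (A1) If $\sum_{j\ge1}f(j)^2j^{-2s}<\infty$, then $T_n(f,s)-\gamma^sa_n(f,s)\leadsto\gamma^s\,v(s)^{1/2}\,\mathcal L(f,s)$. (A2) If $\sum_{j\ge1}f(j)^2j^{-2s}=+\infty$ and $B_n(f,s)\to0$,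 then $\sigma_n^{-1}(f,s)\left(T_n(f,s)-\gamma^sa_n(f,s)\right)\leadsto\mathcal N\left(0,\gamma^{2s}v(s)\right)$. **(B) Case $\gamma=0$.** Suppose that $b_n(\lambda)\log k\to0$ for some $\lambda>1$ and that for every $\lambda>1$, with $m_n(\lambda)=\max\{p_n(\lambda),\,b_n(\lambda)\log k\}$, $$\sum_{j=1}^k f(j)\,s\left\{\frac{E_j}{j}+\left(p_n(\lambda)+\frac{E_j}{j}m_n(\lambda)\right)\right\}^{s-1}\left(p_n(\lambda)+\frac{E_j}{j}m_n(\lambda)\right)\to_{\mathbb P}0.$$ (B1) If $\sum_{j\ge1}f(j)^2j^{-2s}<\infty$, then $\dfrac{T_n(f,s)}{a^s(k/n)}-a_n(f,s)\leadsto v(s)^{1/2}\,\mathcal L(f,s)$. (B2) If $\sum_{j\ge1}f(j)^2j^{-2s}=+\infty$ and $B_n(f,s)\to0$, then $\sigma_n^{-1}(f,s)\left[\dfrac{T_n(f,s)}{a^s(k/n)}-a_n(f,s)\right]\leadsto\mathcal N\left(0,v(s)\right)$.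
   Context: $X_1,X_2,\dots$ are i.i.d. real random variables with $X_i>1$ and distribution function $F$; $X_{1,n}\le\dots\le X_{n,n}$ are the order statistics of $X_1,\dots,X_n$. $F\in D(G_\gamma)$ means that there are real sequences $\alpha_n>0$, $\beta_n$ with $F^n(\alpha_nx+\beta_n)\to G_\gamma(x)$ at continuity points, up to affine change of variable in the limit, where $G_\gamma(x)=\exp(-(1+\gamma x)^{-1/\gamma})$ for $1+\gamma x\ge0$ (and $G_0(x)=\exp(-e^{-x})$). $\mathcal N(0,v)$ is the centred normal law with variance $v$. Definitions: $$T_n(f,s)=\sum_{j=1}^k f(j)\left(\log X_{n-j+1,n}-\log X_{n-j,n}\right)^s,\qquad a_n(f,s)=\Gamma(s+1)\sum_{j=1}^k f(j)j^{-s},$$ $$\sigma_n^2(f,s)=\sum_{j=1}^k f^2(j)j^{-2s},\qquad B_n(f,s)=\max_{1\le j\le k} f(j)j^{-s}/\sigma_n(f,s).$$ Representations. Let $G(x)=F(e^x)$ be the distribution function of $\log X_1$ and $G^{-1}$ its generalized inverse, so $G^{-1}(1-u)=\log F^{-1}(1-u)$. With $F$ one associates a fixed pair of functions $(p,b)$ on $(0,1)$ with $p(u)\to0$, $b(u)\to0$ as $u\to0$, and a constant $c>0$, such that: - if $\gamma>0$ (Karamata representation): $G^{-1}(1-u)=\log c+\log(1+p(u))-\gamma\log u+\int_u^1 b(t)t^{-1}dt$, $0<u<1$; - if $\gamma=0$ (de Haan representation): $G^{-1}(1-u)=d-a(u)+\int_u^1 a(t)t^{-1}dt$, $0<u<1$,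 for a constant $d$, where $a(u)=c(1+p(u))\exp\left(\int_u^1 b(t)t^{-1}dt\right)$. The existence of such representations is a known fact. For $\lambda>1$, $$p_n(\lambda)=\sup\{|p(t)|:0<t\le\lambda k/n\},\qquad b_n(\lambda)=\sup\{|b(t)|:0<t\le\lambda k/n\}$$ (for $n$ large enough that $\lambda k/n<1$). *)

(* Defs.v *)
From HB Require Import structures.
From mathcomp Require Import all_boot all_order all_algebra.
From mathcomp Require Import all_classical all_reals all_analysis.
Set Implicit Arguments.
Unset Strict Implicit.
Unset Printing Implicit Defensive.
Import Order.TTheory GRing.Theory Num.Theory.
Import numFieldNormedType.Exports.
Local Open Scope classical_set_scope.
Local Open Scope ring_scope.

(* All sequences below are indexed from 1, as in X_1, X_2, ...; the value at
   index 0 is never used nor constrained. *)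

Section probability_notions.
Context {R : realType} {d : measure_display} {T : measurableType d}
  (P : probability T R).

Definition mutually_independent (X : nat -> {RV P >-> R}) : Prop :=
  forall (J : seq nat) (A : nat -> set R),
    uniq J -> {in J, forall i, (0 < i)%N} -> (forall i, measurable (A i)) ->
    P (\bigcap_(i in [set` J]) X i @^-1` A i) =
    (\prod_(i <- J) P (X i @^-1` A i))%E.

(* The equality is restricted to measurable sets: both sides are functions on
   arbitrary sets with no meaning outside the sigma-algebra. *)
Definition iid_std_exponential (E : nat -> {RV P >-> R}) : Prop :=
  mutually_independent E /\
  forall j, (0 < j)%N -> forall A : set R, measurable A ->
    P (E j @^-1` A) = exponential_prob 1 A.

Definition cvg_in_probability (Y : nat -> T -> R) (l : R) : Prop :=
  forall e : R, 0 < e -> P [set w | e <= `|Y n w - l|] @[n --> \oo] --> 0%E.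

(* Convergence in distribution to the law [mu] on R, through distribution
   functions at the continuity points of the limit. *)
Definition cvg_in_distribution (Y : nat -> T -> R) (mu : set R -> \bar R)
  : Prop :=
  forall x : R, {for x, continuous (fun y : R => mu `]-oo, y]%classic)} ->
    P [set w | Y n w <= x] @[n --> \oo] --> mu `]-oo, x]%classic.

End probability_notions.

Section analytic_notions.
Context {R : realType}.
Implicit Types (x y u s gamma c lambda : R) (F G a b p : R -> R).

Definition Gamma x : R :=
  \int[lebesgue_measure]_(t in `]0, +oo[) (t `^ (x - 1) * expR (- t)).

Definition ginv G y : R := inf [set x | y <= G x].

(* When gamma <> 0 the extreme value distribution function is 0 (gamma > 0) or
   1 (gamma < 0) outside 1 + gamma x > 0. The boundary 1 + gamma x = 0 is kept
   out of the power branch because [0 `^ (- gamma^-1)] is 0 here, not +oo. *)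
Definition extreme_value_df gamma x : R :=
  if gamma == 0 then expR (- expR (- x))
  else if 0 < 1 + gamma * x then expR (- (1 + gamma * x) `^ (- gamma^-1))
  else if gamma < 0 then 1 else 0.

Definition in_domain_of_attraction F gamma : Prop :=
  exists (alpha beta : nat -> R) (A B : R),
    [/\ forall n, 0 < alpha n, 0 < A &
      let H := fun y : R => extreme_value_df gamma (A * y + B) in
      forall x, {for x, continuous H} ->
        (F (alpha n * x + beta n)) ^+ n @[n --> \oo] --> H x].

(* [logint g u] is meaningful when g satisfies [log_integrable]. *)
Definition log_integrable (g : R -> R) : Prop :=
  forall u, 0 < u < 1 ->
    lebesgue_measure.-integrable `]u, 1[%classic (fun t : R => (g t / t)%:E).

Definition logint (g : R -> R) u : R :=
  \int[lebesgue_measure]_(t in `]u, 1[) (g t / t).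

Definition log_quantile F u : R := ginv (fun x => F (expR x)) (1 - u).

Definition karamata_representation F gamma p b c : Prop :=
  [/\ 0 < c, p u @[u --> 0^'+] --> 0, b u @[u --> 0^'+] --> 0 &
    log_integrable b] /\
  forall u, 0 < u < 1 ->
    0 < 1 + p u /\
    log_quantile F u = ln c + ln (1 + p u) - gamma * ln u + logint b u.

Definition dehaan_a p b c u : R := c * (1 + p u) * expR (logint b u).

Definition dehaan_representation F p b c (D : R) : Prop :=
  let a := dehaan_a p b c in
  [/\ 0 < c, p u @[u --> 0^'+] --> 0, b u @[u --> 0^'+] --> 0,
    log_integrable b & log_integrable a] /\
  forall u, 0 < u < 1 -> log_quantile F u = D - a u + logint a u.

(* With g := p or b this is p_n(lambda) or b_n(lambda), where k = k(n). *)
Definition tail_sup (g : R -> R) lambda (k n : nat) : R :=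
  sup [set `|g t| | t in `]0, lambda * k%:R / n%:R]%classic].

End analytic_notions.

Section statistics.
Context {R : realType}.
Implicit Types (f x e : nat -> R) (s : R) (k n : nat).

Definition order_stat x n i : R :=
  nth 0 (sort <=%R [seq x l | l <- iota 1 n]) i.-1.

Definition T_stat f s k n x : R :=
  \sum_(1 <= j < k.+1) f j *
    (ln (order_stat x n (n - j).+1) - ln (order_stat x n (n - j)%N)) `^ s.

Definition a_coef f s k : R :=
  Gamma (s + 1) * \sum_(1 <= j < k.+1) f j * j%:R `^ (- s).

Definition sigma_coef f s k : R :=
  Num.sqrt (\sum_(1 <= j < k.+1) f j ^+ 2 * j%:R `^ (- (2 * s))).

(* The default value 0 of the maximum is harmless: f is nonnegative. *)
Definition B_coef f s k : R :=
  \big[Num.max/0]_(1 <= j < k.+1) (f j * j%:R `^ (- s) / sigma_coef f s k).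

Definition square_series f s : \bar R :=
  (\sum_(1 <= j <oo) (f j ^+ 2 * j%:R `^ (- (2 * s)))%:E)%E.

Definition v_coef s : R := Gamma (2 * s + 1) - Gamma (s + 1) ^+ 2.

(* Value of the series for a realization e of (E_j); [lim] is arbitrary where
   the series diverges. *)
Definition L_series f s e : R :=
  limn (fun m => \sum_(1 <= j < m.+1)
    f j * j%:R `^ (- s) *
    ((e j `^ s - Gamma (s + 1)) / (v_coef s) `^ (2^-1)) : R).

Definition remainder_sum f s k (g pn qn : R) e : R :=
  \sum_(1 <= j < k.+1) f j * s *
    (g / j%:R * e j + (pn + e j / j%:R * qn)) `^ (s - 1) *
    (pn + e j / j%:R * qn).

End statistics.

(* Main.v *)
(** By Renyi's representation the spacings of the log X_i have the joint law of
q (V_j) - q (V_(j+1)), where q t is the quantile of log X_1 at level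
1 - exp (- t) and V_j is the sum of E_m / m over j <= m <= n. It is proved by
peeling variables off iterated integrals one at a time, from the joint law of
the minimum of two competing exponentials and its excess.

On an event of probability close to one, exp (- V_(k+1)) <= lambda k / n, and
the Karamata (de Haan) representation then shows that the j-th spacing differs
from gamma E_j / j (from a (k/n) E_j / j) by at most a constant times
p_n + b_n E_j / j (times p_n + m_n E_j / j). Hence the centred statistic is,
up to a multiple of the remainder that tends to 0 by hypothesis, the weighted
sum of the independent centred variables E_j^s - Gamma (s + 1).

When the squared weights are summable this sum converges in probability by
Kolmogorov's maximal inequality. Otherwise B_n -> 0 makes the sum of the cubes
of the normalized weights vanish, and Lindeberg's replacement method gives the
normal limit. Weak convergence is tested on the functions
y |-> logistic ((y - x0) / e), which approximate the indicators of half-lines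
and have explicit derivatives. *)

Require Import Defs.
From HB Require Import structures.
From mathcomp Require Import all_boot all_order all_algebra.
From mathcomp Require Import all_classical all_reals all_analysis.
From mathcomp Require Import measurable_realfun.
From mathcomp Require Import ring lra.
Import Order.TTheory GRing.Theory Num.Theory.
Import numFieldNormedType.Exports.
Local Open Scope classical_set_scope.
Local Open Scope ring_scope.

Set Implicit Arguments.
Unset Strict Implicit.
Unset Printing Implicit Defensive.

(** The [X_i] live under [P] and the [E_j] under [Q], and nothing couples them: only the law of the
    statistic crosses, for each fixed [n]. All limits are therefore proved under [Q], where the
    remainders of the hypotheses live, and moved to [P] at the end. The suprema p_n and b_n control
    p and b on (0, lambda k/n] only, so the arguments exp (- V_j) must fall there; V_(k+1) has mean
    close to log (n/k) and variance of order 1/k, which makes this likely. When gamma = 0 the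
    function a must moreover stay comparable to a(k/n) down to the smallest argument exp (- V_1),
    which is 1/n up to a factor bounded in probability: the logarithmic distance is log k + O(1),
    whence b_n log k. The remainder has the shape s (a + r)^(s-1) r of a mean value bound for a
    perturbation of a^s. For s < 1 the mean value point may come close to 0, so this bound is
    obtained from homogeneity instead. R^n is encoded by lists: laws of samples become iterated
    integrals, and inductions on n need Tonelli's theorem for two factors only. *)

Definition image_measure d d' (T : measurableType d) (T' : measurableType d')
    (R : realType) (m : {measure set T -> \bar R}) (f : T -> T')
    (mf : measurable_fun setT f) : {measure set T' -> \bar R} :=
  measure_function_pushforward__canonical__measure_function_Measure m mf.

(** * Affine substitution in Lebesgue integrals *)

Section lebesgue_change_of_variables.
Context {R : realType}.
Local Notation mu := (@lebesgue_measure R).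

Lemma measurable_affine (a b : R) :
  measurable_fun [set: R] (fun x : R => a * x + b).
Proof. by apply: measurable_funD => //; exact: measurable_funM. Qed.

Lemma lebesgue_integral_affine (a b : R) (f : R -> \bar R) : 0 < a ->
  measurable_fun [set: R] f -> (forall x, 0 <= f x)%E ->
  (\int[mu]_x f (a * x + b)%R = a^-1%:E * \int[mu]_x f x)%E.
Proof.
move=> a0 mf f0.
have mphi : measurable_fun setT ((fun x => a * x + b) : R -> measurableTypeR R).
  exact: measurable_affine.
have a0' : 0 <= a by exact: ltW.
(* The image of Lebesgue measure under [x |-> a * x + b] is [a^-1] times Lebesgue measure; scaling
   by [a] undoes this, and agreement on half-open intervals identifies [nu]. *)
pose nu := mscale (NngNum a0') (image_measure mu mphi).
have munu : forall A, measurable A -> mu A = nu A.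
  apply: lebesgue_measure_unique => _ [[u v]] _ <-.
  change (mu `]u, v]%classic =
    (a%:E * mu ((fun x : R => (a * x + b)%R) @^-1` `]u, v]%classic))%E).
  have -> : (fun x => a * x + b) @^-1` `]u, v]%classic =
      `](u - b) / a, (v - b) / a]%classic.
    apply/seteqP; split => x /=; rewrite !in_itv /= ltr_pdivrMr// ler_pdivlMr//;
    by rewrite [x * a]mulrC ltrBlDr lerBrDr.
  rewrite !lebesgue_measure_itv /= !lte_fin ltr_pM2r ?invr_gt0// ltrD2r.
  case: ifPn => _; last by rewrite mule0.
  by rewrite -!EFinD -EFinM; congr EFin; field; rewrite gt_eqF.
have -> : (\int[mu]_x f x = \int[nu]_x f x)%E.
  by apply: eq_measure_integral => A mA _; exact: munu.
rewrite /nu (ge0_integral_mscale _ measurableT)//.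
rewrite ge0_integral_pushforward//=.
by rewrite muleA -EFinM mulVf ?gt_eqF// mul1e.
Qed.

End lebesgue_change_of_variables.

(** * Integration against a measure with a density *)

Section density.
Context d (T : measurableType d) (R : realType).
Variables (mu nu : {measure set T -> \bar R}) (g : T -> R).
Hypothesis mg : measurable_fun setT g.
Hypothesis g0 : forall x, 0 <= g x.
Hypothesis nuE : forall A, measurable A -> nu A = (\int[mu]_(x in A) (g x)%:E)%E.
Import HBNNSimple.

Let integral_density_nnsfun (f : {nnsfun T >-> R}) :
  (\int[nu]_x (f x)%:E = \int[mu]_x ((f x)%:E * (g x)%:E))%E.
Proof.
under [LHS]eq_integral do rewrite fimfunE -fsumEFin//.
rewrite [LHS]ge0_integral_fsum//; last 2 first.
  - by move=> r; exact/measurable_EFinP/measurableT_comp.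
  - by move=> n x _; rewrite EFinM nnfun_muleindic_ge0.
under [RHS]eq_integral.
  move=> x xD; rewrite fimfunE -fsumEFin// ge0_mule_fsuml; last first.
    by move=> r; rewrite EFinM nnfun_muleindic_ge0.
  over.
rewrite [RHS]ge0_integral_fsum//; last 2 first.
  - move=> r; apply: emeasurable_funM; last exact/measurable_EFinP.
    exact/measurable_EFinP/measurableT_comp.
  - move=> n x _; rewrite EFinM mule_ge0//; first by rewrite nnfun_muleindic_ge0.
    by rewrite lee_fin.
apply: eq_fsbigr => r _.
have mfr : measurable (f @^-1` [set r]) by exact: measurable_sfunP.
rewrite integralZl_indic_nnsfun//= integral_indic// setIT nuE//.
have [r0|r0] := leP 0 r.
  under [RHS]eq_integral do rewrite EFinM -muleA.
  rewrite ge0_integralZl//; last 2 first.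
  - by apply: emeasurable_funM; apply/measurable_EFinP => //; exact: measurable_indic.
  - by move=> x _; rewrite mule_ge0// lee_fin.
  congr (_ * _)%E; rewrite integral_mkcond; apply: eq_integral => x _.
  by rewrite patchE indicE; case: ifPn => _; rewrite ?mul1e ?mul0e.
(* A nonnegative simple function has an empty fibre over [r < 0], and both sides vanish. *)
have -> : f @^-1` [set r] = set0 by apply: preimage_nnfun0.
rewrite integral_set0 mule0 integral0_eq// => x _.
by rewrite indic0 mulr0 mul0e.
Qed.

Lemma integral_density (f : T -> \bar R) :
  measurable_fun setT f -> (forall x, 0 <= f x)%E ->
  (\int[nu]_x f x = \int[mu]_x (f x * (g x)%:E))%E.
Proof.
move=> mf f0.
pose f_ := nnsfun_approx measurableT mf.
have cvf x : EFin \o f_ ^~ x @ \oo --> f x.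
  by apply: cvg_nnsfun_approx => // y _; exact: f0.
transitivity (limn (fun n => \int[nu]_x (f_ n x)%:E))%E.
  rewrite -monotone_convergence//=.
  - by apply: eq_integral => x _; apply/esym/cvg_lim => //; exact: cvf.
  - by move=> n; exact/measurable_EFinP.
  - by move=> n ? _; rewrite lee_fin.
  - by move=> ? _ ? ? mn; rewrite lee_fin; exact/lefP/nd_nnsfun_approx.
under eq_fun do rewrite integral_density_nnsfun.
rewrite -monotone_convergence//=.
- apply: eq_integral => x _; apply/cvg_lim => //.
  by apply: cvgeZr => //; exact: cvf.
- by move=> n; apply: emeasurable_funM; exact/measurable_EFinP.
- by move=> n x _; rewrite mule_ge0// lee_fin.
- move=> x _ m n mn; apply: lee_wpmul2r; rewrite ?lee_fin//.
  exact/lefP/nd_nnsfun_approx.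
Qed.

End density.

Definition image_probability d d' (T : measurableType d) (T' : measurableType d')
    (R : realType) (P : probability T R) (f : T -> T')
    (mf : measurable_fun setT f) : probability T' R :=
  distribution P (HB.pack_for {mfun T >-> T'} f (isMeasurableFun.Build _ _ _ _ f mf)).

Lemma integral_image_probability d d' (T : measurableType d) (T' : measurableType d')
    (R : realType) (P : probability T R) (f : T -> T')
    (mf : measurable_fun setT f) (g : T' -> \bar R) :
  measurable_fun setT g -> (forall y, 0 <= g y)%E ->
  (\int[image_probability P mf]_y g y = \int[P]_x g (f x))%E.
Proof. by move=> mg g0; rewrite ge0_integral_distribution. Qed.

(** * Iterated integrals over R^n, with vectors encoded as lists *)

Section measurable_lists.
Context {R : realType}.
Local Open Scope ereal_scope.

(** A random vector given by its coordinates. Indices from [n] on read the default 0, so all [i] may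
    be allowed. *)
Definition mlist d (D : measurableType d) (n : nat) (L : D -> seq R) : Prop :=
  (forall w, size (L w) = n) /\
  forall i, measurable_fun setT (fun w => nth 0%R (L w) i).

(* Joint measurability of H on T x R^n, with R^n replaced by lists; the domain
   D of the test maps plays the part of the product space. *)
Definition mlist_fun d (T : measurableType d) n (H : T -> seq R -> \bar R) : Prop :=
  forall d' (D : measurableType d') (g : D -> T) (L : D -> seq R),
    measurable_fun setT g -> mlist n L ->
    measurable_fun setT (fun w => H (g w) (L w)).

Lemma mlist_cons d (D : measurableType d) n (x : D -> R) (L : D -> seq R) :
  measurable_fun setT x -> mlist n L -> mlist n.+1 (fun w => x w :: L w).
Proof.
move=> mx [sL mL]; split=> [w|[|i]] /=; first by rewrite sL.
- exact: mx.
- exact: mL.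
Qed.

Lemma mlist_nil d (D : measurableType d) : mlist 0 (fun _ : D => [::] : seq R).
Proof. by split => // -[|i]; exact: measurable_cst. Qed.

Lemma mlist_behead d (D : measurableType d) n (L : D -> seq R) :
  mlist n.+1 L -> mlist n (fun w => behead (L w)).
Proof.
move=> [sL mL]; split=> [w|i]; first by rewrite size_behead sL.
rewrite (_ : (fun w => _) = (fun w => nth 0%R (L w) i.+1)); first exact: mL.
by apply/funext => w; rewrite nth_behead.
Qed.

(** The expectation of [h] at n independent variables of law [mu], without a product measure on R^n.
    The first variable is integrated outermost, so that inductions on [n] peel the head of the
    list. *)
Fixpoint iint (mu : {measure set R -> \bar R}) n (h : seq R -> \bar R) : \bar R :=
  if n is m.+1 then \int[mu]_x iint mu m (fun l => h (x :: l)) else h [::].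

Variable mu : probability R R.

Lemma eq_iint n (h1 h2 : seq R -> \bar R) :
  (forall l, size l = n -> h1 l = h2 l) -> iint mu n h1 = iint mu n h2.
Proof.
elim: n h1 h2 => [|n IH] h1 h2 h12 /=; first exact: h12.
by apply: eq_integral => x _; apply: IH => l ln; apply: h12; rewrite /= ln.
Qed.

Lemma iint_ge0 n (h : seq R -> \bar R) :
  (forall l, size l = n -> 0 <= h l) -> 0 <= iint mu n h.
Proof.
elim: n h => [|n IH] h h0 /=; first exact: h0.
by apply: integral_ge0 => x _; apply: IH => l ln; apply: h0; rewrite /= ln.
Qed.

(** The induction moves the outermost integration variable into the parameter space, which becomes
    [T * R]; this is why the parameter space is arbitrary. Tonelli's theorem for two factors then
    gives measurability in the old parameter. *)
Lemma measurable_iint d (T : measurableType d) n (H : T -> seq R -> \bar R) :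
  mlist_fun n H -> (forall t l, size l = n -> 0 <= H t l) ->
  measurable_fun setT (fun t => iint mu n (H t)).
Proof.
elim: n d T H => [|n IH] d T H mH H0 /=.
  by apply: (mH _ T id (fun=> [::])) => //; exact: mlist_nil.
apply: (@measurable_fun_fubini_tonelli_F _ _ T R R mu
  (fun z : T * R => iint mu n (fun l => H z.1 (z.2 :: l)))).
  apply: (IH _ _ (fun z l => H z.1 (z.2 :: l))) => [d' D g L mg mL|t l ln].
    apply: mH; first exact: measurableT_comp.
    by apply: mlist_cons => //; exact: measurableT_comp.
  by apply: H0; rewrite /= ln.
by move=> z; apply: iint_ge0 => l ln; apply: H0; rewrite /= ln.
Qed.

Lemma mlist_fun_cons n (h : seq R -> \bar R) :
  mlist_fun n.+1 (fun _ : unit => h) -> mlist_fun n (fun x l => h (x :: l)).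
Proof.
move=> mh d' D g L mg mL; apply: (mh _ _ (fun=> tt)) => //.
exact: mlist_cons.
Qed.

Lemma mlist_fun_curry n (h : seq R -> \bar R) (x : R) :
  mlist_fun n.+1 (fun _ : unit => h) ->
  mlist_fun n (fun _ : unit => fun l => h (x :: l)).
Proof.
move=> mh d' D g L mg mL; apply: (mh _ _ (fun=> tt)) => //.
by apply: mlist_cons => //; exact: measurable_cst.
Qed.

Lemma iint_cst n (r : \bar R) : iint mu n (fun=> r) = r.
Proof.
by elim: n => [//|n IH] /=; rewrite IH integral_cst// [X in _ * X]probability_setT mule1.
Qed.

End measurable_lists.

(** * From independence to iterated integrals *)

Section independence.
Context {R : realType} {d : measure_display} {T : measurableType d}
  (P : probability T R).
Variable X : nat -> {RV P >-> R}.
Hypothesis indX : mutually_independent X.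
Variable mu : probability R R.

Let cyl (J : seq nat) : set (set T) :=
  [set B | exists2 A : nat -> set R, forall i, measurable (A i) &
    B = \bigcap_(i in [set` J]) X i @^-1` A i].

Let cyl_measurable J : cyl J `<=` measurable.
Proof.
move=> _ [A mA ->]; apply: fin_bigcap_measurable => [|i _]; first by apply/finite_seqP; exists J.
rewrite -[X in measurable X]setTI; exact: measurable_funP.
Qed.

Let cylI J : setI_closed (cyl J).
Proof.
move=> _ _ [A mA ->] [B mB ->]; exists (fun i => A i `&` B i).
  by move=> i; exact: measurableI.
by rewrite -bigcapI.
Qed.

Let cylT J : cyl J setT.
Proof.
by exists (fun=> setT) => //; rewrite bigcapT.
Qed.

(** Cylinder sets over [J] are stable under intersection, and the two finite measures in [B] agree
    on them by independence, hence on the sigma-algebra that they generate. *)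
Lemma independent_cons j J (A : set R) B : uniq (j :: J) ->
  {in j :: J, forall i, (0 < i)%N} -> measurable A -> <<s cyl J >> B ->
  P (X j @^-1` A `&` B) = (P (X j @^-1` A) * P B)%E.
Proof.
move=> uJ J0 mA sB.
have mXA : measurable (X j @^-1` A).
  by rewrite -[X in measurable X]setTI; exact: measurable_funP.
have PXA : P (X j @^-1` A) \is a fin_num by exact: fin_num_measure.
have fXA : 0 <= fine (P (X j @^-1` A)) by exact: fine_ge0.
rewrite setIC.
transitivity (mscale (NngNum fXA) P B); last by rewrite /mscale /= fineK.
change (mrestr P mXA B = mscale (NngNum fXA) P B).
apply: (@g_sigma_algebra_measure_unique _ _ _ (cyl J) _ (fun=> setT)) => //.
- exact: bigcup_const.
- move=> _ [C mC ->].
  transitivity (P (X j @^-1` A) * P (\bigcap_(i in [set` J]) X i @^-1` C i))%E;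
    last by rewrite -[LHS](congr1 (fun r => (r * _)%E) (fineK PXA)).
  change (P ((\bigcap_(i in [set` J]) X i @^-1` C i) `&` X j @^-1` A) =
    P (X j @^-1` A) * P (\bigcap_(i in [set` J]) X i @^-1` C i))%E.
  have [jJ Juniq] := andP uJ.
  (* One family of sets for [j :: J]: since [j] is not in [J], putting [A] at [j] leaves the
     constraints over [J] unchanged. *)
  pose C' i := if i == j then A else C i.
  have mC' i : measurable (C' i) by rewrite /C'; case: ifP.
  have C'E i : i \in J -> C' i = C i.
    by move=> iJ; rewrite /C' ifF//; apply/eqP => ij; rewrite -ij iJ in jJ.
  have := indX uJ J0 mC'; rewrite big_cons {2}/C' eqxx.
  rewrite (eq_big_seq (fun i => P (X i @^-1` C i))); last first.
    by move=> i iJ; rewrite C'E.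
  rewrite -indX//; last by move=> i iJ; apply: J0; rewrite inE iJ orbT.
  move=> <-; congr (P _).
  apply/seteqP; split => [w [wC wA] i /=|w wC].
    by rewrite inE => /orP[/eqP->|iJ]; rewrite /C' ?eqxx// -/(C' i) C'E//; exact: wC.
  split; first by move=> i /= iJ; rewrite -C'E//; apply: wC; rewrite /= inE iJ orbT.
  by have := wC j; rewrite /= inE eqxx /C' eqxx; apply.
- move=> _; change (P (setT `&` X j @^-1` A) < +oo)%E.
  by rewrite setTI ltey_eq PXA.
Qed.

Hypothesis muX : forall j A, (0 < j)%N -> measurable A -> P (X j @^-1` A) = mu A.

(** [S] below is the sample space with the sigma-algebra generated by the [X i], [i] in [J]. The law
    of [w |-> (X j w, w)] on [R * S] is the product of [mu] and the restriction of [P], so Tonelli's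
    theorem detaches the first variable and leaves an expectation of the same form. *)
Lemma integral_sample (J : seq nat) (h : seq R -> \bar R) : uniq J ->
  {in J, forall i, (0 < i)%N} ->
  mlist_fun (size J) (fun _ : unit => h) ->
  (forall l, size l = size J -> 0 <= h l)%E ->
  (\int[P]_w h [seq X j w | j <- J] = iint mu (size J) h)%E.
Proof.
elim: J h => [|j J IH] h uJ J0 mh h0 /=.
  by rewrite integral_cst// [X in (_ * X)%E]probability_setT mule1.
have [jJ uJ'] := andP uJ.
have J0' : {in J, forall i, (0 < i)%N}.
  by move=> i iJ; apply: J0; rewrite inE iJ orbT.
pose S := g_sigma_algebraType (cyl J).
have sm : <<s cyl J >> `<=` measurable.
  by apply: smallest_sub (@cyl_measurable J); exact: sigma_algebra_measurable.
have mid : measurable_fun setT (idfun : T -> S).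
  by move=> _ A mA; rewrite setTI preimage_id; exact: sm.
have mXS i : i \in J -> measurable_fun setT (X i : S -> R).
  move=> iJ _ A mA; rewrite setTI; apply: sub_sigma_algebra.
  exists (fun l => if l == i then A else setT); first by move=> l; case: ifP.
  apply/seteqP; split => [w Aw l /= lJ|w /(_ i iJ)]; last by rewrite eqxx.
  by case: eqP => // ->.
have mpair : measurable_fun setT (fun w => (X j w, w) : R * S).
  by apply: measurable_fun_pair => //; exact: measurable_funP.
have mL : mlist (size J) (fun z : R * S => [seq X i z.2 | i <- J]).
  split=> [w|i]; first by rewrite size_map.
  have [iJ|iJ] := ltnP i (size J); last first.
    rewrite (_ : (fun w => _) = cst 0%R); first exact: measurable_cst.
    by apply/funext => w; rewrite nth_default// size_map.
  rewrite (_ : (fun w => _) = (X (nth 0%N J i) : S -> R) \o snd); last first.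
    by apply/funext => w; rewrite (nth_map 0%N).
  by apply: measurableT_comp; [apply: mXS; exact: mem_nth|exact: measurable_snd].
have mH : measurable_fun setT (fun z : R * S => h (z.1 :: [seq X i z.2 | i <- J])).
  by apply: (mh _ _ (fun=> tt)) => //; exact: mlist_cons.
have H0 (z : R * S) : (0 <= h (z.1 :: [seq X i z.2 | i <- J]))%E.
  by apply: h0; rewrite /= size_map.
have := integral_image_probability P mpair mH H0 => /= <-.
pose PS := image_probability P mid.
have E : forall A, measurable A -> (mu \x PS)%E A = image_probability P mpair A.
  apply: product_measure_unique => A B mA mB.
  have j0 : (0 < j)%N by apply: J0; rewrite mem_head.
  by have := independent_cons uJ J0 mA mB; rewrite (muX j0 mA).
change (\int[image_probability P mpair]_z h (z.1 :: [seq X i z.2 | i <- J]) =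
  \int[mu]_x iint mu (size J) (fun l : seq R => h (x :: l)))%E.
rewrite (eq_measure_integral (mu \x PS)%E); last by move=> A mA _; apply/esym/E.
rewrite fubini_tonelli1//; apply: eq_integral => x _.
rewrite /fubini_F /= integral_image_probability//; first last.
- by move=> w; exact: (H0 (x, w)).
- exact: (measurable_fun_pair2 x mH).
apply: IH => //; first exact: mlist_fun_curry.
by move=> l lJ; apply: h0; rewrite /= lJ.
Qed.

End independence.

(** * The exponential law and two competing exponential clocks *)

Section expo.
Context {R : realType}.
Local Notation leb := (@lebesgue_measure R).

(* Lebesgue measure and the densities of the library live on
   [measurableTypeR R], whose Borel structure is not the canonical one of R. *)
Let measurable_idR : measurable_fun setT (idfun : measurableTypeR R -> R).
Proof. by move=> _ A mA; rewrite setTI preimage_id. Qed.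

Let expo_prob : probability (measurableTypeR R) R :=
  exponential_distribution_exponential_prob__canonical__probability_measure_Probability
    (@ltr01 R).

Definition expo : probability R R := image_probability expo_prob measurable_idR.

Lemma expoE A : expo A = exponential_prob 1 A. Proof. by []. Qed.

(** The flag decides whether the point 0 is included: two versions of the same density. It lets
    [integral_expo_lt] treat strict and large comparisons at once. *)
Definition expo_density (b : bool) (x : R) : R :=
  if 0 < x ?<= if b then expR (- x) else 0.

Lemma expo_density_ge0 b x : 0 <= expo_density b x.
Proof. by rewrite /expo_density; case: ifP => // _; exact: expR_ge0. Qed.

Lemma measurable_expo_density b : measurable_fun setT (expo_density b).
Proof.
apply: measurable_fun_ifT; last exact: measurable_cst.
  by case: b => /=; [exact: measurable_fun_ler|exact: measurable_fun_ltr].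
by apply: measurableT_comp => //; exact: measurable_funN.
Qed.

Lemma integral_expo b (f : R -> \bar R) :
  measurable_fun setT f -> (forall x, 0 <= f x)%E ->
  (\int[expo]_x f x = \int[leb]_x (f x * (expo_density b x)%:E))%E.
Proof.
move=> mf f0; rewrite integral_image_probability//=.
rewrite (@integral_density _ _ _ leb expo_prob _ (measurable_expo_density true))//.
- case: b => //.
  apply: ge0_ae_eq_integral => //.
  + apply: emeasurable_funM => //; apply/measurable_EFinP.
    exact: measurable_expo_density.
  + apply: emeasurable_funM => //; apply/measurable_EFinP.
    exact: measurable_expo_density.
  + by move=> x _; rewrite mule_ge0// lee_fin expo_density_ge0.
  + by move=> x _; rewrite mule_ge0// lee_fin expo_density_ge0.
  exists [set 0]; split => //; first exact: lebesgue_measure_set1.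
  move=> x /=; apply: contra_notP => /eqP x0 _.
  by rewrite /expo_density /= le_eqVlt eq_sym (negbTE x0).
- exact: expo_density_ge0.
- move=> A mA; change (expo_prob A) with (exponential_prob 1 A); apply: eq_integral => x _; congr EFin.
  rewrite /exponential_pdf /expo_density patchE mem_setE in_itv /= andbT.
  by rewrite mulN1r mul1r.
Qed.

(** On the right stands the density of the exponential law of rate [a]. *)
Lemma integral_expo_scale b (a : R) (f : R -> \bar R) : 0 < a ->
  measurable_fun setT f -> (forall x, 0 <= f x)%E ->
  (\int[expo]_x f (x / a)%R = \int[leb]_x (f x * (a * expo_density b (a * x))%:E))%E.
Proof.
move=> a0 mf f0.
have mfa : measurable_fun setT (fun x : R => f (x / a)).
  by apply: measurableT_comp => //; exact: measurable_funM.
have mg : measurable_fun setT (fun x : R => (f (x / a)%R * (expo_density b x)%:E)%E).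
  apply: emeasurable_funM => //.
  apply/measurable_EFinP; exact: measurable_expo_density.
rewrite (integral_expo b)//.
have g0 x : (0 <= f (x / a)%R * (expo_density b x)%:E)%E.
  by rewrite mule_ge0// lee_fin expo_density_ge0.
have := lebesgue_integral_affine 0 a0 mg g0.
under eq_integral do rewrite addr0 mulrAC divff ?gt_eqF// mul1r.
move=> /(congr1 (fun r => a%:E * r)%E).
rewrite muleA -EFinM divff ?gt_eqF// mul1e => <-.
rewrite -ge0_integralZl//; last by rewrite lee_fin ltW.
- by apply: eq_integral => x _; rewrite EFinM [RHS]muleCA.
- apply: emeasurable_funM => //; apply/measurable_EFinP.
  apply: measurableT_comp; first exact: measurable_expo_density.
  exact: measurable_funM.
- by move=> x _; rewrite mule_ge0// lee_fin expo_density_ge0.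
Qed.

Section half.
Variables (al be : R) (phi : R -> R -> \bar R).
Hypotheses (al0 : 0 < al) (be0 : 0 < be).
Hypothesis mphi : measurable_fun setT (fun z : R * R => phi z.1 z.2).
Hypothesis phi0 : forall x y, (0 <= phi x y)%E.

Let Psi u := (\int[expo]_r phi u (u + r / be)%R)%E.

Let mPsi : measurable_fun setT Psi.
Proof.
apply: (@measurable_fun_fubini_tonelli_F _ _ R R R expo
  (fun z : R * R => phi z.1 (z.1 + z.2 / be))) => //.
apply: (measurableT_comp mphi (f := fun z : R * R => phi z.1 z.2)
  (g := fun z : R * R => (z.1, z.1 + z.2 / be))).
apply: measurable_fun_pair => //; apply: measurable_funD => //.
exact: measurable_funM.
Qed.

(** Let X and Y have rates [al] and [be]. Given X = u, the event u < Y has weight exp (- be u), and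
    the excess Y - u is again exponential of rate [be]. This weight times the density al exp (- al
    u) is al / (al + be) times the density of rate al + be. *)
Lemma integral_expo_lt b :
  (\int[expo]_x \int[expo]_e
     (if (x / al < e / be ?<= if b)%R then phi (x / al)%R (e / be)%R else 0) =
   (al / (al + be))%:E *
   \int[expo]_m \int[expo]_r
     phi (m / (al + be))%R (m / (al + be) + r / be)%R)%E.
Proof.
have albe : 0 < al + be by exact: addr_gt0.
have m1 x0 : measurable_fun setT (fun y : R => phi x0 (x0 + y)).
  apply: (measurableT_comp mphi (f := fun z : R * R => phi z.1 z.2)
    (g := fun y : R => (x0, x0 + y))).
  by apply: measurable_fun_pair => //; apply: measurable_funD.
have inner x0 : 0 < x0 ->
  (\int[expo]_e (if (x0 < e / be ?<= if b)%R then phi x0 (e / be)%R else 0) =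
   (expR (- (be * x0)))%:E * Psi x0)%E.
  move=> x00.
  have mif : measurable_fun setT
      (fun y : R => if x0 < y ?<= if b then phi x0 y else 0%E).
    apply: measurable_fun_ifT => //.
      case: b => /=; [exact: measurable_fun_ler|exact: measurable_fun_ltr].
    exact: (measurable_fun_pair2 x0 mphi).
  have if0 y : (0 <= if (x0 < y ?<= if b)%R then phi x0 y else 0)%E.
    by case: ifP.
  rewrite (integral_expo_scale b (f := fun y => if x0 < y ?<= if b then phi x0 y else 0%E))//.
  rewrite /Psi (integral_expo_scale b (f := fun r => phi x0 (x0 + r)%R))//.
  pose g y := ((if (x0 < y ?<= if b)%R then phi x0 y else 0) * (be * expo_density b (be * y))%:E)%E.
  have mg : measurable_fun setT g.
    apply: emeasurable_funM => //; apply/measurable_EFinP.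
    apply: measurable_funM => //; apply: measurableT_comp.
      exact: measurable_expo_density.
    exact: measurable_funM.
  have g0 y : (0 <= g y)%E.
    by rewrite mule_ge0// lee_fin mulr_ge0 ?expo_density_ge0// ltW.
  (* The variable becomes the excess over [x0]; the density at [x0 + t] splits into exp (- be x0)
     and the density at [t]. *)
  have := lebesgue_integral_affine x0 ltr01 mg g0; rewrite invr1 mul1e => <-.
  rewrite -ge0_integralZl//.
  - apply: eq_integral => t _; rewrite /g mul1r addrC.
    have -> : (x0 < x0 + t ?<= if b) = (0 < t ?<= if b).
      by case: (b) => /=; rewrite ?lerDl ?ltrDl.
    rewrite /expo_density.
    have -> : (0 < be * t ?<= if b) = (0 < t ?<= if b).
      by case: (b) => /=; rewrite ?pmulr_rge0 ?pmulr_rgt0.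
    case: ifPn => t0; last by rewrite mul0e !mulr0 !mule0.
    have -> : (0 < be * (x0 + t) ?<= if b).
      apply: lteifS; rewrite mulr_gt0// ltr_wpDr//.
      by move: t0; case: (b) => //= /ltW.
    rewrite mulrDr opprD expRD muleCA -EFinM; congr (_ * _%:E)%E.
    by rewrite mulrCA.
  - apply: emeasurable_funM; [exact: m1|apply/measurable_EFinP].
    apply: measurable_funM => //; apply: measurableT_comp.
      exact: measurable_expo_density.
    exact: measurable_funM.
  - by move=> y _; rewrite mule_ge0// lee_fin mulr_ge0 ?expo_density_ge0// ltW.
have Psi0 u : (0 <= Psi u)%E by exact: integral_ge0.
pose Ph u := ((expR (- (be * u)))%:E * Psi u)%E.
have mPh : measurable_fun setT Ph.
  apply: emeasurable_funM => //; apply/measurable_EFinP.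
  by apply: measurableT_comp => //; apply: measurable_funN; exact: measurable_funM.
have Ph0 u : (0 <= Ph u)%E by rewrite mule_ge0// lee_fin expR_ge0.
transitivity (\int[expo]_x Ph (x / al)%R)%E.
  have mL : measurable_fun setT (fun x : R => \int[expo]_e
     (if (x / al < e / be ?<= if b)%R then phi (x / al)%R (e / be)%R else 0))%E.
    apply: (@measurable_fun_fubini_tonelli_F _ _ R R R expo (fun z : R * R =>
      if z.1 / al < z.2 / be ?<= if b then phi (z.1 / al) (z.2 / be) else 0%E)) => //.
      apply: measurable_fun_ifT => //.
        by case: (b) => /=; [apply: measurable_fun_ler|apply: measurable_fun_ltr];
          exact: measurable_funM.
      apply: (measurableT_comp mphi (f := fun z : R * R => phi z.1 z.2)
        (g := fun z : R * R => (z.1 / al, z.2 / be))).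
      by apply: measurable_fun_pair; exact: measurable_funM.
    by move=> z; case: ifP.
  rewrite (integral_expo false)//; last first.
    by move=> x; apply: integral_ge0 => y _; case: ifP.
  rewrite (integral_expo false)//; last first.
    by apply: measurableT_comp => //; exact: measurable_funM.
  apply: eq_integral => x _; rewrite /expo_density /=.
  by case: ifP => x0; rewrite ?mule0// inner// divr_gt0.
rewrite (integral_expo_scale false)// (integral_expo_scale false (f := Psi))//.
rewrite -ge0_integralZl//; last by rewrite lee_fin divr_ge0// ltW.
- apply: eq_integral => u _; rewrite /Ph /expo_density /= !pmulr_rgt0//.
  case: ifP => u0; last by rewrite !mulr0 !mule0.
  rewrite muleAC -EFinM [RHS]muleCA [LHS]muleC -EFinM; congr (_ * _%:E)%E.
  have -> : - ((al + be) * u) = - (al * u) + - (be * u) by ring.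
  by rewrite expRD; field; rewrite gt_eqF.
- apply: emeasurable_funM => //; apply/measurable_EFinP.
  apply: measurable_funM => //; apply: measurableT_comp.
    exact: measurable_expo_density.
  exact: measurable_funM.
- by move=> y _; rewrite mule_ge0// lee_fin mulr_ge0 ?expo_density_ge0// ltW.
Qed.

End half.

(** The clocks have rates 1 and [a]. The cases [x <= e / a] and [e / a < x] put ties in the first
    one only, so the integrands add up pointwise. In each case the minimum has rate [1 + a] and the
    excess keeps the rate of the clock that is still running. *)
Lemma competing_exponentials (a : R) (phi : R -> R -> \bar R) : 0 < a ->
  measurable_fun setT (fun z : R * R => phi z.1 z.2) ->
  (forall x y, (0 <= phi x y)%E) ->
  (\int[expo]_x \int[expo]_e phi x (e / a)%R =
   (1 / (1 + a))%:E * (\int[expo]_m \int[expo]_r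
      phi (m / (1 + a))%R (m / (1 + a) + r / a)%R) +
   (a / (1 + a))%:E * (\int[expo]_m \int[expo]_r
      phi (m / (1 + a) + r)%R (m / (1 + a))%R))%E.
Proof.
move=> a0 mphi phi0.
have mphi' : measurable_fun setT (fun z : R * R => phi z.2 z.1).
  apply: (measurableT_comp mphi (f := fun z : R * R => phi z.1 z.2)
    (g := fun z : R * R => (z.2, z.1))).
  exact: measurable_fun_pair.
have := integral_expo_lt ltr01 a0 mphi phi0 true => <-.
have := integral_expo_lt a0 ltr01 mphi' (fun x y => phi0 y x) false.
rewrite addrC => E.
have -> : (\int[expo]_m \int[expo]_r phi (m / (1 + a) + r)%R (m / (1 + a))%R =
  \int[expo]_m \int[expo]_r phi (m / (1 + a) + r / 1)%R (m / (1 + a))%R)%E.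
  by under [RHS]eq_integral do under eq_integral do rewrite divr1.
rewrite -E.
have mF b : measurable_fun setT (fun z : R * R =>
    if (if b then z.1 <= z.2 / a else z.2 / a < z.1) then phi z.1 (z.2 / a) else 0%E).
  apply: measurable_fun_ifT => //.
    by case: b; [apply: measurable_fun_ler|apply: measurable_fun_ltr] => //;
      exact: measurable_funM.
  apply: (measurableT_comp mphi (f := fun z : R * R => phi z.1 z.2)
    (g := fun z : R * R => (z.1, z.2 / a))).
  by apply: measurable_fun_pair => //; exact: measurable_funM.
have F0 b (z : R * R) : (0 <= if (if b then z.1 <= z.2 / a else z.2 / a < z.1)%R
    then phi z.1 (z.2 / a)%R else 0)%E by case: ifP.
have -> : (\int[expo]_x \int[expo]_e (if (x / a < e / 1)%R then phi (e / 1)%R (x / a)%R else 0) =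
  \int[expo]_x \int[expo]_e (if (e / a < x)%R then phi x (e / a)%R else 0))%E.
  have /= -> := @fubini_tonelli _ _ _ _ R expo expo _ (mF false) (F0 false).
  by under eq_integral do under eq_integral do rewrite divr1.
rewrite -ge0_integralD//.
- apply: eq_integral => x _; rewrite -ge0_integralD//.
  + apply: eq_integral => e _; rewrite /= divr1.
    by case: ltP; rewrite ?adde0 ?add0e.
  + by move=> e _; rewrite divr1; exact: (F0 true (x, e)).
  + by under eq_fun do rewrite divr1; exact: (measurable_fun_pair2 x (mF true)).
  + by move=> e _; exact: (F0 false (x, e)).
  + exact: (measurable_fun_pair2 x (mF false)).
- by move=> x _; apply: integral_ge0 => e _; rewrite divr1; exact: (F0 true (x, e)).
- under eq_fun do under eq_integral do rewrite divr1.
  exact: (@measurable_fun_fubini_tonelli_F _ _ R R R expo _ (mF true) (F0 true)).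
- by move=> x _; apply: integral_ge0 => e _; exact: (F0 false (x, e)).
- exact: (@measurable_fun_fubini_tonelli_F _ _ R R R expo _ (mF false) (F0 false)).
Qed.

End expo.
#[global] Opaque expo.

(** * Renyi's representation of exponential order statistics *)

Section renyi.
Context {R : realType}.
Implicit Types (x y m : R) (l : seq R).

Fixpoint insert x l : seq R :=
  if l is y :: l' then if x <= y then x :: l else y :: insert x l' else [:: x].

(** Insertion sort recurses on the head of the list, as [iint] does; [isortE] identifies it with
    [sort]. *)
Definition isort l : seq R := foldr insert [::] l.

(* If the entries of l are independent standard exponential variables then
   [renyi l] is distributed as their order statistics. *)
Fixpoint renyi l : seq R :=
  if l is e :: l' then
    let m := e / (size l)%:R in m :: [seq m + y | y <- renyi l']
  else [::].

Lemma size_insert x l : size (insert x l) = (size l).+1.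
Proof. by elim: l => //= y l IH; case: ifP => //= _; rewrite IH. Qed.

Lemma size_isort l : size (isort l) = size l.
Proof. by elim: l => //= x l IH; rewrite size_insert IH. Qed.

Lemma size_renyi l : size (renyi l) = size l.
Proof. by elim: l => //= x l IH; rewrite size_map IH. Qed.

Lemma perm_insert x l : perm_eq (insert x l) (x :: l).
Proof.
elim: l => //= y l IH; case: ifP => // _.
by rewrite (perm_trans (y := y :: x :: l)) ?perm_cons// (perm_catCA [:: y] [:: x]).
Qed.

Lemma sorted_insert x l : sorted <=%R l -> sorted <=%R (insert x l).
Proof.
elim: l => //= y l IH sl; case: ifP => [xy|/negbT]; first by rewrite /= xy.
rewrite -ltNge => /ltW yx.
have {}IH := IH (path_sorted sl).
rewrite /= path_sortedE; last exact: le_trans.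
rewrite IH andbT (perm_all _ (perm_insert x l)) /= yx /=.
by move: sl; rewrite path_sortedE; [case/andP|exact: le_trans].
Qed.

Lemma isortE l : isort l = sort <=%R l.
Proof.
apply: (sorted_eq (leT := <=%R)).
- exact: le_trans.
- exact: le_anti.
- by elim: l => //= x l; exact: sorted_insert.
- exact: sort_le_sorted.
- rewrite perm_sym perm_sort perm_sym; elim: l => //= x l IH.
  by apply: perm_trans (perm_insert _ _) _; rewrite perm_cons.
Qed.

Lemma insert_shift m x l :
  insert (m + x) [seq m + y | y <- l] = [seq m + y | y <- insert x l].
Proof. by elim: l => //= y l IH; rewrite lerD2l; case: ifP => //= _; rewrite IH. Qed.

Section closure.
Context {d} {D : measurableType d}.
Implicit Types (L : D -> seq R) (n : nat).

Lemma mlist_if n (c : D -> bool) L1 L2 : measurable_fun setT c ->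
  mlist n L1 -> mlist n L2 -> mlist n (fun w => if c w then L1 w else L2 w).
Proof.
move=> mc [s1 m1] [s2 m2]; split=> [w|i]; first by case: ifP.
rewrite (_ : (fun w => _) = (fun w => if c w then nth 0 (L1 w) i else nth 0 (L2 w) i)).
  exact: measurable_fun_ifT.
by apply/funext => w; case: ifP.
Qed.

Lemma mlist_shift n (f : D -> R) L : measurable_fun setT f ->
  mlist n L -> mlist n (fun w => [seq f w + y | y <- L w]).
Proof.
move=> mf [sL mL]; split=> [w|i]; first by rewrite size_map sL.
have [ni|ni] := ltnP i n; last first.
  rewrite (_ : (fun w => _) = cst 0); first exact: measurable_cst.
  by apply/funext => w; rewrite nth_default// size_map sL.
rewrite (_ : (fun w => _) = (fun w => f w + nth 0 (L w) i)).
  exact: measurable_funD.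
by apply/funext => w; rewrite (nth_map 0)// sL.
Qed.

Lemma mlist_head_behead n L w : mlist n.+1 L ->
  L w = nth 0 (L w) 0 :: behead (L w).
Proof. by move=> [sL _]; have := sL w; case: (L w). Qed.

Lemma mlist_insert n (x : D -> R) L : measurable_fun setT x ->
  mlist n L -> mlist n.+1 (fun w => insert (x w) (L w)).
Proof.
move=> mx; elim: n L => [|n IH] L mL.
  rewrite (_ : (fun w => _) = (fun w => [:: x w])).
    by apply: mlist_cons => //; exact: mlist_nil.
  apply/funext => w; case: mL => /(_ w) + _; by case: (L w).
rewrite (_ : (fun w => _) = (fun w => if x w <= nth 0 (L w) 0 then x w :: L w
    else nth 0 (L w) 0 :: insert (x w) (behead (L w)))).
  apply: mlist_if.
  - by apply: measurable_fun_ler => //; exact: mL.2.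
  - exact: mlist_cons.
  - by apply: mlist_cons; [exact: mL.2|apply: IH; exact: mlist_behead].
by apply/funext => w; rewrite {1}(mlist_head_behead w mL) /= -(mlist_head_behead w mL).
Qed.

Lemma mlist_isort n L : mlist n L -> mlist n (fun w => isort (L w)).
Proof.
elim: n L => [|n IH] L mL.
  by split=> [w|i]; [rewrite size_isort mL.1|rewrite (_ : (fun w => _) = cst 0);
    [exact: measurable_cst|apply/funext => w; rewrite nth_default// size_isort mL.1]].
rewrite (_ : (fun w => _) =
    (fun w => insert (nth 0 (L w) 0) (isort (behead (L w))))).
  by apply: mlist_insert; [exact: mL.2|apply: IH; exact: mlist_behead].
by apply/funext => w; rewrite {1}(mlist_head_behead w mL).
Qed.

Lemma mlist_renyi n L : mlist n L -> mlist n (fun w => renyi (L w)).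
Proof.
elim: n L => [|n IH] L mL.
  by split=> [w|i]; [rewrite size_renyi mL.1|rewrite (_ : (fun w => _) = cst 0);
    [exact: measurable_cst|apply/funext => w; rewrite nth_default// size_renyi mL.1]].
rewrite (_ : (fun w => _) =
    (fun w => nth 0 (L w) 0 / n.+1%:R ::
      [seq nth 0 (L w) 0 / n.+1%:R + y | y <- renyi (behead (L w))])).
  have mh : measurable_fun setT (fun w => nth 0 (L w) 0 / n.+1%:R).
    by apply: measurable_funM => //; exact: mL.2.
  by apply: mlist_cons => //; apply: mlist_shift => //; apply: IH; exact: mlist_behead.
apply/funext => w; rewrite {1}(mlist_head_behead w mL) /=.
by rewrite size_behead mL.1.
Qed.

End closure.

Lemma eq_integral_expo (f g : R -> \bar R) :
  measurable_fun setT f -> measurable_fun setT g ->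
  (forall x, 0 <= f x)%E -> (forall x, 0 <= g x)%E ->
  (forall x, 0 < x -> f x = g x) ->
  (\int[expo]_x f x = \int[expo]_x g x)%E.
Proof.
move=> mf mg f0 g0 fg; rewrite !(integral_expo false)//.
apply: eq_integral => x _; rewrite /expo_density /=.
by case: ifP => [/fg ->|]; rewrite ?mule0.
Qed.

Section renyi_representation.
Local Open Scope ereal_scope.
Local Notation E := (iint expo).

(** A fresh exponential [x] of rate 1 competes with the head of the list, of rate [a = n + 1] in the
    inductive step. If [x] comes first it is the new head, and the list restarts from it by lack of
    memory. Otherwise the old head stays, and its distance to [x] is a fresh exponential to be
    inserted into the tail, which is the induction hypothesis. Either way the new head has rate
    [n + 2]. *)
Lemma iint_insert_renyi n (h : seq R -> \bar R) :
  mlist_fun n.+1 (fun _ : unit => h) -> (forall l, size l = n.+1 -> 0 <= h l) ->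
  \int[expo]_x E n (fun l => h (insert x (renyi l))) =
  E n.+1 (fun l => h (renyi l)).
Proof.
elim: n h => [|n IH] h mh h0.
  by apply: eq_integral => x _ /=; rewrite divr1.
pose a : R := n.+1%:R.
have a0 : (0 < a)%R by rewrite ltr0n.
have a1 : (1 + a = n.+2%:R)%R by rewrite -[n.+2]add1n natrD.
pose shift m l := [seq (m + y)%R | y <- l] : seq R.
pose phi x y := E n (fun l => h (insert x (y :: shift y (renyi l)))).
have phi0 x y : 0 <= phi x y.
  apply: iint_ge0 => l ln; apply: h0.
  by rewrite size_insert /= size_map size_renyi ln.
have mphi : measurable_fun setT (fun z : R * R => phi z.1 z.2).
  apply: (measurable_iint expo (H := fun (z : R * R) l =>
      h (insert z.1 (z.2 :: shift z.2 (renyi l))))).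
    move=> d D g L mg mL; apply: (mh _ _ (fun=> tt)) => //.
    apply: mlist_insert; first exact: measurableT_comp.
    apply: mlist_cons; first exact: measurableT_comp.
    apply: mlist_shift; first exact: measurableT_comp.
    exact: mlist_renyi.
  move=> z l ln; apply: h0.
  by rewrite size_insert /= size_map size_renyi ln.
transitivity (\int[expo]_x \int[expo]_e phi x (e / a)%R).
  apply: eq_integral => x _ /=; apply: eq_integral => e _.
  by apply: eq_iint => l ln; rewrite ln.
rewrite competing_exponentials//.
pose Phi m := E n.+1 (fun l => h (m :: shift m (renyi l))).
have Phi0 m : 0 <= Phi m.
  by apply: iint_ge0 => l ln; apply: h0; rewrite /= size_map size_renyi ln.
have mPhi : measurable_fun setT Phi.
  apply: (measurable_iint expo (H := fun m l => h (m :: shift m (renyi l)))).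
    move=> d D g L mg mL; apply: (mh _ _ (fun=> tt)) => //.
    by apply: mlist_cons => //; apply: mlist_shift => //; exact: mlist_renyi.
  by move=> z l ln; apply: h0; rewrite /= size_map size_renyi ln.
have mphi2 (u v : R -> R) : measurable_fun setT u -> measurable_fun setT v ->
    measurable_fun setT (fun r => phi (u r) (v r)).
  move=> mu mv; apply: (measurableT_comp mphi (f := fun z : R * R => phi z.1 z.2)
    (g := fun r : R => (u r, v r))).
  exact: measurable_fun_pair.
have mh' m : mlist_fun n.+1 (fun _ : unit => fun l => h (m :: shift m l)).
  move=> d D g L mg mL; apply: (mh _ _ (fun=> tt)) => //.
  have mc : measurable_fun setT (fun _ : D => m) by exact: measurable_cst.
  by apply: mlist_cons => //; exact: mlist_shift.
have h'0 m l : size l = n.+1 -> 0 <= h (m :: shift m l).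
  by move=> ln; apply: h0; rewrite /= size_map ln.
have miint (F : R -> seq R -> seq R) m :
    (forall d (D : measurableType d) (g : D -> R) (L : D -> seq R),
      measurable_fun setT g -> mlist n L -> mlist n.+1 (fun w => F (g w) (L w))) ->
    measurable_fun setT (fun r => E n (fun l => h (m :: shift m (F r l)))).
  move=> mF; apply: (measurable_iint expo (H := fun r l => h (m :: shift m (F r l)))).
    by move=> d D g L mg mL; apply: (mh' m _ _ (fun=> tt)) => //; exact: mF.
  move=> r l ln; apply: h'0.
  have mr : measurable_fun setT (fun _ : R => r) by exact: measurable_cst.
  have ml : mlist n (fun _ : R => l) by split => // i; exact: measurable_cst.
  by have [/(_ 0%R)] := mF _ _ _ _ mr ml.
(* Here [x] comes first, and [r / a] is what remains of the old head. *)
have T1 m : \int[expo]_r phi m (m + r / a)%R = Phi m.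
  transitivity (\int[expo]_r E n (fun l => h (m :: shift m
      (r / a :: shift (r / a) (renyi l))%R))).
    apply: eq_integral_expo.
    + apply: mphi2 => //; apply: measurable_funD => //; exact: measurable_funM.
    + apply: (miint (fun r l => (r / a)%R :: shift (r / a)%R (renyi l))).
      move=> d D g L mg mL.
      have mga : measurable_fun setT (fun w => g w / a)%R by exact: measurable_funM.
      by apply: mlist_cons => //; apply: mlist_shift => //; exact: mlist_renyi.
    + by move=> x.
    + move=> x; apply: iint_ge0 => l ln; apply: h'0.
      by rewrite /= size_map size_renyi ln.
    move=> r r0; apply: eq_iint => l ln; congr h => /=.
    rewrite lerDl divr_ge0 ?ltW//; congr (_ :: _ :: _).
    by rewrite /shift -map_comp; apply: eq_map => y /=; rewrite addrA.
  by apply: eq_integral => r _ /=; apply: eq_iint => l ln; rewrite /= ln.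
(* Here the old head comes first, and the excess [r] of [x] goes into the shifted tail. *)
have T2 m : \int[expo]_r phi (m + r)%R m = Phi m.
  rewrite /Phi -(IH _ (mh' m))//; last exact: h'0.
  apply: eq_integral_expo.
  + by apply: mphi2 => //; exact: measurable_funD.
  + apply: (miint (fun r l => insert r (renyi l))) => d D g L mg mL.
    by apply: mlist_insert => //; exact: mlist_renyi.
  + by move=> x.
  + move=> x; apply: iint_ge0 => l ln; apply: h'0.
    by rewrite size_insert size_renyi ln.
  move=> r r0; apply: eq_iint => l ln; congr h => /=.
  by rewrite gerDl leNgt r0 /= insert_shift.
under eq_integral do rewrite T1.
under [X in _ + _ * X]eq_integral do rewrite T2.
rewrite -ge0_muleDl ?lee_fin ?divr_ge0 ?addr_ge0 ?ltW//.
rewrite -EFinD -mulrDl divff ?mul1e; last by rewrite gt_eqF// addr_gt0.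
rewrite -[RHS]/(\int[expo]_m E n.+1 (fun l => h (renyi (m :: l)))).
apply: eq_integral => m _; rewrite a1.
by apply: eq_iint => l ln; rewrite /= ln.
Qed.

Lemma iint_renyi n (h : seq R -> \bar R) :
  mlist_fun n (fun _ : unit => h) -> (forall l, size l = n -> 0 <= h l) ->
  E n (fun l => h (isort l)) = E n (fun l => h (renyi l)).
Proof.
elim: n h => [//|n IH] h mh h0.
rewrite -(iint_insert_renyi mh h0) /=; apply: eq_integral => x _.
apply: (IH (fun l => h (insert x l))) => [d D g L mg mL|l ln].
  by apply: (mh _ _ (fun=> tt)) => //; apply: mlist_insert => //; exact: measurable_cst.
by apply: h0; rewrite size_insert ln.
Qed.

End renyi_representation.
End renyi.

(** * The quantile transform of an exponential variable *)

Section quantile_transform.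
Context {R : realType}.

Lemma probability_eq_cdf (P1 P2 : probability R R) :
  (forall x : R, P1 `]-oo, x]%classic = P2 `]-oo, x]%classic) ->
  forall A, measurable A -> P1 A = P2 A.
Proof.
move=> P12 A mA.
apply: (@measure_unique _ R R (@RGenOInfty.G R)
  (fun n => `](- n%:R)%R, +oo[%classic)) => //.
- exact: RGenOInfty.measurableE.
- move=> _ _ [x ->] [y ->]; exists (Num.max x y).
  by apply/seteqP; split => z /=; rewrite !in_itv /= !andbT gt_max;
    [case=> -> ->|case/andP].
- by move=> n; exists (- n%:R).
- rewrite -subTset => x _; exists (Num.bound `|x|) => //=.
  rewrite in_itv /= andbT ltrNl.
  by rewrite (le_lt_trans _ (archi_boundP (normr_ge0 x)))// -normrN ler_norm.
- move=> _ [x ->].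
  have -> : `]x, +oo[%classic = ~` `]-oo, x]%classic by rewrite setCitvl.
  transitivity (1 - P1 `]-oo, x]%classic)%E; first exact: probability_setC.
  by rewrite P12; apply/esym; exact: probability_setC.
- by move=> n; rewrite ltey_eq fin_num_measure.
Qed.

(** By its density [expo] charges the positive reals only. *)
Lemma expo_eq_pos (A B : set R) : measurable A -> measurable B ->
  (forall x, 0 < x -> A x <-> B x) -> expo A = expo B.
Proof.
move=> mA mB AB.
have mI (C : set R) : measurable C -> measurable_fun setT (fun x : R => (\1_C x : R)%:E).
  by move=> mC; apply/measurable_EFinP; exact: measurable_indic.
have E (C : set R) : measurable C -> expo C = (\int[expo]_x (\1_C x)%:E)%E.
  by move=> mC; rewrite integral_indic// setIT.
rewrite !E//; apply: (eq_integral_expo (mI _ mA) (mI _ mB)) => x.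
- by rewrite lee_fin.
- by rewrite lee_fin.
- move=> x0; congr (_%:E); rewrite !indicE; congr (_%:R).
  congr nat_of_bool; apply/idP/idP; rewrite !inE => Ax.
    exact: (AB _ x0).1.
  exact: (AB _ x0).2.
Qed.

Lemma expo_cdf (t : R) : 0 <= t -> expo `]-oo, t]%classic = (1 - expR (- t))%:E.
Proof.
rewrite le_eqVlt => /predU1P[<-|t0].
  rewrite oppr0 expR0 subrr; transitivity (expo (set0 : set R)).
    apply: expo_eq_pos => // x x0; rewrite /= in_itv /= leNgt x0; by split.
  exact: measure0.
rewrite (@expo_eq_pos _ `[0, t]%classic)//; last first.
  by move=> x x0; rewrite /= !in_itv /= (ltW x0).
by rewrite expoE exponential_prob_itv0c// mulN1r.
Qed.

Definition exp_quantile (F : R -> R) (t : R) : R := expR (log_quantile F (expR (- t))).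

Section law.
Variable F : R -> R.
Hypothesis F_nd : forall x y, x <= y -> F x <= F y.
Hypothesis F_rc : right_continuous F.
Hypothesis F01 : forall x, 0 <= F x <= 1.
Hypothesis F1 : F 1 = 0.
Hypothesis F_lim : forall p, p < 1 -> exists x, 1 < x /\ p <= F x.

Let S (u : R) : set R := [set x | 1 - u <= F (expR x)].

Let S_gt0 u x : u < 1 -> S u x -> 0 < x.
Proof.
move=> u1 Sx; rewrite ltNge; apply/negP => x0.
have : F (expR x) <= F 1 by apply: F_nd; rewrite -expR0 ler_expR.
by rewrite F1 => Fx; move: (le_trans Sx Fx); rewrite leNgt subr_gt0 u1.
Qed.

Let S_inf u : 0 < u -> u < 1 -> has_inf (S u).
Proof.
move=> u0 u1; split; last by exists 0 => x /(S_gt0 u1) /ltW.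
have [|x [x1 Fx]] := F_lim (p := 1 - u); first by rewrite gtrBl.
by exists (ln x); rewrite /S /= lnK// posrE (lt_trans _ x1).
Qed.

(** The Galois connection between a distribution function and its generalized inverse: right
    continuity of [F] makes the infimum belong to the set. *)
Lemma log_quantile_le u x : 0 < u < 1 ->
  (log_quantile F u <= x) = (1 - u <= F (expR x)).
Proof.
move=> /andP[u0 u1]; have [Sne Slb] := S_inf u0 u1.
apply/idP/idP => [qx|Sx]; last exact: ge_inf.
have cF : F y @[y --> (expR x)^'+] --> F (expR x) by exact: F_rc.
apply: (cvgr_to_ge cF); near=> y.
have xy : expR x < y by near: y; exact: nbhs_right_gt.
have y0 : 0 < y by exact: lt_trans (expR_gt0 x) xy.
have : log_quantile F u < ln y by rewrite (le_lt_trans qx)// -ltr_expR lnK.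
move=> /(inf_lt Sne)[z Sz zy]; apply: le_trans Sz _.
by apply: F_nd; rewrite -(lnK y0) ler_expR ltW.
Unshelve. all: by end_near. Qed.

Lemma exp_quantile_le t y : 0 < t -> 0 < y ->
  (exp_quantile F t <= y) = (1 - expR (- t) <= F y).
Proof.
move=> t0 y0; rewrite /exp_quantile -{1}(lnK y0) ler_expR log_quantile_le ?lnK//.
by rewrite expR_gt0 expR_lt1 oppr_lt0.
Qed.

(** For such [u] the defining set is all of R and [inf] takes its default 0. The values at [u < 1]
    lie above 0, so monotonicity extends to all [u > 0], that is to [expR (- t)] for every real
    [t]. *)
Lemma log_quantile_ge1 u : 1 <= u -> log_quantile F u = 0.
Proof.
move=> u1; rewrite /log_quantile /ginv; apply: inf_out => -[_ [x lbx]].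
have := lbx (x - 1); rewrite /= lerBrDr gerDl ler10 => H; apply: notF; apply: H.
by apply: le_trans (andP (F01 _)).1; rewrite subr_le0.
Qed.

Lemma log_quantile_ge0 u : 0 < u -> 0 <= log_quantile F u.
Proof.
move=> u0; have [u1|/log_quantile_ge1 ->//] := ltP u 1.
apply: lb_le_inf; first by have [] := S_inf u0 u1.
by move=> x /(S_gt0 u1)/ltW.
Qed.

Lemma log_quantile_ni u v : 0 < u -> u <= v -> log_quantile F v <= log_quantile F u.
Proof.
move=> u0 uv; have [v1|/log_quantile_ge1 ->] := ltP v 1; last exact: log_quantile_ge0.
have u1 := le_lt_trans uv v1; have v0 := lt_le_trans u0 uv.
rewrite log_quantile_le ?v0//; apply: le_trans (_ : 1 - u <= _).
  by rewrite lerD2l lerN2.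
by rewrite -log_quantile_le ?u0.
Qed.

Lemma exp_quantile_nd t t' : t <= t' -> exp_quantile F t <= exp_quantile F t'.
Proof.
by move=> tt'; rewrite ler_expR log_quantile_ni ?expR_gt0// ler_expR lerN2.
Qed.

Lemma measurable_exp_quantile : measurable_fun setT (exp_quantile F).
Proof.
apply: (nondecreasing_measurable measurableT) => x y; exact: exp_quantile_nd.
Qed.

Lemma exp_quantile_law y :
  expo (exp_quantile F @^-1` `]-oo, y]%classic) = (F y)%:E.
Proof.
have mA : measurable (exp_quantile F @^-1` `]-oo, y]%classic).
  by rewrite -[X in measurable X]setTI; apply: measurable_exp_quantile.
have [Fy0 Fy1] := andP (F01 y).
have [y0|y0] := leP y 0.
  have -> : exp_quantile F @^-1` `]-oo, y]%classic = set0.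
    apply/seteqP; split => // t /=; rewrite in_itv /= => qy.
    by have := lt_le_trans (expR_gt0 _) (le_trans qy y0); rewrite ltxx.
  rewrite measure0; congr EFin; apply/eqP; rewrite eq_le Fy0 /= -F1.
  by apply: F_nd; exact: le_trans y0 ler01.
(* For [F y = 1] the threshold [- ln (1 - F y)] used below would have to be infinite. *)
have [Fy|Fy] := eqVneq (F y) 1.
  rewrite (@expo_eq_pos _ setT) ?probability_setT ?Fy// => t t0; split => // _.
  by rewrite /= in_itv /= exp_quantile_le// Fy gerBl expR_ge0.
have Fy1' : F y < 1 by rewrite lt_neqAle Fy.
have p0 : 0 < 1 - F y by rewrite subr_gt0.
rewrite (@expo_eq_pos _ `]-oo, - ln (1 - F y)]%classic)//; last first.
  move=> t t0 /=; rewrite !in_itv /= exp_quantile_le//.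
  have -> : (t <= - ln (1 - F y)) = (1 - F y <= expR (- t)).
    by rewrite lerNr -[LHS]ler_expR lnK.
  by rewrite lerBlDr lerBlDl addrC.
rewrite expo_cdf; first by rewrite opprK lnK// subKr.
by rewrite oppr_ge0 ln_le0// gerBl.
Qed.

End law.

Lemma iint_image (mu : probability R R) (psi : R -> R) (mpsi : measurable_fun setT psi)
    n (h : seq R -> \bar R) :
  mlist_fun n (fun _ : unit => h) -> (forall l, size l = n -> 0 <= h l)%E ->
  iint (image_probability mu mpsi) n h = iint mu n (fun l => h (map psi l)).
Proof.
elim: n h => [//|n IH] h mh h0 /=.
rewrite integral_image_probability.
- apply: eq_integral => x _; apply: IH; first exact: mlist_fun_curry.
  by move=> l ln; apply: h0; rewrite /= ln.
- apply: (measurable_iint _ (H := fun y l => h (y :: l))).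
    exact: mlist_fun_cons.
  by move=> x l ln; apply: h0; rewrite /= ln.
- by move=> x; apply: iint_ge0 => l ln; apply: h0; rewrite /= ln.
Qed.

Lemma mlist_map d (D : measurableType d) (psi : R -> R) n (L : D -> seq R) :
  measurable_fun setT psi -> mlist n L -> mlist n (fun w => map psi (L w)).
Proof.
move=> mpsi [sL mL]; split=> [w|i]; first by rewrite size_map sL.
have [ni|ni] := ltnP i n; last first.
  rewrite (_ : (fun w => _) = cst 0); first exact: measurable_cst.
  by apply/funext => w; rewrite nth_default// size_map sL.
rewrite (_ : (fun w => _) = psi \o (fun w => nth 0 (L w) i)).
  exact: measurableT_comp.
by apply/funext => w; rewrite (nth_map 0)// sL.
Qed.

Lemma isort_map (psi : R -> R) l : {homo psi : x y / x <= y} ->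
  isort (map psi l) = map psi (isort l).
Proof.
move=> hpsi; rewrite !isortE.
apply: (sorted_eq (leT := <=%R)); [exact: le_trans|exact: le_anti|exact: sort_le_sorted| |].
  rewrite (homo_sorted (e := <=%R))//; exact: sort_le_sorted.
by rewrite perm_sort perm_sym; apply: perm_map; rewrite perm_sort.
Qed.

(** [renyi] divides each entry by the length of the list that it heads; listing the variables by
    decreasing index makes this length equal to the index. *)
Lemma nth_renyi (e : nat -> R) n i : (i < n)%N ->
  nth 0 (renyi [seq e j | j <- rev (iota 1 n)]) i =
  \sum_(n - i <= m < n.+1) e m / m%:R.
Proof.
elim: n i => [//|n IH] i iSn.
have -> : rev (iota 1 n.+1) = n.+1 :: rev (iota 1 n).
  by have := iotaD 1 n 1; rewrite addn1 => ->; rewrite rev_cat /= add1n.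
rewrite /= size_map size_rev size_iota.
case: i iSn => [|i] iSn /=; first by rewrite subn0 big_nat1.
rewrite (nth_map 0); last by rewrite size_renyi size_map size_rev size_iota.
by rewrite subSS IH// [RHS]big_nat_recr 1?addrC//= leqW// leq_subr.
Qed.

End quantile_transform.

(** * The law of the statistic as a function of exponential variables *)

Section transfer.
Context {R : realType}.

(* By Renyi's representation [V j] has the law of the order statistic of rank
   n - j + 1 in an exponential sample of size n. *)
Definition T_quantile (q : R -> R) (f : nat -> R) (s : R) (k n : nat) (e : nat -> R) : R :=
  let V j := \sum_(j <= m < n.+1) e m / m%:R in
  \sum_(1 <= j < k.+1) f j * (q (V j) - q (V j.+1)) `^ s.

(** [T_stat] read off the sorted sample: the order statistic of rank [i] sits at position [i.-1]. *)
Let T_list (f : nat -> R) (s : R) (k n : nat) (l : seq R) : R :=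
  \sum_(1 <= j < k.+1) f j *
    (ln (nth 0 l (n - j)) - ln (nth 0 l (n - j).-1)) `^ s.

Let measurable_T_list f s k n d (D : measurableType d) (L : D -> seq R) :
  mlist n L -> measurable_fun setT (fun w => T_list f s k n (L w)).
Proof.
move=> mL; apply: measurable_sum => j; apply: measurable_funM => //.
apply: (@measurableT_comp _ _ _ _ _ _ (fun x : R => x `^ s)) => //.
by apply: measurable_funB; apply: measurableT_comp; try exact: mL.2.
Qed.

Let T_list_renyi f s k n (q : R -> R) (e : nat -> R) : (k < n)%N ->
  T_list f s k n (map (fun t => expR (q t)) (renyi [seq e j | j <- rev (iota 1 n)])) =
  T_quantile q f s k n e.
Proof.
move=> kn; rewrite /T_quantile /T_list; apply: eq_big_nat => j /andP[j1 jk].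
have jn : (j < n)%N by exact: leq_trans jk _.
have sz : size (renyi [seq e j | j <- rev (iota 1 n)]) = n.
  by rewrite size_renyi size_map size_rev size_iota.
have nj : (n - j < n)%N by rewrite ltn_subrL j1; exact: leq_ltn_trans jn.
have nj' : ((n - j).-1 < n)%N by exact: leq_ltn_trans (leq_pred _) nj.
rewrite (nth_map 0); last by rewrite sz.
rewrite [X in _ - ln X](nth_map 0); last by rewrite sz.
rewrite !expRK nth_renyi; last exact: nj.
rewrite nth_renyi; last exact: nj'.
by rewrite subKn -?subnS ?subKn//; exact: ltnW.
Qed.

Variables (d : measure_display) (T : measurableType d) (P : probability T R).
Variables (X : nat -> {RV P >-> R}) (F : R -> R).
Hypothesis indX : mutually_independent X.
Hypothesis cdfX : forall i, (0 < i)%N -> forall x : R, cdf (X i) x = (F x)%:E.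
Hypothesis X1 : forall i, (0 < i)%N -> {ae P, forall w, 1 < X i w}.

Let F_nd x y : x <= y -> F x <= F y.
Proof.
move=> xy; rewrite -lee_fin -(cdfX (ltn0Sn 0)) -(cdfX (ltn0Sn 0)).
exact: cdf_nondecreasing.
Qed.

Let F_rc : right_continuous F.
Proof.
move=> x; have := @cdf_right_continuous _ _ _ P (X 1%N) x.
rewrite (_ : cdf (X 1%N) = EFin \o F); last by apply/funext => y; exact: cdfX.
by move/fine_cvgP => [_]; exact.
Qed.

Let F01 x : 0 <= F x <= 1.
Proof.
have Fx := cdfX (ltn0Sn 0) x.
by rewrite -!lee_fin -Fx cdf_ge0 cdf_le1.
Qed.

Let F1 : F 1 = 0.
Proof.
apply: EFin_inj; rewrite -(cdfX (ltn0Sn 0)) /cdf /distribution /pushforward.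
have [N [mN PN sub]] := X1 (ltn0Sn 0).
apply/eqP; rewrite eq_le measure_ge0 andbT.
apply: le_trans (_ : P N <= _)%E; last by rewrite PN.
apply: le_measure.
- by rewrite inE -[X in measurable X]setTI; exact: measurable_funP.
- by rewrite inE.
- apply: subset_trans sub => w /=; rewrite in_itv /= => + Xw.
  by rewrite leNgt Xw.
Qed.

Let F_lim p : p < 1 -> exists x, 1 < x /\ p <= F x.
Proof.
move=> p1; have := @cvg_cdfy1 _ _ _ P (X 1%N).
rewrite (_ : cdf (X 1%N) = EFin \o F); last by apply/funext => y; exact: cdfX.
move/fine_cvgP => [_] cF.
have Fx : \forall x \near +oo, p <= F x by exact: (cvgr_ge _ cF).
have /filter_ex[x [x1 px]] : \forall x \near +oo, 1 < x /\ p <= F x.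
  exact: (filterI (nbhs_pinfty_gt (num_real 1)) Fx).
by exists x.
Qed.

Lemma log_quantile_decreasing u v : 0 < u -> u <= v ->
  log_quantile F v <= log_quantile F u.
Proof. exact: (log_quantile_ni F_nd F_rc F01 F1 F_lim). Qed.

Variables (d' : measure_display) (T' : measurableType d') (Q : probability T' R).
Variable E : nat -> {RV Q >-> R}.
Hypothesis hE : iid_std_exponential E.

Let mpsi : measurable_fun setT (exp_quantile F).
Proof. exact: (measurable_exp_quantile F_nd F_rc F01 F1 F_lim). Qed.

Let lawX j A : (0 < j)%N -> measurable A ->
  P (X j @^-1` A) = image_probability expo mpsi A.
Proof.
move=> j0 mA; rewrite -(@probability_eq_cdf _ (distribution P (X j)) _ _ _ mA)//.
move=> x; transitivity (F x)%:E; first exact: cdfX.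
by apply/esym; exact: (exp_quantile_law F_nd F_rc F01 F1 F_lim).
Qed.

(** Both sides become iterated integrals against [expo]. On the left the law of [X i] is the image
    of [expo] under the quantile, which commutes with sorting because it is nondecreasing; on the
    right the indices are reversed in view of [nth_renyi]. Renyi's representation joins the two. *)
Lemma integral_order_stat n (h : seq R -> \bar R) :
  mlist_fun n (fun _ : unit => h) -> (forall l, size l = n -> 0 <= h l)%E ->
  (\int[P]_w h (sort <=%R [seq X j w | j <- iota 1 n]) =
   \int[Q]_w h (map (exp_quantile F) (renyi [seq E j w | j <- rev (iota 1 n)])))%E.
Proof.
move=> mh h0.
have pos J : {in J, forall i, (0 < i)%N} -> {in rev J, forall i, (0 < i)%N}.
  by move=> H i; rewrite mem_rev; exact: H.
have pos1 : {in iota 1 n, forall i, (0 < i)%N}.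
  by move=> i; rewrite mem_iota => /andP[].
have mis : mlist_fun n (fun _ : unit => fun l => h (isort l)).
  by move=> d0 D g L mg mL; apply: (mh _ _ (fun=> tt)) => //; exact: mlist_isort.
have mmap : mlist_fun n (fun _ : unit => fun l => h (map (exp_quantile F) l)).
  by move=> d0 D g L mg mL; apply: (mh _ _ (fun=> tt)) => //; exact: (mlist_map mpsi).
have mren : mlist_fun n (fun _ : unit => fun l => h (map (exp_quantile F) (renyi l))).
  move=> d0 D g L mg mL; apply: (mh _ _ (fun=> tt)) => //.
  by apply: (mlist_map mpsi); exact: mlist_renyi.
under eq_integral do rewrite -isortE.
rewrite (integral_sample indX lawX (h := fun l => h (isort l))) ?size_iota ?iota_uniq//;
  last by move=> l ln; apply: h0; rewrite size_isort.
rewrite iint_image//; last by move=> l ln; apply: h0; rewrite size_isort.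
have lawE j A : (0 < j)%N -> measurable A -> Q (E j @^-1` A) = expo A.
  by move=> j0 mA; rewrite hE.2.
have := @integral_sample _ _ _ Q E hE.1 expo lawE (rev (iota 1 n))
  (fun l => h (map (exp_quantile F) (renyi l))).
rewrite rev_uniq iota_uniq size_rev size_iota => -> //; first last.
- by move=> l ln; apply: h0; rewrite size_map size_renyi.
- exact: pos.
rewrite -(iint_renyi mmap); last by move=> l ln; apply: h0; rewrite size_map.
apply: eq_iint => l ln; congr h; apply: isort_map => x y; exact: (exp_quantile_nd F_nd F_rc F01 F1 F_lim).
Qed.

Lemma T_stat_quantile (f : nat -> R) (s : R) (k n : nat) (B : set R) : (k < n)%N ->
  measurable B ->
  P [set w | B (T_stat f s k n (fun i => X i w))] =
  Q [set w | B (T_quantile (fun t => log_quantile F (expR (- t))) f s k n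
                  (fun i => E i w))].
Proof.
move=> kn mB.
have mT d0 (D : measurableType d0) (L : D -> seq R) : mlist n L ->
    measurable [set w | B (T_list f s k n (L w))].
  move=> mL; rewrite -[X in measurable X]setTI.
  exact: (measurable_T_list f s k mL).
have mls d0 (D : measurableType d0) (Z : nat -> {mfun D >-> R}) J :
    mlist (size J) (fun w => [seq Z j w | j <- J]).
  split=> [w|i]; first by rewrite size_map.
  have [iJ|iJ] := ltnP i (size J); last first.
    rewrite (_ : (fun w => _) = cst 0%R); first exact: measurable_cst.
    by apply/funext => w; rewrite nth_default// size_map.
  rewrite (_ : (fun w => _) = Z (nth 0%N J i)); first exact: measurable_funP.
  by apply/funext => w; rewrite (nth_map 0%N).
have mX := mls _ _ X (iota 1 n); rewrite size_iota in mX.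
have mE := mls _ _ E (rev (iota 1 n)); rewrite size_rev size_iota in mE.
have := @integral_order_stat n (fun l => (\1_B (T_list f s k n l))%:E).
have mh : mlist_fun n (fun _ : unit => fun l => (\1_B (T_list f s k n l))%:E).
  move=> d0 D g L _ mL; apply/measurable_EFinP.
  apply: (@measurableT_comp _ _ _ _ _ _ (\1_B : R -> R)).
    exact: measurable_indic.
  exact: measurable_T_list.
move=> /(_ mh); rewrite (_ : (fun w => (\1_B _)%:E) =
  (fun w => (\1_[set w | B (T_stat f s k n (fun i => X i w))] w)%:E)) => [|//].
rewrite (_ : (fun w => (\1_B (T_list _ _ _ _ (map _ (renyi _))))%:E) =
  (fun w => (\1_[set w | B (T_quantile (fun t => log_quantile F (expR (- t)))
    f s k n (fun i => E i w))] w)%:E)); last first.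
  by apply/funext => w; rewrite T_list_renyi.
rewrite !integral_indic//.
- by rewrite !setIT; apply => l _; rewrite lee_fin.
- rewrite (_ : [set w | _] = [set w | B (T_list f s k n
      (map (exp_quantile F) (renyi [seq E j w | j <- rev (iota 1 n)])))]).
    by apply: mT; apply: (mlist_map mpsi); exact: mlist_renyi.
  by apply/seteqP; split => w /=; rewrite T_list_renyi.
- rewrite (_ : [set w | _] = [set w | B (T_list f s k n
      (isort [seq X j w | j <- iota 1 n]))]).
    by apply: mT; exact: mlist_isort.
  by apply/seteqP; split => w /=; rewrite isortE.
Qed.

End transfer.

Lemma integral_cst_probability d (T : measurableType d) (R : realType)
  (P : probability T R) (r : \bar R) : (\int[P]_x r = r)%E.
Proof. by rewrite integral_cst// [X in (_ * X)%E]probability_setT mule1. Qed.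

(** * Moments of powers of an exponential variable *)

Section moments.
Context {R : realType}.
Local Notation leb := (@lebesgue_measure R).
Implicit Types p s x : R.

Lemma measurable_powRr p : measurable_fun setT (fun x : R => x `^ p).
Proof. exact: measurable_powR. Qed.

(** This is [1 + ln y <= y] at [y = x / (2 * p)]. The exponent [x / 2] leaves half of the decay of
    [expR (- x)] for integrability. *)
Lemma powR_le_expR p x : 0 < p -> 0 < x ->
  x `^ p <= expR (p * ln (2 * p)) * expR (x / 2).
Proof.
move=> p0 x0; rewrite /powR gt_eqF// -expRD ler_expR.
have p2 : 0 < 2 * p by rewrite mulr_gt0.
have y0 : 0 < x / (2 * p) by rewrite divr_gt0.
have := expR_ge1Dx (ln (x / (2 * p))); rewrite lnK// => H.
have E : ln (x / (2 * p)) = ln x - ln (2 * p) by rewrite ln_div.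
have : p * (1 + (ln x - ln (2 * p))) <= p * (x / (2 * p)).
  by rewrite ler_pM2l// -E.
have -> : p * (x / (2 * p)) = x / 2 by field; rewrite gt_eqF.
by lra.
Qed.

Lemma expo_powR_lty p : 0 <= p -> (\int[expo]_x (x `^ p)%:E < +oo)%E.
Proof.
rewrite le_eqVlt => /predU1P[<-|p0].
  under eq_integral do rewrite powRr0.
  by rewrite integral_cst_probability ltry.
pose C := expR (p * ln (2 * p)).
have mE : measurable_fun setT (fun x : R => (x `^ p)%:E).
  by apply/measurable_EFinP; exact: measurable_powRr.
rewrite (integral_expo false)//; last by move=> x; rewrite lee_fin powR_ge0.
have I1 : (\int[leb]_x (1 * (2^-1 * expo_density false (2^-1 * x))%:E) = 1)%E.
  have := @integral_expo_scale R false 2^-1 (cst 1%E) _ (measurable_cst _) (fun=> lee01).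
  rewrite invr_gt0 ltr0n => /(_ isT) <-.
  by rewrite integral_cst_probability.
apply: (@le_lt_trans _ _ (\int[leb]_x ((2 * C)%:E *
    (1 * (2^-1 * expo_density false (2^-1 * x))%:E)))%E); last first.
  rewrite ge0_integralZl ?I1 ?mule1 ?ltry//.
  - apply: emeasurable_funM => //; apply/measurable_EFinP.
    apply: measurable_funM => //; apply: measurableT_comp.
      exact: measurable_expo_density.
    exact: measurable_funM.
  - by move=> x _; rewrite mul1e lee_fin mulr_ge0 ?expo_density_ge0// invr_ge0.
  - by rewrite lee_fin mulr_ge0 ?expR_ge0.
apply: ge0_le_integral => //.
- by move=> x _; rewrite mule_ge0// lee_fin ?powR_ge0 ?expo_density_ge0.
- apply: emeasurable_funM => //; apply/measurable_EFinP.
  exact: measurable_expo_density.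
- apply: emeasurable_funM => //; apply: emeasurable_funM => //.
  apply/measurable_EFinP.
  apply: measurable_funM => //; apply: measurableT_comp.
    exact: measurable_expo_density.
  exact: measurable_funM.
move=> x _; rewrite mul1e -!EFinM lee_fin /expo_density /=.
rewrite pmulr_rgt0 ?invr_gt0//; case: ifPn => x0; last by rewrite !mulr0.
have -> : 2 * C * (2^-1 * expR (- (2^-1 * x))) = C * expR (- (x / 2)).
  by rewrite [x / 2]mulrC; field.
apply: le_trans (_ : C * expR (x / 2) * expR (- x) <= _).
  by rewrite ler_wpM2r ?expR_ge0// powR_le_expR.
rewrite -mulrA -expRD ler_pM2l ?expR_gt0// ler_expR.
by lra.
Qed.

Lemma expo_powR p : 0 <= p -> (\int[expo]_x (x `^ p)%:E = (Gamma (p + 1))%:E)%E.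
Proof.
move=> p0; have fin := expo_powR_lty p0.
have mE : measurable_fun setT (fun x : R => (x `^ p)%:E).
  by apply/measurable_EFinP; exact: measurable_powRr.
have E : (\int[expo]_x (x `^ p)%:E =
    \int[leb]_(t in `]0%R, +oo[) (t `^ (p + 1 - 1) * expR (- t))%:E)%E.
  rewrite (integral_expo false)//; last by move=> x; rewrite lee_fin powR_ge0.
  rewrite [RHS]integral_mkcond; apply: eq_integral => x _.
  rewrite patchE /expo_density /= mem_setE in_itv /= andbT addrK.
  by case: ifP => // _; rewrite mule0.
rewrite /Gamma /Rintegral -E fineK// fin_numElt fin andbT.
by apply: lt_le_trans (_ : 0 <= _)%E => //; apply: integral_ge0 => x _; rewrite lee_fin powR_ge0.
Qed.

(** At [x = E_j] this is $F_j^{(s)}$ times the square root of [v_coef s]. *)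
Definition centered_pow s x : R := x `^ s - Gamma (s + 1).

Lemma measurable_centered_pow s : measurable_fun setT (centered_pow s).
Proof. by apply: measurable_funB => //; exact: measurable_powRr. Qed.

Lemma expo_integrable_powR p : 0 <= p ->
  expo.-integrable setT (fun x => (x `^ p)%:E).
Proof.
move=> p0; apply/integrableP; split.
  by apply/measurable_EFinP; exact: measurable_powRr.
under eq_integral do rewrite gee0_abs ?lee_fin ?powR_ge0//.
exact: expo_powR_lty.
Qed.

Lemma expo_integrable_cst (r : R) : expo.-integrable setT (fun _ : R => r%:E).
Proof. exact: finite_measure_integrable_cst. Qed.

Lemma integrable_centered_pow s : 0 <= s ->
  expo.-integrable setT (fun x => (centered_pow s x)%:E).
Proof.
move=> s0; rewrite /centered_pow; under eq_fun do rewrite EFinB.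
by apply: integrableB => //; [exact: expo_integrable_powR|exact: expo_integrable_cst].
Qed.

Lemma integral_centered_pow s : 0 <= s ->
  (\int[expo]_x (centered_pow s x)%:E = 0)%E.
Proof.
move=> s0; rewrite /centered_pow; under eq_integral do rewrite EFinB.
rewrite integralB//; [|exact: expo_integrable_powR|exact: expo_integrable_cst].
rewrite expo_powR// integral_cst_probability.
by rewrite -EFinB subrr.
Qed.

Lemma centered_pow_sqr s x : centered_pow s x ^+ 2 =
  x `^ (2 * s) - 2 * Gamma (s + 1) * x `^ s + Gamma (s + 1) ^+ 2.
Proof.
rewrite /centered_pow sqrrB.
have -> : (x `^ s) ^+ 2 = x `^ (2 * s) by rewrite mulrC powRrM powR_mulrn ?powR_ge0.
by congr (_ + _); rewrite -mulr_natr; ring.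
Qed.

Lemma integral_centered_pow_sqr s : 0 < s ->
  (\int[expo]_x (centered_pow s x ^+ 2)%:E = (v_coef s)%:E)%E.
Proof.
move=> s0; have s2 : 0 <= 2 * s by rewrite mulr_ge0// ltW.
have I2 := expo_integrable_powR s2.
have I1 := expo_integrable_powR (ltW s0).
pose G := Gamma (s + 1).
have I3 : expo.-integrable setT (fun x => ((2 * G)%:E * (x `^ s)%:E)%E).
  exact: integrableZl.
transitivity (\int[expo]_x ((x `^ (2 * s))%:E - (2 * G)%:E * (x `^ s)%:E
    + (G ^+ 2)%:E))%E.
  by apply: eq_integral => x _; rewrite centered_pow_sqr.
have mI2 := integrableB measurableT I2 I3.
rewrite integralD//; last exact: expo_integrable_cst.
rewrite integralB// integralZl// !expo_powR ?(ltW s0)//.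
rewrite integral_cst_probability -EFinM -EFinB -EFinD /v_coef -/G; congr EFin.
by ring.
Qed.

Lemma integral_centered_pow_cube_lty s : 0 < s ->
  (\int[expo]_x (`|centered_pow s x| ^+ 3)%:E < +oo)%E.
Proof.
move=> s0; pose G := Gamma (s + 1).
have s3 : 0 <= 3 * s by rewrite mulr_ge0// ltW.
apply: (@le_lt_trans _ _ (\int[expo]_x (4 * x `^ (3 * s) + 4 * `|G| ^+ 3)%:E)%E).
  apply: ge0_le_integral => //.
  - apply/measurable_EFinP; apply: measurable_funX.
    by apply: measurableT_comp => //; exact: measurable_centered_pow.
  - apply/measurable_EFinP; apply: measurable_funD => //.
    by apply: measurable_funM => //; exact: measurable_powRr.
  move=> x _; rewrite lee_fin /centered_pow -/G.
  have -> : x `^ (3 * s) = (x `^ s) ^+ 3 by rewrite mulrC powRrM powR_mulrn ?powR_ge0.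
  have : `|x `^ s - G| <= x `^ s + `|G|.
    by rewrite (le_trans (ler_normB _ _))// ger0_norm ?powR_ge0.
  have := powR_ge0 x s; have := normr_ge0 G.
  move: (x `^ s) `|G| => a b b0 a0 ab.
  apply: le_trans (_ : (a + b) ^+ 3 <= _).
    by rewrite lerXn2r// nnegrE ?addr_ge0.
  (* [4 * a ^+ 3 + 4 * b ^+ 3 - (a + b) ^+ 3] is three times this product. *)
  have : 0 <= (a + b) * (a - b) ^+ 2 by rewrite mulr_ge0 ?addr_ge0 ?sqr_ge0.
  by nra.
have m3 : measurable_fun setT (fun x : R => (x `^ (3 * s))%:E).
  by apply/measurable_EFinP; exact: measurable_powRr.
under eq_integral do rewrite EFinD EFinM.
rewrite ge0_integralD//.
- rewrite ge0_integralZl//; last by move=> x _; rewrite lee_fin powR_ge0.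
  by rewrite expo_powR// integral_cst_probability -EFinM -EFinD ltry.
- by move=> x _; rewrite mule_ge0 ?lee_fin ?powR_ge0.
- exact: emeasurable_funM.
Qed.

(** Beyond [a] the centred power is at least 1, and the exponential law gives this half-line the
    mass exp (- a). *)
Lemma v_coef_gt0 s : 0 < s -> 0 < v_coef s.
Proof.
move=> s0; pose G := Gamma (s + 1).
rewrite -lte_fin -(integral_centered_pow_sqr s0).
pose a := (`|G| + 1) `^ s^-1.
have a0 : 0 < a by rewrite powR_gt0// ltr_wpDl.
have mI : measurable_fun setT (fun x : R => (\1_(`]a, +oo[%classic) x : R)%:E).
  by apply/measurable_EFinP; exact: measurable_indic.
apply: (@lt_le_trans _ _ (\int[expo]_x (\1_(`]a, +oo[%classic) x)%:E)%E).
  rewrite integral_indic// setIT.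
  have -> : `]a, +oo[%classic = ~` `]-oo, a]%classic by rewrite setCitvl.
  have PC : expo (~` `]-oo, a]%classic) = (1 - expo `]-oo, a]%classic)%E.
    exact: probability_setC.
  rewrite [ltRHS]PC expo_cdf; last exact: ltW.
  by rewrite -EFinB lte_fin opprB addrC subrK expR_gt0.
apply: ge0_le_integral => //.
- apply/measurable_EFinP; apply: measurable_funX; exact: measurable_centered_pow.
move=> x _; rewrite lee_fin indicE mem_setE in_itv /= andbT.
case: ltP => [ax|_]; last exact: sqr_ge0.
have : a `^ s <= x `^ s by rewrite ge0_ler_powR// ?nnegrE ltW// (lt_trans a0).
rewrite -powRrM mulVf ?gt_eqF// powRr1 ?addr_ge0// => H.
have : 1 <= centered_pow s x.
  rewrite /centered_pow -/G; have := ler_norm G; lra.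
by move=> H1; rewrite expr_ge1// (le_trans ler01).
Qed.

Definition pow_law s : probability R R := image_probability expo (measurable_centered_pow s).

Lemma pow_law_integrable s : 0 < s ->
  (pow_law s).-integrable setT (fun y => y%:E).
Proof.
move=> s0; apply/integrableP; split; first exact/measurable_EFinP.
rewrite integral_image_probability//; last first.
  change (measurable_fun setT (fun y : R => (`|y|)%:E)).
  by apply/measurable_EFinP; exact: normr_measurable.
by have /integrableP[] := integrable_centered_pow (ltW s0).
Qed.

Lemma pow_law_mean s : 0 < s -> (\int[pow_law s]_y y%:E = 0)%E.
Proof.
move=> s0; rewrite -(integral_centered_pow (ltW s0)).
apply: integral_distribution; first exact/measurable_EFinP.
exact: integrable_centered_pow (ltW s0).
Qed.

Lemma pow_law_var s : 0 < s -> (\int[pow_law s]_y (y ^+ 2)%:E = (v_coef s)%:E)%E.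
Proof.
move=> s0; rewrite -(integral_centered_pow_sqr s0).
apply: integral_image_probability; last by move=> y; rewrite lee_fin sqr_ge0.
by apply/measurable_EFinP; exact: measurable_funX.
Qed.

Lemma pow_law_cube s : 0 < s -> (\int[pow_law s]_y (`|y| ^+ 3)%:E < +oo)%E.
Proof.
move=> s0; have := integral_centered_pow_cube_lty s0.
rewrite [X in _ -> (X < _)%E]integral_image_probability//.
apply/measurable_EFinP; apply: measurable_funX.
exact: normr_measurable.
Qed.

End moments.
#[global] Opaque pow_law.

Lemma measurable_pred_set d (T : measurableType d) (b : T -> bool) :
  measurable_fun setT b -> measurable [set w | b w].
Proof.
move=> mb; rewrite -[X in measurable X]setTI.
rewrite (_ : [set w | b w] = b @^-1` [set true]); last first.
  by apply/seteqP; split.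
exact: mb.
Qed.

Lemma cvge0P {R : realType} (a : nat -> \bar R) : (forall n, 0 <= a n)%E ->
  a @ \oo --> 0%E <-> forall e : R, 0 < e -> \forall n \near \oo, (a n <= e%:E)%E.
Proof.
move=> a0; split=> [/fine_cvgP[fa ca] e e0|H].
  move/cvgrPdist_le : ca => /(_ e e0); apply: filterS2 fa => n fn.
  by rewrite sub0r normrN -[leRHS]/e => /(le_trans (ler_norm _)); rewrite -lee_fin /= fineK.
have fa : \forall n \near \oo, a n \is a fin_num.
  apply: filterS (H 1 ltr01) => n an; rewrite ge0_fin_numE//.
  by apply: le_lt_trans an _; rewrite ltry.
apply/fine_cvgP; split => //; apply/cvgrPdist_le => e e0.
have := H e e0; apply: filterS2 fa => n fn an.
by rewrite sub0r normrN ger0_norm ?fine_ge0//= -lee_fin fineK.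
Qed.

Lemma cvge0_le {R : realType} (a : nat -> \bar R) (b : nat -> R) :
  (forall n, 0 <= a n)%E -> (\forall n \near \oo, (a n <= (b n)%:E)%E) ->
  b @ \oo --> 0 -> a @ \oo --> 0%E.
Proof.
move=> a0 ab b0; apply/(cvge0P a0) => e e0.
move/cvgrPdist_le : b0 => /(_ e e0); apply: filterS2 ab => n anb.
rewrite sub0r normrN => /(le_trans (ler_norm _)) be.
by apply: le_trans anb _; rewrite lee_fin.
Qed.

(** * Kolmogorov's maximal inequality *)

Section kolmogorov.
Context {R : realType}.
Variables (nu : probability R R) (v : R).
Hypothesis nu_int : nu.-integrable setT (fun y => y%:E).
Hypothesis nu0 : (\int[nu]_y y%:E = 0)%E.
Hypothesis nuv : (\int[nu]_y (y ^+ 2)%:E = v%:E)%E.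

(** The event of the maximal inequality. The current partial sum [x] is an argument, so that one
    step of the walk is one unfolding. *)
Fixpoint exceeds (eps x : R) (cs l : seq R) : bool :=
  (eps <= `|x|) ||
  (if cs is c :: cs' then exceeds eps (x + c * nth 0 l 0) cs' (behead l) else false).

Lemma measurable_exceeds d (D : measurableType d) eps (x : D -> R) cs (L : D -> seq R) :
  measurable_fun setT x -> mlist (size cs) L ->
  measurable_fun setT (fun w => exceeds eps (x w) cs (L w)).
Proof.
elim: cs x L => [|c cs IH] x L mx mL /=.
  apply: measurable_or; last exact: measurable_cst.
  by apply: measurable_fun_ler => //; exact: measurableT_comp.
apply: measurable_or.
  by apply: measurable_fun_ler => //; exact: measurableT_comp.
apply: IH; last exact: mlist_behead.
by apply: measurable_funD => //; apply: measurable_funM => //; exact: mL.2.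
Qed.

Lemma integrable_sqr : nu.-integrable setT (fun y => (y ^+ 2)%:E).
Proof.
apply/integrableP; split; first by apply/measurable_EFinP; exact: measurable_funX.
by under eq_integral do rewrite gee0_abs ?lee_fin ?sqr_ge0//; rewrite nuv ltry.
Qed.

Lemma integral_affine_sqr (x c : R) :
  (\int[nu]_y ((x + c * y) ^+ 2)%:E = (x ^+ 2 + c ^+ 2 * v)%:E)%E.
Proof.
have i1 := integrableZl measurableT (2 * x * c) nu_int.
have i2 := integrableZl measurableT (c ^+ 2) integrable_sqr.
have i0 : nu.-integrable setT (fun _ : R => (x ^+ 2)%:E).
  exact: finite_measure_integrable_cst.
have i01 := integrableD measurableT i0 i1.
transitivity (\int[nu]_y ((x ^+ 2)%:E + (2 * x * c)%:E * y%:E +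
    (c ^+ 2)%:E * (y ^+ 2)%:E))%E.
  by apply: eq_integral => y _; rewrite -!EFinM -!EFinD; congr EFin; ring.
rewrite integralD// integralD// !integralZl//; last exact: integrable_sqr.
by rewrite integral_cst_probability nu0 nuv mule0 adde0 -EFinM -EFinD.
Qed.

(** Induction with an arbitrary starting point, in place of stopping times. If [x] is already beyond
    [eps] the bound is at least 1; otherwise one step is integrated, and since (x + c Y)^2 has mean
    x^2 + c^2 v the bound reproduces itself exactly. *)
Lemma kolmogorov_iint eps x cs : 0 < eps ->
  (iint nu (size cs) (fun l => ((exceeds eps x cs l)%:R)%:E) <=
   ((x ^+ 2 + v * \sum_(c <- cs) c ^+ 2) / eps ^+ 2)%:E)%E.
Proof.
move=> e0.
have v0 : 0 <= v.
  by rewrite -lee_fin -nuv; apply: integral_ge0 => y _; rewrite lee_fin sqr_ge0.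
have e20 : 0 < eps ^+ 2 by rewrite exprn_gt0.
have big z : eps <= `|z| -> 1 <= z ^+ 2 / eps ^+ 2.
  move=> ez; rewrite ler_pdivlMr// mul1r -[leRHS]real_normK ?num_real//.
  by rewrite lerXn2r// nnegrE ltW.
elim: cs x => [|c cs IH] x /=.
  rewrite big_nil mulr0 addr0 orbF lee_fin.
  by case: (leP eps `|x|) => [/big //|_]; rewrite divr_ge0// ?sqr_ge0 ?ltW.
rewrite big_cons; have S0 : 0 <= \sum_(c <- cs) c ^+ 2.
  by apply: sumr_ge0 => i _; exact: sqr_ge0.
have [ex|ex] := leP eps `|x|.
  rewrite (_ : (fun y => _) = fun=> 1%E); last first.
    by apply/funext => y /=; rewrite (iint_cst nu).
  rewrite integral_cst_probability lee_fin; apply: le_trans (big _ ex) _.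
  by rewrite ler_pM2r ?invr_gt0// lerDl mulr_ge0// addr_ge0// sqr_ge0.
have mH : mlist_fun (size cs) (fun y l => ((exceeds eps (x + c * y) cs l)%:R : R)%:E).
  move=> d' D g L mg mL; apply/measurable_EFinP.
  rewrite (_ : (fun w => _) = (fun w => if exceeds eps (x + c * g w) cs (L w) then 1 else 0)); last first.
    by apply/funext => w; case: exceeds.
  apply: measurable_fun_ifT => //.
  apply: measurable_exceeds => //.
  by apply: measurable_funD => //; exact: measurable_funM.
apply: (@le_trans _ _ (\int[nu]_y (((x + c * y) ^+ 2 + v * \sum_(c <- cs) c ^+ 2) / eps ^+ 2)%:E)%E).
  apply: ge0_le_integral => //.
  - by move=> y _; apply: (iint_ge0 nu) => l _; rewrite lee_fin.
  - by apply: (measurable_iint nu mH) => *; rewrite lee_fin.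
  - apply/measurable_EFinP; apply: measurable_funM => //; apply: measurable_funD => //.
    by apply: measurable_funX; apply: measurable_funD => //; exact: measurable_funM.
  - by move=> y _; exact: IH.
under eq_integral do rewrite EFinM EFinD.
rewrite ge0_integralZr//; first last.
- by rewrite lee_fin invr_ge0 ltW.
- by move=> y _; rewrite adde_ge0// lee_fin ?sqr_ge0// mulr_ge0.
- apply: emeasurable_funD => //; apply/measurable_EFinP.
  by apply: measurable_funX; apply: measurable_funD => //; exact: measurable_funM.
rewrite ge0_integralD//; first last.
- by move=> y _; rewrite lee_fin mulr_ge0.
- apply/measurable_EFinP.
  by apply: measurable_funX; apply: measurable_funD => //; exact: measurable_funM.
- by move=> y _; rewrite lee_fin sqr_ge0.
rewrite integral_affine_sqr integral_cst_probability -EFinD -EFinM lee_fin.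
by rewrite le_eqVlt; apply/orP; left; apply/eqP; congr (_ / _); ring.
Qed.

Lemma exceedsP eps x (c y : nat -> R) N m :
  exceeds eps x [seq c j | j <- iota N m] [seq y j | j <- iota N m] <->
  exists2 i, (i <= m)%N & eps <= `|x + \sum_(N <= j < N + i) c j * y j|.
Proof.
elim: m x N => [|m IH] x N /=.
  rewrite orbF; split=> [ex|[i]]; first by exists 0%N => //; rewrite addn0 big_geq// addr0.
  by rewrite leqn0 => /eqP ->; rewrite addn0 big_geq// addr0.
split=> [/orP[ex|/IH[i im ei]]|[[|i] im]].
- by exists 0%N => //; rewrite addn0 big_geq// addr0.
- by exists i.+1 => //; rewrite addnS -addSn big_ltn ?leq_addr// addrA.
- by rewrite addn0 big_geq// addr0 => ->.
- rewrite addnS -addSn big_ltn ?leq_addr// addrA => ei.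
  by apply/orP; right; apply/IH; exists i.
Qed.

End kolmogorov.

(** * Convergence of a random series from its oscillations *)

Section random_series.
Context {R : realType} {d : measure_display} {T : measurableType d}
  (Q : probability T R).
Variable S : nat -> T -> R.
Hypothesis mS : forall n, measurable_fun setT (S n).

Definition oscillates (N : nat) (eps : R) : set T :=
  \bigcup_m [set w | eps <= `|S (N + m)%N w - S N w|].

Lemma measurable_oscillates N eps : measurable (oscillates N eps).
Proof.
apply: bigcupT_measurable => m; apply: measurable_pred_set.
by apply: measurable_fun_ler => //; apply: measurableT_comp => //; exact: measurable_funB.
Qed.

Variable r : nat -> R.
Hypothesis r0 : r @ \oo --> 0.
Hypothesis Qr : forall N (eps : R), 0 < eps -> (Q (oscillates N eps) <= (r N / eps ^+ 2)%:E)%E.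

(** The failure of the Cauchy criterion, written with countable operations and hence measurable. *)
Let divergent : set T := \bigcup_p \bigcap_N oscillates N (p.+1%:R^-1).

Let measurable_divergent : measurable divergent.
Proof.
by apply: bigcupT_measurable => p; apply: bigcapT_measurable => N; exact: measurable_oscillates.
Qed.

Let divergentP w : ~ divergent w <-> cvgn (S ^~ w).
Proof.
split=> [nd|cS [p _ Dp]].
  apply/cauchy_cvgP/cauchy_ballP => e e0.
  have [p pe] : exists p : nat, p.+1%:R^-1 < e / 2.
    have e20 : 0 < e / 2 by rewrite divr_gt0.
    have [N _ H] := near_infty_natSinv_lt (PosNum e20).
    by exists N; exact: (H N (leqnn N)).
  have [N HN] : exists N, ~ oscillates N (p.+1%:R^-1) w.
    by apply: contrapT => H; apply: nd; exists p => // N _; apply: contrapT => ?; apply: H; exists N.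
  have HB m : (N <= m)%N -> `|S m w - S N w| < e / 2.
    move=> Nm; apply: lt_trans pe; rewrite ltNge; apply/negP => H; apply: HN.
    by exists (m - N)%N => //=; rewrite subnKC.
  exists ([set x | `|x - S N w| < e / 2], [set x | `|x - S N w| < e / 2]) => /=.
    by split; exists N.
  move=> [x y] [/= H1]; rewrite distrC => H2; rewrite /ball /= [e]splitr.
  apply: le_lt_trans (ltrD H1 H2).
  have -> : x - y = (x - S N w) + (S N w - y) by ring.
  exact: ler_normD.
have e0 : 0 < (p.+1%:R^-1 : R) / 2 by rewrite divr_gt0// invr_gt0.
move/cvgrPdist_lt : cS => /(_ _ e0)[N _ H].
have [m _ /=] := Dp N I; apply/negP; rewrite -ltNge.
have H1 := H N (leqnn _); have H2 := H (N + m)%N (leq_addr _ _).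
rewrite distrC in H2; rewrite [ltRHS]splitr.
apply: le_lt_trans (ltrD H2 H1).
set l := lim _.
have -> : S (N + m)%N w - S N w = (S (N + m)%N w - l) + (l - S N w) by ring.
exact: ler_normD.
Qed.

Let Qosc_cvg eps : 0 < eps -> Q (oscillates N eps) @[N --> \oo] --> 0%E.
Proof.
move=> e0; apply: (@cvge0_le _ _ (fun N => r N / eps ^+ 2)) => //.
  by near=> N; exact: Qr.
by rewrite -(mul0r (eps ^+ 2)^-1); apply: cvgM => //; exact: cvg_cst.
Unshelve. all: by end_near. Qed.

Let Qdivergent : Q divergent = 0%E.
Proof.
apply/(measure_negligible measurable_divergent)/negligible_bigcup => p.
have mI : measurable (\bigcap_N oscillates N (p.+1%:R^-1)).
  by apply: bigcapT_measurable => N; exact: measurable_oscillates.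
apply/negligibleP => //; apply/eqP; rewrite eq_le measure_ge0 andbT.
have p0 : 0 < (p.+1%:R^-1 : R) by rewrite invr_gt0.
have := Qosc_cvg p0 => /cvge0P H; apply/lee_addgt0Pr => e e0.
rewrite add0e; have [N _ /(_ N (leqnn _))] := H (fun=> measure_ge0 _ _) e e0.
apply: le_trans; apply: le_measure; rewrite ?inE//; first exact: measurable_oscillates.
by move=> w /(_ N I).
Qed.

Let mSc n : measurable_fun setT (fun w => if w \in divergent then 0 else S n w).
Proof.
apply: measurable_fun_ifT => //.
apply: (measurable_fun_bool true); rewrite setTI (_ : _ @^-1` _ = divergent)//.
by apply/seteqP; split => w /=; [move/set_mem|move/mem_set].
Qed.

(** Where the sequence diverges [lim] takes its default 0. The sequence set to 0 on [divergent]
    therefore converges everywhere, to this very function. *)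
Lemma measurable_limn_series : measurable_fun setT (fun w => limn (S ^~ w)).
Proof.
apply: (measurable_fun_cvg (fun n => mSc n)) => w _.
have [wD|wD] := pselect (divergent w).
  rewrite mem_set// (_ : limn _ = 0); first exact: cvg_cst.
  by apply: dvgP => /divergentP.
by rewrite memNset//; exact/divergentP.
Qed.

Lemma limn_series_cvg_in_probability :
  cvg_in_probability Q (fun n w => S n w - limn (S ^~ w)) 0.
Proof.
move=> e e0; have e20 : 0 < e / 2 by rewrite divr_gt0.
have mD n : measurable [set w | e <= `|S n w - limn (S ^~ w) - 0|].
  apply: measurable_pred_set; apply: measurable_fun_ler => //.
  apply: measurableT_comp => //; apply: measurable_funB => //.
  by apply: measurable_funB => //; exact: measurable_limn_series.
apply/cvge0P => [n|e' e'0]; first exact: measure_ge0.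
have /cvge0P := Qosc_cvg e20; move=> /(_ (fun=> measure_ge0 _ _) e' e'0).
apply: filterS => n; apply: le_trans.
rewrite -[leRHS]add0e -Qdivergent.
apply: le_trans (measureU2 _ measurable_divergent (measurable_oscillates n (e / 2))).
apply: le_measure; rewrite ?inE//.
  by apply: measurableU => //; exact: measurable_oscillates.
move=> w /=; rewrite subr0 => ew.
have [wD|/divergentP cw] := pselect (divergent w); [by left|right].
apply: contrapT => no.
(* Without an oscillation of size [e / 2] after [n] the limit stays within [e / 2] of [S n w],
   against the assumed distance [e]. *)
have : `|S n w - limn (S ^~ w)| <= e / 2.
  have cc : `|S n w - S m w| @[m --> \oo] --> `|S n w - limn (S ^~ w)|.
    by apply: cvg_norm; apply: cvgB => //; exact: cvg_cst.
  apply: (cvgr_to_le cc); exists n => // m /= nm.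
  rewrite leNgt; apply/negP => H; apply: no; exists (m - n)%N => //=.
  by rewrite subnKC// distrC ltW.
by rewrite leNgt => /negP; apply; apply: lt_le_trans ew; rewrite ltr_pdivrMr// ltr_pMr// ltr1n.
Qed.

End random_series.

Lemma integral_pred d (T : measurableType d) (R : realType)
    (m : {measure set T -> \bar R}) (b : T -> bool) : measurable_fun setT b ->
  (\int[m]_w ((b w)%:R : R)%:E = m [set w | b w])%E.
Proof.
move=> mb; have mB := measurable_pred_set mb.
rewrite -[in RHS](setIT [set w | b w]) -integral_indic//; apply: eq_integral => w _.
rewrite indicE; case: (boolP (b w)) => bw; first by rewrite mem_set.
by rewrite memNset//; exact/negP.
Qed.

(** * Weighted sums of centred powers of exponential variables *)

Section weighted_sums.
Context {R : realType} {d : measure_display} {T : measurableType d}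
  (Q : probability T R).
Variable E : nat -> {RV Q >-> R}.
Hypothesis hE : iid_std_exponential E.
Variables (s : R) (c : nat -> R).
Hypothesis s0 : 0 < s.

Lemma integral_sample_pow (J : seq nat) (h : seq R -> \bar R) : uniq J ->
  {in J, forall i, (0 < i)%N} ->
  mlist_fun (size J) (fun _ : unit => h) ->
  (forall l, size l = size J -> 0 <= h l)%E ->
  (\int[Q]_w h [seq centered_pow s (E j w) | j <- J] = iint (pow_law s) (size J) h)%E.
Proof.
move=> uJ J0 mh h0.
have lawE j A : (0 < j)%N -> measurable A -> Q (E j @^-1` A) = expo A.
  by move=> j0 mA; rewrite hE.2.
have mh' : mlist_fun (size J) (fun _ : unit => fun l => h (map (centered_pow s) l)).
  move=> d0 D g L _ mL; apply: (mh _ _ (fun=> tt)) => //.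
  by apply: mlist_map => //; exact: measurable_centered_pow.
have h'0 l : size l = size J -> (0 <= h (map (centered_pow s) l))%E.
  by move=> ls; apply: h0; rewrite size_map.
rewrite (iint_image expo (measurable_centered_pow s) mh h0).
rewrite -(integral_sample hE.1 lawE uJ J0 mh' h'0).
by apply: eq_integral => w _; rewrite -map_comp.
Qed.

Lemma measurable_weighted_term j : measurable_fun setT (fun w => c j * centered_pow s (E j w)).
Proof.
apply: measurable_funM => //.
apply: (measurableT_comp (measurable_centered_pow s)); exact: measurable_funP.
Qed.

Definition weighted_sum N M w : R := \sum_(N <= j < M) c j * centered_pow s (E j w).

Lemma measurable_weighted_sum N M : measurable_fun setT (weighted_sum N M).
Proof. by apply: measurable_sum => j; exact: measurable_weighted_term. Qed.

Let mlistY J : mlist (size J) (fun w => [seq centered_pow s (E j w) | j <- J]).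
Proof.
split=> [w|i]; first by rewrite size_map.
have [iJ|iJ] := ltnP i (size J); last first.
  rewrite (_ : (fun w => _) = cst 0%R); first exact: measurable_cst.
  by apply/funext => w; rewrite nth_default// size_map.
rewrite (_ : (fun w => _) = (fun w => centered_pow s (E (nth 0%N J i) w))).
  apply: (measurableT_comp (measurable_centered_pow s)); exact: measurable_funP.
by apply/funext => w; rewrite (nth_map 0%N).
Qed.

Let large_sum N M eps : set T := [set w |
  exceeds eps 0 [seq c j | j <- iota N M] [seq centered_pow s (E j w) | j <- iota N M]].

Let measurable_large_sum N M eps : measurable (large_sum N M eps).
Proof.
apply: measurable_pred_set.
apply: (@measurable_exceeds _ _ T _ (cst 0)); first exact: measurable_cst.
have := mlistY (iota N M); by rewrite size_map.
Qed.

Let large_sumP N M eps w : large_sum N M eps w <->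
  exists2 i, (i <= M)%N & eps <= `|weighted_sum N (N + i) w|.
Proof.
have H := @exceedsP R eps 0 c (fun j => centered_pow s (E j w)) N M.
split=> [/H[i iM ei]|[i iM ei]]; last by apply/H; exists i => //; rewrite add0r.
by exists i => //; rewrite add0r in ei.
Qed.

Let kolmogorov N M eps : (0 < N)%N -> 0 < eps ->
  (Q (large_sum N M eps) <=
    (v_coef s * (\sum_(N <= j < N + M) c j ^+ 2) / eps ^+ 2)%:E)%E.
Proof.
move=> N0 eps0.
have := @kolmogorov_iint R (pow_law s) (v_coef s) (pow_law_integrable s0)
  (pow_law_mean s0) (pow_law_var s0) eps 0 [seq c j | j <- iota N M] eps0.
have -> : iota N M = index_iota N (N + M) by rewrite /index_iota addKn.
rewrite expr0n add0r big_map; apply: le_trans.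
have NJ : {in index_iota N (N + M), forall i, (0 < i)%N}.
  by move=> i; rewrite mem_index_iota => /andP[Ni _]; exact: leq_trans N0 Ni.
have mh : mlist_fun (size (index_iota N (N + M))) (fun _ : unit => fun l =>
    ((exceeds eps 0 [seq c j | j <- index_iota N (N + M)] l)%:R : R)%:E).
  move=> d' D g L _ mL; apply/measurable_EFinP.
  rewrite (_ : (fun w => _) = (fun w => if exceeds eps 0 [seq c j | j <- index_iota N (N + M)]
      (L w) then 1 else 0)); last by apply/funext => w; case: exceeds.
  apply: measurable_fun_ifT => //; apply: (@measurable_exceeds _ _ D _ (cst 0)).
    exact: measurable_cst.
  by rewrite size_map.
rewrite size_map -(integral_sample_pow (iota_uniq _ _) NJ mh); last first.
  by move=> l _; rewrite lee_fin.
rewrite integral_pred /index_iota ?addKn//.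
apply: (@measurable_exceeds _ _ T _ (cst 0)); first exact: measurable_cst.
by have := mlistY (iota N M); rewrite size_map.
Qed.

Lemma weighted_sum_chebyshev N M eps : (0 < N <= M)%N -> 0 < eps ->
  (Q [set w | (eps <= `|weighted_sum N M w|)%R] <=
    (v_coef s * (\sum_(N <= j < M) c j ^+ 2) / eps ^+ 2)%:E)%E.
Proof.
move=> /andP[N0 NM] eps0; rewrite -{2}(subnKC NM).
apply: le_trans (kolmogorov (M - N) N0 eps0); apply: le_measure.
- rewrite inE; apply: measurable_pred_set; apply: measurable_fun_ler => //.
  by apply: measurableT_comp => //; exact: measurable_weighted_sum.
- by rewrite inE; exact: measurable_large_sum.
- by move=> w /= ew; apply/large_sumP; exists (M - N)%N => //; rewrite subnKC.
Qed.

Let S n := weighted_sum 1 n.+1.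

Let mS n : measurable_fun setT (S n).
Proof. exact: measurable_weighted_sum. Qed.

Variable l : R.
Hypothesis c2l : (fun n => \sum_(1 <= j < n.+1) c j ^+ 2) @ \oo --> l.

Let r N := v_coef s * (l - \sum_(1 <= j < N.+1) c j ^+ 2).

Let r0 : r @ \oo --> 0.
Proof.
rewrite -(mulr0 (v_coef s)) -(subrr l); apply: cvgM; first exact: cvg_cst.
by apply: cvgB => //; exact: cvg_cst.
Qed.

(** The maximal inequality holds on blocks of every length [M] after [N]; as [M] grows, continuity
    from below gives the whole oscillation, bounded through the tail of the series of squared
    weights. *)
Let Qr N eps : 0 < eps -> (Q (oscillates S N eps) <= (r N / eps ^+ 2)%:E)%E.
Proof.
move=> eps0.
have sub : oscillates S N eps `<=` \bigcup_M large_sum N.+1 M eps.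
  move=> w [m _ /= ew]; exists m => //; apply/large_sumP; exists m => //.
  rewrite addSn /weighted_sum; move: ew; rewrite /S /weighted_sum.
  by rewrite (big_cat_nat (n := N.+1)) ?ltnS ?leq_addr//= addrAC subrr add0r.
apply: (@le_trans _ _ (Q (\bigcup_M large_sum N.+1 M eps))).
  apply: le_measure => //; rewrite inE; first exact: measurable_oscillates.
  by apply: bigcupT_measurable => M; exact: measurable_large_sum.
have cvL : Q (large_sum N.+1 M eps) @[M --> \oo] --> Q (\bigcup_M large_sum N.+1 M eps).
  apply: nondecreasing_cvg_mu => //.
  - by apply: bigcupT_measurable => M; exact: measurable_large_sum.
  - move=> M M' MM'; apply/subsetPset => w /large_sumP[i iM ei].
    by apply/large_sumP; exists i => //; exact: leq_trans MM'.
apply: (cvge_to_le cvL); near=> M.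
apply: le_trans (kolmogorov M (ltn0Sn N) eps0) _.
rewrite lee_fin ler_pM2r ?invr_gt0 ?exprn_gt0// ler_pM2l ?v_coef_gt0//.
rewrite lerBrDl.
have -> : \sum_(1 <= j < N.+1) c j ^+ 2 + \sum_(N.+1 <= j < N.+1 + M) c j ^+ 2 =
    \sum_(1 <= j < (N + M).+1) c j ^+ 2.
  by rewrite [RHS](big_cat_nat (n := N.+1)) ?ltnS ?leq_addr.
have nd : nondecreasing_seq (fun n => \sum_(1 <= j < n.+1) c j ^+ 2).
  apply/nondecreasing_seqP => n.
  by rewrite [leRHS]big_nat_recr//= lerDl sqr_ge0.
have /cvg_lim <- // := c2l.
by apply: nondecreasing_cvgn_le => //; apply: cvgP c2l.
Unshelve. all: by end_near. Qed.

Lemma measurable_weighted_series :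
  measurable_fun setT (fun w => limn (fun n => weighted_sum 1 n.+1 w)).
Proof. exact: (measurable_limn_series mS). Qed.

Lemma weighted_series_cvg_in_probability : cvg_in_probability Q
  (fun n w => weighted_sum 1 n.+1 w - limn (fun n => weighted_sum 1 n.+1 w)) 0.
Proof. exact: (limn_series_cvg_in_probability mS r0 Qr). Qed.

End weighted_sums.

(** * Taylor's formula for the logistic function *)

Section logistic.
Context {R : realType}.
Implicit Types x t h : R.

Definition logistic t : R := (1 + expR t)^-1.

Lemma logistic_gt0 t : 0 < logistic t.
Proof. by rewrite invr_gt0 addr_gt0 ?expR_gt0. Qed.

Lemma logistic_lt1 t : logistic t < 1.
Proof. by rewrite invf_lt1 ?addr_gt0 ?expR_gt0// ltrDl expR_gt0. Qed.

Lemma logistic_ni t t' : t <= t' -> logistic t' <= logistic t.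
Proof. by move=> tt'; rewrite lef_pV2 ?posrE ?addr_gt0 ?expR_gt0// lerD2l ler_expR. Qed.

Section derivatives.
Variables (f g : R -> R) (x df dg : R).
Hypotheses (Hf : is_derive x (1 : R) f df) (Hg : is_derive x (1 : R) g dg).

Lemma is_derive_fD : is_derive x (1 : R) (fun t => f t + g t) (df + dg).
Proof. exact: is_deriveD. Qed.

Lemma is_derive_fB : is_derive x (1 : R) (fun t => f t - g t) (df - dg).
Proof. exact: is_deriveB. Qed.

Lemma is_derive_fM : is_derive x (1 : R) (fun t => f t * g t) (df * g x + f x * dg).
Proof. by have := is_deriveM Hf Hg; rewrite addrC [_ *: df]mulrC. Qed.

Lemma is_derive_fcst (r : R) : is_derive x (1 : R) (fun _ : R => r) 0.
Proof. exact: is_derive_cst. Qed.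

Lemma is_derive_fid : is_derive x (1 : R) (fun t : R => t) 1.
Proof. exact: is_derive_id. Qed.

End derivatives.

(** Since rho' = rho (rho - 1), all derivatives are polynomials in [rho], and bounds on them are
    polynomial inequalities on (0, 1). *)
Let rho : R -> R := logistic.
Let rho1 t : R := rho t * (rho t - 1).
Let rho2 t : R := (2 * rho t - 1) * rho1 t.
Let rho3 t : R := rho1 t * (6 * (rho t * (rho t - 1)) + 1).

Let is_derive_rho x : is_derive x (1 : R) rho (rho1 x).
Proof.
have e0 : 1 + expR x != 0 by rewrite gt_eqF// addr_gt0// expR_gt0.
have H := is_derive_fD (is_derive_fcst x 1) (is_derive_expR x).
have [H1 H2] := H.
apply: DeriveDef; first exact: derivableV.
rewrite deriveV// H2.
by rewrite /rho1 /rho /logistic /GRing.scale /=; field.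
Qed.

Let is_derive_rho1 x : is_derive x (1 : R) rho1 (rho2 x).
Proof.
have H := is_derive_rho x.
apply: (is_derive_eq (is_derive_fM H (is_derive_fB H (is_derive_fcst x 1)))).
by rewrite /rho2; ring.
Qed.

Let is_derive_rho2 x : is_derive x (1 : R) rho2 (rho3 x).
Proof.
have H := is_derive_rho x.
have H2 := is_derive_fB (is_derive_fM (is_derive_fcst x 2) H) (is_derive_fcst x 1).
apply: (is_derive_eq (is_derive_fM H2 (is_derive_rho1 x))).
by rewrite /rho3 /rho2 /rho1; ring.
Qed.

Let rho3_le1 x : `|rho3 x| <= 1.
Proof.
rewrite /rho3 /rho1.
have := logistic_gt0 x; have := logistic_lt1 x; rewrite -/(rho x).
move: (rho x) => r r1 r0.
have -> : r * (r - 1) * (6 * (r * (r - 1)) + 1) =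
  - (r * (1 - r)) * (1 - 6 * (r * (1 - r))) by ring.
have p0 : 0 <= r * (1 - r) by nra.
have p1 : r * (1 - r) <= 4^-1.
  have := sqr_ge0 (r - 2^-1); lra.
move: (r * (1 - r)) p0 p1 => p p0 p1.
by rewrite ler_norml; apply/andP; split; nra.
Qed.

(** The intermediate point is a displacement [t], so that [h] may have either sign. *)
Lemma mean_value (f f' : R -> R) (x h : R) : (forall y : R, is_derive y (1 : R) f (f' y)) ->
  exists2 t, `|t| <= `|h| & f (x + h) - f x = f' (x + t) * h.
Proof.
move=> df.
have cf a b : {within `[a, b]%classic, continuous f}.
  apply: continuous_subspaceT => y.
  by apply/differentiable_continuous/derivable1_diffP; have [] := df y.
have [h0|h0|<-] := ltgtP 0 h; last by exists 0 => //; rewrite addr0 subrr mulr0.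
- have xh : x < x + h by rewrite ltrDl.
  have [c + E] := MVT xh (fun y _ => df y) (cf _ _).
  rewrite in_itv /= => /andP[xc ch]; exists (c - x).
    by rewrite !gtr0_norm ?subr_gt0// lerBlDl ltW.
  by rewrite E addrCA subrr addr0 addrAC subrr add0r.
- have xh : x + h < x by rewrite gtrDl.
  have [c + E] := MVT xh (fun y _ => df y) (cf _ _).
  rewrite in_itv /= => /andP[hc cx]; exists (c - x).
    by rewrite !ltr0_norm ?subr_lt0// lerN2 lerBrDl ltW.
  by rewrite -opprB E [x + (c - x)]addrCA subrr addr0 opprD addrA subrr add0r mulrN opprK.
Qed.

(** Three nested uses of the mean value theorem, starting from the bound 1 on the third derivative.
    Each intermediate displacement is bounded crudely by the full one, hence the constant 1 instead
    of 1/6. *)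
Lemma logistic_taylor x h :
  `|rho (x + h) - (rho x + h * rho1 x + h ^+ 2 / 2 * rho2 x)| <= `|h| ^+ 3.
Proof.
have B2 t : `|rho2 (x + t) - rho2 x| <= `|t|.
  have [u _ ->] := mean_value x t is_derive_rho2.
  by rewrite normrM ler_piMl.
pose F1 t := rho1 (x + t) - rho1 x - t * rho2 x.
pose F t := rho (x + t) - rho x - t * rho1 x - t ^+ 2 / 2 * rho2 x.
have dF1 t : is_derive t (1 : R) F1 (rho2 (x + t) - rho2 x).
  have H := is_derive_fD (is_derive_fcst t x) (is_derive_fid t).
  have C : is_derive t (1 : R) (rho1 \o (fun t => x + t)) (rho2 (x + t)).
    have H1 := is_derive_rho1 (x + t).
    by apply: is_derive_eq; rewrite add0r mulr1.
  apply: (is_derive_eq (is_derive_fB (is_derive_fB C (is_derive_fcst t (rho1 x)))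
     (is_derive_fM (is_derive_fid t) (is_derive_fcst t (rho2 x))))).
  by ring.
have dF t : is_derive t (1 : R) F (F1 t).
  have H := is_derive_fD (is_derive_fcst t x) (is_derive_fid t).
  have C : is_derive t (1 : R) (rho \o (fun t => x + t)) (rho1 (x + t)).
    have H1 := is_derive_rho (x + t).
    by apply: is_derive_eq; rewrite add0r mulr1.
  have Hl := is_derive_fM (is_derive_fid t) (is_derive_fcst t (rho1 x)).
  have Hq := is_derive_fM (is_derive_fM (is_derive_fM (is_derive_fid t) (is_derive_fid t))
    (is_derive_fcst t 2^-1)) (is_derive_fcst t (rho2 x)).
  apply: (is_derive_eq (is_derive_fB (is_derive_fB (is_derive_fB C
     (is_derive_fcst t (rho x))) Hl) Hq)).
  by rewrite /F1; field.
have B1 t : `|F1 t| <= `|t| ^+ 2.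
  have [u ut] := mean_value 0 t dF1.
  rewrite !add0r {2}/F1 addr0 mul0r subr0 subrr subr0 => ->.
  rewrite normrM expr2 ler_wpM2r//; exact: le_trans (B2 u) ut.
have [u uh] := mean_value 0 h dF.
rewrite !add0r {2}/F addr0 mul0r expr0n /= !mul0r !subr0 subrr subr0 => E.
have -> : rho (x + h) - (rho x + h * rho1 x + h ^+ 2 / 2 * rho2 x) = F h.
  by rewrite /F; ring.
rewrite E normrM exprSr ler_wpM2r//; apply: le_trans (B1 u) _.
by rewrite lerXn2r ?nnegrE.
Qed.

Lemma logistic_lipschitz x y : `|logistic x - logistic y| <= `|x - y|.
Proof.
have [u _] := mean_value y (x - y) is_derive_rho.
rewrite addrCA subrr addr0 /rho => ->; rewrite normrM ler_piMl// /rho1 /rho.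
have := logistic_gt0 (y + u); have := logistic_lt1 (y + u).
by move: (logistic _) => r r1 r0; rewrite ler_norml; apply/andP; split; nra.
Qed.

End logistic.

Lemma integral_image_measure d d' (T : measurableType d) (T' : measurableType d')
    (R : realType) (m : {measure set T -> \bar R}) (f : T -> T')
    (mf : measurable_fun setT f) (g : T' -> \bar R) :
  measurable_fun setT g -> (forall y, 0 <= g y)%E ->
  (\int[image_measure m mf]_y g y = \int[m]_x g (f x))%E.
Proof. by move=> mg g0; rewrite ge0_integral_pushforward. Qed.

(** * The standard normal law: convolution and moments *)

Section standard_normal.
Context {R : realType}.
Local Notation leb := (@lebesgue_measure R).

Let measurable_idR : measurable_fun setT (idfun : measurableTypeR R -> R).
Proof. by move=> _ A mA; rewrite setTI preimage_id. Qed.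

Let normal_prob01 : probability (measurableTypeR R) R :=
  normal_distribution_normal_prob__canonical__probability_measure_Probability 0 1.

Definition std_normal : probability R R := image_probability normal_prob01 measurable_idR.

Let phi (z : R) : R := normal_peak 1 * expR (- (z ^+ 2 / 2)).

Let normal_pdf01 z : normal_pdf 0 1 z = phi z.
Proof.
rewrite normal_pdfE ?oner_neq0// /phi /normal_fun subr0 expr1n; congr (_ * expR _).
by rewrite mulNr.
Qed.

Let phi_ge0 z : 0 <= phi z.
Proof. by rewrite mulr_ge0 ?expR_ge0 ?normal_peak_ge0. Qed.

Let measurable_phi : measurable_fun setT phi.
Proof.
apply: measurable_funM => //; apply: measurableT_comp => //.
by apply: measurable_funN; apply: measurable_funM => //; exact: measurable_funX.
Qed.

Lemma integral_std_normal (f : R -> \bar R) : measurable_fun setT f -> (forall x, 0 <= f x)%E ->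
  (\int[std_normal]_x f x = \int[leb]_x (f x * (phi x)%:E))%E.
Proof.
move=> mf f0; rewrite integral_image_probability//=.
rewrite (@integral_density _ _ _ leb normal_prob01 _ measurable_phi)// => A mA.
change (normal_prob01 A) with (normal_prob 0 1 A : \bar R).
by apply: eq_integral => x _; rewrite normal_pdf01.
Qed.

Lemma normal_prob_scale (tau : R) A : 0 < tau -> measurable A ->
  normal_prob 0 tau A = std_normal [set z | A (tau * z)].
Proof.
move=> t0 mA.
have mI : measurable_fun setT (fun z : R => (\1_A (tau * z) : R)%:E).
  apply/measurable_EFinP; apply: (@measurableT_comp _ _ _ _ _ _ (\1_A : R -> R)).
    exact: measurable_indic.
  exact: measurable_funM.
have mS : measurable [set z : R | A (tau * z)].
  rewrite -[X in measurable X]setTI; apply: (measurable_funM (measurable_cst tau) (@measurable_id _ _ setT)) => //.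
rewrite -[in RHS](setIT [set z | A _]) -integral_indic//.
rewrite (integral_std_normal (f := fun z => (\1_A (tau * z))%:E))//.
rewrite /normal_prob integral_mkcond.
pose g (y : R) : \bar R := ((\1_A y : R)%:E * (normal_pdf 0 tau y)%:E)%E.
transitivity (\int[leb]_y g y)%E.
  apply: eq_integral => y _; rewrite patchE /g indicE.
  by case: ifP => _; rewrite ?mul1e ?mul0e.
have mg : measurable_fun setT g.
  apply: emeasurable_funM; first by apply/measurable_EFinP; exact: measurable_indic.
  by apply/measurable_EFinP; exact: measurable_normal_pdf.
have g0 y : (0 <= g y)%E by rewrite mule_ge0// lee_fin normal_pdf_ge0.
have := lebesgue_integral_affine 0 t0 mg g0.
move=> /(congr1 (fun r => tau%:E * r)%E).
rewrite muleA -EFinM divff ?gt_eqF// mul1e => <-.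
rewrite -ge0_integralZl//; first last.
- by rewrite lee_fin ltW.
- by apply: (measurableT_comp mg); exact: measurable_affine.
apply: eq_integral => z _; rewrite /g addr0 muleCA; congr (_ * _)%E.
rewrite -EFinM; congr EFin; rewrite normal_pdfE ?gt_eqF// /phi /normal_peak /normal_fun subr0.
rewrite expr1n mul1r -mulrnAr sqrtrM ?sqr_ge0// sqrtr_sqr gtr0_norm// invfM mulrA mulrA.
rewrite divff ?gt_eqF// mul1r; congr (_ * expR _).
by rewrite -mulr_natr; field; rewrite gt_eqF.
Qed.

Lemma integral_std_normalN (f : R -> \bar R) : measurable_fun setT f ->
  (forall x, 0 <= f x)%E ->
  (\int[std_normal]_x f (- x)%R = \int[std_normal]_x f x)%E.
Proof.
move=> mf f0.
have mfN : measurable_fun setT (fun x : R => f (- x)).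
  by apply: measurableT_comp => //; exact: measurable_funN.
rewrite !integral_std_normal//.
pose g x := (f x * (phi x)%:E)%E.
have mg : measurable_fun setT (g : measurableTypeR R -> \bar R).
  by apply: emeasurable_funM => //; exact/measurable_EFinP.
have mN : measurable_fun setT (-%R : measurableTypeR R -> measurableTypeR R).
  exact: measurable_funN.
transitivity (\int[image_measure leb mN]_x g x)%E; last first.
  by apply: eq_measure_integral => A mA _; exact: lebesgue_measureN.
have g0 x : (0 <= g x)%E by rewrite mule_ge0// lee_fin.
rewrite (integral_image_measure leb mN mg g0).
by apply: eq_integral => x _; rewrite /g /phi sqrrN.
Qed.

Lemma std_normal_convolution (a b : R) (h : R -> \bar R) : 0 <= a -> 0 <= b ->
  measurable_fun setT h -> (forall x, 0 <= h x)%E ->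
  (\int[std_normal]_z \int[std_normal]_u h (a * z + b * u)%R =
   \int[std_normal]_w h (Num.sqrt (a ^+ 2 + b ^+ 2) * w)%R)%E.
Proof.
move=> a0 b0 mh h0.
have mhl (al be : R) : measurable_fun setT (fun w : R => h (al * w + be)).
  by apply: measurableT_comp => //; exact: measurable_affine.
move: a0; rewrite le_eqVlt => /predU1P[<-|a0].
  rewrite expr0n add0r sqrtr_sqr ger0_norm//.
  under eq_integral do under eq_integral do rewrite mul0r add0r.
  exact: integral_cst_probability.
move: b0; rewrite le_eqVlt => /predU1P[<-|b0].
  rewrite expr0n addr0 sqrtr_sqr gtr0_norm//.
  apply: eq_integral => z _; under eq_integral do rewrite mul0r addr0.
  exact: integral_cst_probability.
pose t := Num.sqrt (a ^+ 2 + b ^+ 2).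
have t2 : t ^+ 2 = a ^+ 2 + b ^+ 2 by rewrite sqr_sqrtr// addr_ge0 ?sqr_ge0.
have t0 : 0 < t by rewrite sqrtr_gt0 ltr_wpDl ?sqr_ge0 ?exprn_gt0.
rewrite -/t.
(* The integrand after the substitution [u = (t * w - a * z) / b], which turns [a * z + b * u] into
   [t * w]. *)
pose G (z w : R) : \bar R := (h (t * w)%R * (phi z * (t / b * phi ((t * w - a * z) / b)))%R%:E)%E.
have G0 z w : (0 <= G z w)%E.
  apply: mule_ge0; first exact: h0.
  rewrite lee_fin; apply: mulr_ge0; first exact: phi_ge0.
  apply: mulr_ge0; last exact: phi_ge0.
  by rewrite divr_ge0 ?ltW.
have mG : measurable_fun setT (fun p : measurableTypeR R * measurableTypeR R => G p.1 p.2).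
  apply: emeasurable_funM.
    apply: (measurableT_comp mh); apply: measurable_funM => //.
  apply/measurable_EFinP; apply: measurable_funM.
    exact: measurableT_comp.
  apply: measurable_funM => //; apply: measurableT_comp => //.
  by apply: measurable_funM => //; apply: measurable_funB; exact: measurable_funM.
have inner z : (\int[std_normal]_u h (a * z + b * u)%R * (phi z)%:E =
    \int[leb]_w G z w)%E.
  have mz : measurable_fun setT (fun u : R => h (a * z + b * u)).
    by under eq_fun do rewrite addrC; exact: mhl.
  rewrite integral_std_normal//.
  pose g u := (h (a * z + b * u)%R * (phi u)%:E)%E.
  have mg : measurable_fun setT g by apply: emeasurable_funM => //; exact/measurable_EFinP.
  have g0 u : (0 <= g u)%E by rewrite mule_ge0// lee_fin.
  have tb : 0 < t / b by rewrite divr_gt0.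
  have := lebesgue_integral_affine (- (a * z / b)) tb mg g0.
  move=> /(congr1 (fun r => (t / b)%:E * r)%E).
  rewrite muleA -EFinM divff ?gt_eqF// mul1e => <-.
  have mga : measurable_fun setT (fun x : R => g (t / b * x - a * z / b)).
    by apply: (measurableT_comp mg); exact: measurable_affine.
  rewrite muleAC -EFinM -ge0_integralZl//; last by rewrite lee_fin mulr_ge0// ltW.
  apply: eq_integral => w _; rewrite /g /G.
  have -> : a * z + b * (t / b * w - a * z / b) = t * w by field; rewrite gt_eqF.
  have -> : t / b * w - a * z / b = (t * w - a * z) / b by field; rewrite gt_eqF.
  by rewrite muleCA -EFinM; congr (_ * _%:E)%E; ring.
rewrite integral_std_normal; last 2 first.
- apply: (@measurable_fun_fubini_tonelli_F _ _ R R R std_normal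
    (fun p : R * R => h (a * p.1 + b * p.2))) => //.
  by apply: (measurableT_comp mh); apply: measurable_funD; exact: measurable_funM.
- by move=> z; exact: integral_ge0.
under eq_integral do rewrite inner.
have /= -> := @fubini_tonelli _ _ _ _ R leb leb _ mG (fun p => G0 p.1 p.2).
have mht : measurable_fun setT (fun w : R => h (t * w)).
  by apply: (measurableT_comp mh); exact: measurable_funM.
rewrite [RHS]integral_std_normal//; apply: eq_integral => w _.
pose p x := (phi x)%:E.
have mp : measurable_fun setT p by exact/measurable_EFinP.
have p0 x : (0 <= p x)%E by rewrite lee_fin.
have tb : 0 < t / b by rewrite divr_gt0.
have := lebesgue_integral_affine (- (a * w / b)) tb mp p0.
have -> : (\int[leb]_x p x = 1)%E.
  rewrite -(integral_cst_probability std_normal 1) integral_std_normal//.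
  by apply: eq_integral => x _; rewrite mul1e.
rewrite mule1 => E.
have mpa : measurable_fun setT (fun x : R => p (t / b * x - a * w / b)).
  by apply: (measurableT_comp mp); exact: measurable_affine.
(* Rotation invariance of the Gaussian density: z^2 + ((t w - a z) / b)^2 = w^2 + ((t z - a w) /
   b)^2, because b^2 = t^2 - a^2. What remains in z is an affinely transformed density, of integral
   b / t. *)
transitivity (\int[leb]_x ((h (t * w)%R * (phi w * (t / b))%:E) *
    p (t / b * x - a * w / b)%R))%E.
  apply: eq_integral => z _; rewrite /G /p -muleA -EFinM; congr (_ * _%:E)%E.
  rewrite [LHS]mulrCA [RHS]mulrAC [RHS]mulrC; congr (_ * _); rewrite /phi.
  rewrite mulrACA [RHS]mulrACA -!expRD; congr (_ * expR _).
  have -> : (t / b * z - a * w / b) = (t * z - a * w) / b by field; rewrite gt_eqF.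
  rewrite -!opprD; congr (- _); rewrite !expr_div_n -!mulrDl; congr (_ / 2).
  have b2 : b ^+ 2 != 0 by rewrite expf_neq0// gt_eqF.
  apply: (mulIf b2); rewrite !mulrDl !mulfVK//.
  have -> : b ^+ 2 = t ^+ 2 - a ^+ 2 by rewrite t2 addrAC subrr add0r.
  by ring.
rewrite ge0_integralZl//; last first.
  by rewrite mule_ge0// lee_fin mulr_ge0// ltW.
rewrite E -muleA -EFinM; congr (_ * _%:E)%E.
by rewrite -mulrA divff ?mulr1// gt_eqF.
Qed.

Lemma std_normal_cube : (\int[std_normal]_z (`|z| ^+ 3)%:E < +oo)%E.
Proof.
have m3 : measurable_fun setT (fun z : R => (`|z| ^+ 3)%:E).
  by apply/measurable_EFinP; apply: measurable_funX; exact: normr_measurable.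
rewrite (integral_std_normal m3); last by move=> x; rewrite lee_fin exprn_ge0.
pose s2 : R := Num.sqrt 2.
have s20 : 0 < s2 by rewrite sqrtr_gt0.
have s22 : s2 ^+ 2 = 2 by rewrite sqr_sqrtr.
apply: (@le_lt_trans _ _ (\int[leb]_z ((64 * s2)%:E * (normal_pdf 0 s2 z)%:E))%E); last first.
  rewrite ge0_integralZl//.
  - by rewrite integral_normal_pdf mule1 ltry.
  - by apply/measurable_EFinP; exact: measurable_normal_pdf.
  - by move=> x _; rewrite lee_fin normal_pdf_ge0.
  - by rewrite lee_fin mulr_ge0// ltW.
apply: ge0_le_integral => //.
- by move=> x _; apply: mule_ge0; rewrite lee_fin ?exprn_ge0 ?phi_ge0.
- by apply: emeasurable_funM => //; exact/measurable_EFinP.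
- apply: emeasurable_funM => //; apply/measurable_EFinP; exact: measurable_normal_pdf.
move=> z _; rewrite -!EFinM lee_fin normal_pdfE ?gt_eqF// /phi /normal_fun subr0.
have -> : normal_peak 1 = s2 * normal_peak s2.
  rewrite /normal_peak expr1n mul1r -mulrnAr sqrtrM ?sqr_ge0// sqrtr_sqr gtr0_norm//.
  by rewrite invfM mulrA divff ?mul1r// gt_eqF.
(* The square of e^x >= 1 + x at x = z^2 / 8 bounds the right side below by 64 + 16 z^2 + z^4. The
   exponent z^2 / 4 leaves the normal density of variance 2 as an integrable majorant. *)
have z4 : `|z| ^+ 3 <= 64 * expR (z ^+ 2 / 4).
  have -> : expR (z ^+ 2 / 4) = expR (z ^+ 2 / 8) ^+ 2.
    by rewrite [RHS]expr2 -expRD; congr expR; field.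
  have := expR_ge1Dx (z ^+ 2 / 8); rewrite -[z ^+ 2]real_normK ?num_real//.
  have := normr_ge0 z; move: `|z| (expR _) => y u y0 yu.
  have y2 : 0 <= 1 + y ^+ 2 / 8 by rewrite addr_ge0// divr_ge0// sqr_ge0.
  have : (1 + y ^+ 2 / 8) ^+ 2 <= u ^+ 2.
    by rewrite lerXn2r ?nnegrE// (le_trans y2).
  have : 0 <= y ^+ 2 * (y - 2^-1) ^+ 2 by rewrite mulr_ge0 ?sqr_ge0.
  have := sqr_ge0 y.
  by move: (u ^+ 2) => U; nra.
have -> : - z ^+ 2 / (s2 ^+ 2 *+ 2) = z ^+ 2 / 4 * -1 by rewrite s22; field.
have -> : - (z ^+ 2 / 2) = z ^+ 2 / 4 * -1 + z ^+ 2 / 4 * -1 by field.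
have pk : 0 <= s2 * normal_peak s2 by rewrite mulr_ge0 ?normal_peak_ge0// ltW.
rewrite expRD mulrN1; set e := expR _.
apply: le_trans (_ : 64 * expR (z ^+ 2 / 4) * (s2 * normal_peak s2 * (e * e)) <= _).
  by apply: ler_wpM2r => //; apply: mulr_ge0 => //; rewrite mulr_ge0 ?expR_ge0.
have : expR (z ^+ 2 / 4) * e = 1 by rewrite /e -expRD subrr expR0.
move: (expR (z ^+ 2 / 4)) => e' e'e; rewrite le_eqVlt; apply/orP; left; apply/eqP.
transitivity (64 * (e' * e) * (s2 * normal_peak s2 * e)); first by ring.
by rewrite e'e; ring.
Qed.

Let pos (z : R) : \bar R := (\1_(`]0%R, +oo[%classic) z : R)%:E.

Let mpos : measurable_fun setT pos.
Proof. by apply/measurable_EFinP; exact: measurable_indic. Qed.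

Let posE z : pos z = if 0 < z then 1%E else 0%E.
Proof. by rewrite /pos indicE mem_setE in_itv /= andbT; case: ifP. Qed.

Let pos_ge0 z : (0 <= pos z)%E.
Proof. by rewrite posE; case: ifP. Qed.

(** The point 0 belongs to neither half-line; it is Lebesgue null. *)
Let std_normal_half (f : R -> \bar R) : measurable_fun setT f ->
  (forall x, 0 <= f x)%E -> (forall x, f (- x)%R = f x) ->
  (\int[std_normal]_z f z = 2%:E * \int[std_normal]_z (f z * pos z))%E.
Proof.
move=> mf f0 fN.
have mfp : measurable_fun setT (fun z => f z * pos z)%E by exact: emeasurable_funM.
have fp0 z : (0 <= f z * pos z)%E by exact: mule_ge0.
have mfpN : measurable_fun setT (fun z : R => f (- z)%R * pos (- z)%R)%E.
  by apply: (measurableT_comp mfp); exact: measurable_funN.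
transitivity (\int[std_normal]_z (f z * pos z + f (- z)%R * pos (- z)%R))%E.
  rewrite !integral_std_normal//; last 2 first.
  - exact: emeasurable_funD.
  - by move=> x; rewrite adde_ge0.
  apply: ge0_ae_eq_integral => //.
  - by apply: emeasurable_funM => //; exact/measurable_EFinP.
  - apply: emeasurable_funM; last exact/measurable_EFinP.
    exact: emeasurable_funD.
  - by move=> x _; rewrite mule_ge0// lee_fin.
  - by move=> x _; rewrite mule_ge0// ?lee_fin// adde_ge0.
  exists [set 0]; split => //; first exact: lebesgue_measure_set1.
  move=> x /=; apply: contra_notP => /eqP x0 _.
  congr (_ * _)%E; rewrite fN !posE oppr_gt0.
  by case: ltgtP x0 => //; rewrite ?mule1 ?mule0 ?adde0 ?add0e.
rewrite ge0_integralD//.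
rewrite (integral_std_normalN mfp fp0).
by rewrite -[(2%:E)]/(1%:E + 1%:E)%E ge0_muleDl ?lee01// !mul1e.
Qed.

(** [- phi] is a primitive of [z * phi z]. *)
Let integral_phi_tail t : 0 < t ->
  (\int[leb]_z ((if (t < z)%R then z%:E else 0) * (phi z)%:E) = (phi t)%:E)%E.
Proof.
move=> t0.
transitivity (\int[leb]_(z in `[t, +oo[) (z * phi z)%:E)%E.
  rewrite -integral_itv_obnd_cbnd; last first.
    by apply/measurable_funTS/measurable_EFinP; exact: measurable_funM.
  rewrite [RHS]integral_mkcond; apply: eq_integral => z _.
  by rewrite patchE mem_setE in_itv /= andbT; case: ifP => // _; rewrite mul0e.
have dphi z : is_derive z (1 : R) (fun x => - phi x) (z * phi z).
  have H1 := is_derive_fM (is_derive_fM (is_derive_fid z) (is_derive_fid z)) (is_derive_fcst z (- 2^-1)).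
  have H2 := @is_derive1_comp R expR _ z _ _ (is_derive_expR _) H1.
  have H3 := is_derive_fM (is_derive_fcst z (- normal_peak 1)) H2.
  have eE x : x * x * - 2^-1 = - (x ^+ 2 / 2) :> R by field.
  have E : (fun x => - phi x) = (fun x => - normal_peak 1 * (expR \o (fun x => x * x * - 2^-1)) x).
    by apply/funext => x; rewrite /phi /= mulNr eE.
  rewrite E; apply: (is_derive_eq H3); rewrite /phi /= eE.
  by field.
have cphi : continuous phi.
  move=> x; have [H _] := dphi x.
  have : {for x, continuous (fun x => - phi x)}.
    by apply/differentiable_continuous/derivable1_diffP.
  by move=> /(@cvgN _ R^o); rewrite opprK opprK.
rewrite (@ge0_continuous_FTC2y _ _ (fun x => - phi x) _ 0)//.
- by rewrite EFinN oppeK add0e.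
- by move=> x tx; rewrite mulr_ge0// (le_trans _ tx)// ltW.
- by apply: continuous_subspaceT => x; apply: cvgM => //; exact: cphi.
- rewrite -oppr0; apply: cvgN; rewrite -(mulr0 (normal_peak 1)).
  apply: cvgM; first exact: cvg_cst.
  apply: (cvg_comp (fun x : R => x ^+ 2 / 2) (fun x => expR (- x))); last exact: cvgr_expR.
  under eq_fun do rewrite mulrC.
  apply: (cvg_comp (fun x : R => x ^+ 2) (fun y => 2^-1 * y)); first exact: cvgr_expr2.
  have h0 : 0 < (2^-1 : R) by rewrite invr_gt0.
  exact: (gt0_cvgMry h0 (@cvg_id _ +oo)).
- by apply: cvgN; apply: cvg_at_right_filter; exact: cphi.
- by move=> x _; rewrite derive1E; have [] := dphi x.
Qed.

Let integral_cst_itv0 (z r : R) : 0 < z ->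
  (\int[leb]_(t in `]0%R, z[) r%:E = (r * z)%:E)%E.
Proof.
move=> z0; rewrite integral_cst; last exact: measurable_itv.
by rewrite [X in (_ * X)%E]lebesgue_measure_itv /= lte_fin z0 sube0 -EFinM.
Qed.

(** Integration by parts in the form of Tonelli's theorem: for z > 0, z^2 is the integral of z over
    0 < t < z, and integrating z phi(z) over z > t first leaves phi(t). So the second moment on the
    half-line equals the mass of the half-line. *)
Lemma std_normal_var : (\int[std_normal]_z (z ^+ 2)%:E = 1%:E)%E.
Proof.
have msq : measurable_fun setT (fun z : R => (z ^+ 2)%:E).
  by apply/measurable_EFinP; exact: measurable_funX.
rewrite std_normal_half//; [|by move=> x; rewrite lee_fin sqr_ge0|by move=> x; rewrite sqrrN].
rewrite -[RHS](integral_cst_probability std_normal) [RHS]std_normal_half//.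
congr (_ * _)%E.
have h1 : measurable_fun setT (fun z : R => (z ^+ 2)%:E * pos z)%E by exact: emeasurable_funM.
have h10 (z : R) : (0 <= (z ^+ 2)%:E * pos z)%E by rewrite mule_ge0// lee_fin sqr_ge0.
have h2 : measurable_fun setT (fun z : R => 1 * pos z)%E by exact: emeasurable_funM.
have h20 (z : R) : (0 <= 1 * pos z)%E by rewrite mul1e.
rewrite (integral_std_normal h1 h10) (integral_std_normal h2 h20).
pose G (z t : R) : \bar R := (if ((0 < t) && (t < z))%R then (z * phi z)%:E else 0)%E.
have G0 z t : (0 <= G z t)%E.
  by rewrite /G; case: ifP => // /andP[t0 tz]; rewrite lee_fin mulr_ge0// ltW// (lt_trans t0).
have mG : measurable_fun setT (fun p : measurableTypeR R * measurableTypeR R => G p.1 p.2).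
  apply: measurable_fun_ifT => //.
    by apply: measurable_and; exact: measurable_fun_ltr.
  apply/measurable_EFinP; apply: measurable_funM => //; exact: measurableT_comp.
have /= E := @fubini_tonelli _ _ _ _ R leb leb _ mG (fun p => G0 p.1 p.2).
transitivity (\int[leb]_z \int[leb]_t G z t)%E.
  apply: eq_integral => z _; rewrite posE; case: ifP => z0; last first.
    rewrite mule0 mul0e; apply/esym/integral0_eq => t _; rewrite /G; case: ifP => [/andP[t0 tz]|//].
    by rewrite (lt_trans t0 tz) in z0.
  rewrite mule1 -EFinM.
  transitivity (\int[leb]_(t in `]0%R, z[) (z * phi z)%:E)%E.
    by rewrite integral_cst_itv0; [rewrite expr2 mulrAC|exact: z0].
  by rewrite integral_mkcond; apply: eq_integral => t _; rewrite patchE mem_setE in_itv.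
rewrite E; apply: eq_integral => t _; rewrite posE mul1e; case: ifP => t0; last first.
  by rewrite mul0e; apply: integral0_eq => z _; rewrite /G t0.
rewrite mul1e -(integral_phi_tail t0); apply: eq_integral => z _.
by rewrite /G t0 /=; case: ifP; rewrite ?mul0e.
Qed.

Lemma std_normal_integrable : std_normal.-integrable setT (fun z => z%:E).
Proof.
have m1 : measurable_fun setT (fun z : R => z%:E) by exact/measurable_EFinP.
apply/integrableP; split => //.
apply: (@le_lt_trans _ _ (\int[std_normal]_z (1 + (`|z| ^+ 3)%:E))%E).
  apply: ge0_le_integral => //.
  - by apply/measurable_EFinP; exact: normr_measurable.
  - apply: emeasurable_funD => //.
    by apply/measurable_EFinP; apply: measurable_funX; exact: normr_measurable.
  move=> z _; rewrite -EFinD lee_fin; have := normr_ge0 z; move: `|z| => y y0.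
  have [y1|y1] := leP y 1; first by rewrite (le_trans y1)// lerDl exprn_ge0.
  have : 1 <= y ^+ 2 by rewrite expr_ge1// ltW.
  by rewrite exprS => H; nra.
have m3 : measurable_fun setT (fun z : R => (`|z| ^+ 3)%:E).
  by apply/measurable_EFinP; apply: measurable_funX; exact: normr_measurable.
rewrite ge0_integralD//.
rewrite integral_cst_probability; apply: lte_add_pinfty; rewrite ?ltry//.
exact: std_normal_cube.
Qed.

Lemma std_normal_mean : (\int[std_normal]_z z%:E = 0)%E.
Proof.
have m1 : measurable_fun setT (fun z : R => z%:E) by exact/measurable_EFinP.
have fin : (\int[std_normal]_z (EFin^\+ z)%E)%E \is a fin_num.
  exact: (integrable_pos_fin_num measurableT std_normal_integrable).
rewrite integralE.
have -> : (\int[std_normal]_z (EFin^\- z)%E = \int[std_normal]_z (EFin^\+ z)%E)%E.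
  rewrite -(integral_std_normalN (f := (EFin^\+)%E)).
  - by apply: eq_integral => z _; rewrite funenegE funeposE EFinN.
  - exact: measurable_funepos.
  - by move=> x; exact: funepos_ge0.
by rewrite subee.
Qed.

End standard_normal.
#[global] Opaque std_normal.

(** * Lindeberg's replacement method *)

Section lindeberg.
Context {R : realType}.
Local Open Scope ereal_scope.

(** Stated without subtraction, so that finiteness of [a] and [b] need not be tracked. *)
Definition close_within (e : R) (a b : \bar R) : Prop :=
  a <= b + e%:E /\ b <= a + e%:E.

Lemma close_within_trans e1 e2 (a b c : \bar R) :
  close_within e1 a b -> close_within e2 b c -> close_within (e1 + e2) a c.
Proof.
move=> [ab ba] [bc cb]; split.
- by rewrite (le_trans ab)// [(e1 + e2)%R]addrC EFinD addeA leeD2r.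
- by rewrite (le_trans cb)// EFinD addeA leeD2r.
Qed.

Lemma close_within_refl e (a : \bar R) : (0 <= e)%R -> close_within e a a.
Proof. by move=> e0; split; rewrite leeDl// lee_fin. Qed.

Lemma close_within_integral d (T : measurableType d) (P : probability T R) (f g : T -> \bar R) e :
  (0 <= e)%R -> measurable_fun setT f -> measurable_fun setT g ->
  (forall x, 0 <= f x) -> (forall x, 0 <= g x) ->
  (forall x, close_within e (f x) (g x)) ->
  close_within e (\int[P]_x f x) (\int[P]_x g x).
Proof.
move=> e0 mf mg f0 g0 fg.
have half (u w : T -> \bar R) : measurable_fun setT u -> measurable_fun setT w ->
    (forall x, 0 <= u x) -> (forall x, 0 <= w x) -> (forall x, u x <= w x + e%:E) ->
    \int[P]_x u x <= \int[P]_x w x + e%:E.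
  move=> mu mw u0 w0 uw; rewrite -[X in _ + X](integral_cst_probability P).
  rewrite -ge0_integralD//.
  apply: ge0_le_integral => //; exact: emeasurable_funD.
by split; apply: half => // x; have [] := fg x.
Qed.

(* The last clause is Taylor's formula of order three, with g1 and g2 the first
   two derivatives of g. *)
Definition smooth_test (K : R) (g : R -> R) : Prop :=
  [/\ measurable_fun setT g, forall x, (0 <= g x <= 1)%R &
   exists g1 g2 : R -> R, forall x h,
     (`|g (x + h) - (g x + h * g1 x + h ^+ 2 / 2 * g2 x)| <= K * `|h| ^+ 3)%R].

Section replacement.
Variables (K : R) (g : R -> R).
Hypotheses (K0 : (0 <= K)%R) (sg : smooth_test K g).
Variables (v : R).

Definition moment_bound (nu : probability R R) (M : R) : Prop :=
  [/\ nu.-integrable setT (fun y => y%:E), \int[nu]_y y%:E = 0,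
   \int[nu]_y (y ^+ 2)%:E = v%:E & \int[nu]_y (`|y| ^+ 3)%:E = M%:E].

Let mg : measurable_fun setT g. Proof. by have [] := sg. Qed.
Let g01 x : (0 <= g x <= 1)%R. Proof. by have [_ H _] := sg. Qed.

Lemma measurable_test_affine (c x : R) : measurable_fun setT (fun y : R => (g (x + c * y))%:E).
Proof.
apply/measurable_EFinP; apply: (measurableT_comp mg).
by apply: measurable_funD => //; exact: measurable_funM.
Qed.

Lemma test_ge0 x : 0 <= (g x)%:E. Proof. by rewrite lee_fin; have /andP[] := g01 x. Qed.

(** Up to the error in the third moment the integral depends on [nu] only through the mean 0 and the
    variance [v]. As [g2] is chosen before [nu], two such laws share the same intermediate value. *)
Lemma taylor_integral : exists g2 : R -> R, forall nu M, moment_bound nu M ->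
  forall x c, close_within (K * `|c| ^+ 3 * M)
    (\int[nu]_y (g (x + c * y))%:E) (g x + c ^+ 2 * v / 2 * g2 x)%:E.
Proof.
have [_ _ [g1 [g2 T]]] := sg; exists g2 => nu M [i1 m1 m2 m3] x c.
have i2 : nu.-integrable setT (fun y => (y ^+ 2)%:E).
  apply/integrableP; split; first by apply/measurable_EFinP; exact: measurable_funX.
  by under eq_integral do rewrite gee0_abs ?lee_fin ?sqr_ge0//; rewrite m2 ltry.
have i3 : nu.-integrable setT (fun y => (`|y| ^+ 3)%:E).
  apply/integrableP; split.
    by apply/measurable_EFinP; apply: measurable_funX; exact: normr_measurable.
  by under eq_integral do rewrite gee0_abs ?lee_fin ?exprn_ge0//; rewrite m3 ltry.
have i0 (r : R) : nu.-integrable setT (fun _ : R => r%:E).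
  exact: finite_measure_integrable_cst.
have ig : nu.-integrable setT (fun y => (g (x + c * y))%:E).
  apply: (le_integrable measurableT _ _ (i0 1%R)); first exact: measurable_test_affine.
  by move=> y _; rewrite !gee0_abs ?lee_fin ?test_ge0//; have /andP[] := g01 (x + c * y)%R.
(* [r = 1] and [r = -1] give the upper and the lower envelope of the Taylor expansion. *)
have key (r : R) : let q y := (g x)%:E + (c * g1 x)%:E * y%:E +
      (c ^+ 2 / 2 * g2 x)%:E * (y ^+ 2)%:E + (r * (K * `|c| ^+ 3))%:E * (`|y| ^+ 3)%:E in
    nu.-integrable setT q /\
    \int[nu]_y q y = (g x + c ^+ 2 * v / 2 * g2 x + r * (K * `|c| ^+ 3 * M))%:E.
  have j1 := integrableZl measurableT (c * g1 x) i1.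
  have j2 := integrableZl measurableT (c ^+ 2 / 2 * g2 x) i2.
  have j3 := integrableZl measurableT (r * (K * `|c| ^+ 3)) i3.
  have k1 := integrableD measurableT (i0 (g x)) j1.
  have k2 := integrableD measurableT k1 j2.
  split; first exact: integrableD.
  rewrite integralD// integralD// integralD// !integralZl//.
  rewrite integral_cst_probability m1 m2 m3 mule0 adde0 -!EFinM -!EFinD.
  by congr EFin; ring.
have qE (r y : R) : (g x)%:E + (c * g1 x)%:E * y%:E +
      (c ^+ 2 / 2 * g2 x)%:E * (y ^+ 2)%:E + (r * (K * `|c| ^+ 3))%:E * (`|y| ^+ 3)%:E =
    (g x + (c * y) * g1 x + (c * y) ^+ 2 / 2 * g2 x + r * (K * `|c * y| ^+ 3))%:E.
  by rewrite -!EFinM -!EFinD normrM; congr EFin; ring.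
have [iU eU] := key 1%R; have [iL eL] := key (-1)%R.
have up : \int[nu]_y (g (x + c * y))%:E <=
    (g x + c ^+ 2 * v / 2 * g2 x + 1 * (K * `|c| ^+ 3 * M))%:E.
  rewrite -eU; apply: le_integral => // y _; rewrite qE lee_fin mul1r.
  by have := T x (c * y)%R; rewrite ler_norml => /andP[_]; lra.
have lo : (g x + c ^+ 2 * v / 2 * g2 x + -1 * (K * `|c| ^+ 3 * M))%:E <=
    \int[nu]_y (g (x + c * y))%:E.
  rewrite -eL; apply: le_integral => // y _; rewrite qE lee_fin.
  by have := T x (c * y)%R; rewrite ler_norml => /andP[]; lra.
split; first by rewrite (le_trans up)// -EFinD lee_fin mul1r.
rewrite -leeBlDr//; apply: le_trans lo; rewrite -EFinB lee_fin; lra.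
Qed.

Lemma replacement nu1 nu2 M1 M2 : moment_bound nu1 M1 -> moment_bound nu2 M2 ->
  forall x c, close_within (K * `|c| ^+ 3 * (M1 + M2))
    (\int[nu1]_y (g (x + c * y))%:E) (\int[nu2]_y (g (x + c * y))%:E).
Proof.
move=> b1 b2 x c; have [g2 H] := taylor_integral.
rewrite mulrDr; apply: close_within_trans (H _ _ b1 x c) _.
by have [] := H _ _ b2 x c; split.
Qed.

Section gaussian.
Hypothesis v0 : (0 <= v)%R.
Let sigma := Num.sqrt v.

Let msigma : measurable_fun setT (fun z : R => (sigma * z)%R).
Proof. exact: measurable_funM. Qed.

Definition normal_law : probability R R := image_probability std_normal msigma.

Lemma integral_normal_law (f : R -> \bar R) : measurable_fun setT f -> (forall x, 0 <= f x) ->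
  \int[normal_law]_y f y = \int[std_normal]_z f (sigma * z)%R.
Proof. exact: integral_image_probability. Qed.

Lemma normal_law_moments : exists2 M, (0 <= M)%R & moment_bound normal_law M.
Proof.
have M3 := @std_normal_cube R; set I3 := \int[_]_z _ in M3.
have I30 : 0 <= I3 by apply: integral_ge0 => z _; rewrite lee_fin exprn_ge0.
have fI3 : I3 \is a fin_num by rewrite ge0_fin_numE.
have m3 : measurable_fun setT (fun z : R => (`|z| ^+ 3)%:E).
  by apply/measurable_EFinP; apply: measurable_funX; exact: normr_measurable.
have m2 : measurable_fun setT (fun z : R => (z ^+ 2)%:E).
  by apply/measurable_EFinP; exact: measurable_funX.
have sg0 : (0 <= sigma)%R by exact: sqrtr_ge0.
have is1 := integrableZl measurableT sigma (@std_normal_integrable R).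
exists (sigma ^+ 3 * fine I3)%R; first by rewrite mulr_ge0 ?exprn_ge0// fine_ge0.
split.
- apply/integrableP; split; first exact/measurable_EFinP.
  rewrite integral_normal_law//; last first.
    by apply/measurable_EFinP; exact: normr_measurable.
  by have /integrableP[] := is1.
- have -> : \int[normal_law]_y y%:E = \int[std_normal]_z (sigma%:E * z%:E).
    by apply: integral_distribution => //; exact/measurable_EFinP.
  by rewrite integralZl ?std_normal_mean ?mule0//; exact: std_normal_integrable.
- rewrite integral_normal_law//; last by move=> x; rewrite lee_fin sqr_ge0.
  under eq_integral do rewrite exprMn sqr_sqrtr// EFinM.
  rewrite ge0_integralZl//; first by rewrite std_normal_var mule1.
  by move=> x _; rewrite lee_fin sqr_ge0.
- rewrite integral_normal_law//.
  under eq_integral do rewrite normrM exprMn ger0_norm// EFinM.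
  rewrite ge0_integralZl//.
  + by rewrite [RHS]EFinM fineK.
  + by rewrite lee_fin exprn_ge0.
Qed.

End gaussian.

Fixpoint dot (cs l : seq R) : R :=
  if cs is c :: cs' then (c * nth 0%R l 0 + dot cs' (behead l))%R else 0%R.

Lemma measurable_dot d (D : measurableType d) cs (L : D -> seq R) :
  mlist (size cs) L -> measurable_fun setT (fun w => dot cs (L w)).
Proof.
elim: cs L => [|c cs IH] L mL /=; first exact: measurable_cst.
apply: measurable_funD; first by apply: measurable_funM => //; exact: mL.2.
by apply: IH; exact: mlist_behead.
Qed.

Lemma mlist_fun_test_dot cs : mlist_fun (size cs) (fun (x : R) l => (g (x + dot cs l)%R)%:E).
Proof.
move=> d D x L mx mL; apply/measurable_EFinP; apply: (measurableT_comp mg).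
by apply: measurable_funD => //; exact: measurable_dot.
Qed.

(* Trotter's form of Lindeberg's argument: the summands are replaced one at a
   time by normal variables of the same variance. *)
Lemma trotter nu M : (0 <= v)%R -> (0 <= M)%R -> moment_bound nu M ->
  exists2 C : R, (0 <= C)%R & forall cs, all (fun c => 0 <= c)%R cs -> forall x,
    close_within (C * \sum_(c <- cs) c ^+ 3)
      (iint nu (size cs) (fun l => (g (x + dot cs l)%R)%:E))
      (\int[std_normal]_z (g (x + Num.sqrt (v * \sum_(c <- cs) c ^+ 2) * z)%R)%:E).
Proof.
move=> v0 M0 bnu; have [M2 M20 b2] := normal_law_moments v0.
exists (K * (M + M2))%R; first by rewrite mulr_ge0// addr_ge0.
elim=> [|c cs IH] /= ccs x.
  rewrite !big_nil !mulr0 sqrtr0 addr0.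
  under eq_integral do rewrite mul0r addr0.
  by rewrite integral_cst_probability; exact: close_within_refl.
have /andP[c0 cs0] := ccs; rewrite !big_cons.
set S3 := (\sum_(c <- cs) c ^+ 3)%R; set S2 := (\sum_(c <- cs) c ^+ 2)%R.
have S30 : (0 <= S3)%R.
  rewrite /S3 big_seq; apply: sumr_ge0 => i ics; apply: exprn_ge0.
  exact: (allP cs0).
have S20 : (0 <= S2)%R by apply: sumr_ge0 => i _; exact: sqr_ge0.
pose t := Num.sqrt (v * S2).
have C0 : (0 <= K * (M + M2))%R by rewrite mulr_ge0// addr_ge0.
pose A y := iint nu (size cs) (fun l => (g (x + c * y + dot cs l)%R)%:E).
have -> : \int[nu]_y iint nu (size cs) (fun l => (g (x + (c * y + dot cs l))%R)%:E) =
    \int[nu]_y A y.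
  by apply: eq_integral => y _; apply: eq_iint => l _; rewrite addrA.
have mxy : measurable_fun setT (fun y : R => x + c * y)%R.
  by apply: measurable_funD => //; exact: measurable_funM.
have mA : measurable_fun setT A.
  apply: (measurable_iint nu (H := fun y l => (g (x + c * y + dot cs l)%R)%:E)).
    move=> d D y L my mL; apply: (mlist_fun_test_dot (g := fun w => (x + c * y w)%R)) => //.
    exact: (measurableT_comp mxy my).
  by move=> *; exact: test_ge0.
pose G (y z : R) := (g (x + c * y + t * z)%R)%:E.
have mG : measurable_fun setT (fun p : R * R => G p.1 p.2).
  apply/measurable_EFinP; apply: (measurableT_comp mg).
  apply: measurable_funD; first by apply: measurable_funD => //; exact: measurable_funM.
  exact: measurable_funM.
have G0 y z : 0 <= G y z by exact: test_ge0.
have mB : measurable_fun setT (fun y => \int[std_normal]_z G y z).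
  exact: (@measurable_fun_fubini_tonelli_F _ _ R R R std_normal _ mG (fun p => G0 p.1 p.2)).
rewrite mulrDr addrC.
(* In the intermediate quantity the tail is already normal, by induction from the start [x + c * y],
   while the head still has law [nu]. *)
apply: (@close_within_trans _ _ _ (\int[nu]_y \int[std_normal]_z G y z)).
  apply: close_within_integral => //.
  - by rewrite mulr_ge0.
  - by move=> y; apply: (iint_ge0 nu) => *; exact: test_ge0.
  - by move=> y; apply: integral_ge0 => *; exact: test_ge0.
  - by move=> y; exact: (IH cs0 (x + c * y)%R).
(* With the integrals exchanged, the head is replaced while the normal tail is frozen; the two
   normal variables then merge by convolution. *)
have /= -> := @fubini_tonelli _ _ _ _ R nu std_normal _ mG (fun p => G0 p.1 p.2).
pose h w := (g (x + w)%R)%:E.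
have mh : measurable_fun setT h.
  by apply/measurable_EFinP; apply: (measurableT_comp mg); exact: measurable_funD.
have cs2 : (0 <= c * Num.sqrt v)%R by rewrite mulr_ge0// sqrtr_ge0.
have := std_normal_convolution (sqrtr_ge0 _ : (0 <= t)%R) cs2 mh (fun=> test_ge0 _).
have -> : (t ^+ 2 + (c * Num.sqrt v) ^+ 2 = v * (c ^+ 2 + S2))%R.
  by rewrite exprMn !sqr_sqrtr ?mulr_ge0//; ring.
rewrite -/(h _) => <-.
have mG' : measurable_fun setT (fun p : R * R => G p.2 p.1).
  apply: (measurableT_comp mG (f := fun p => G p.1 p.2) (g := fun p : R * R => (p.2, p.1))).
  exact: measurable_fun_pair.
apply: close_within_integral => //.
- by rewrite mulr_ge0// exprn_ge0.
- exact: (@measurable_fun_fubini_tonelli_F _ _ R R R nu _ mG' (fun p => G0 p.2 p.1)).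
- apply: (@measurable_fun_fubini_tonelli_F _ _ R R R std_normal
    (fun p : R * R => h (t * p.1 + c * Num.sqrt v * p.2)%R)).
    by apply: (measurableT_comp mh); apply: measurable_funD; exact: measurable_funM.
  by move=> p; exact: test_ge0.
- by move=> z; apply: integral_ge0 => *; exact: test_ge0.
- by move=> z; apply: integral_ge0 => *; exact: test_ge0.
move=> z.
have := replacement bnu b2 (x + t * z)%R c.
rewrite integral_normal_law; last 2 first.
- exact: measurable_test_affine.
- by move=> y; exact: test_ge0.
rewrite ger0_norm// mulrAC.
have -> : \int[nu]_y (g (x + t * z + c * y)%R)%:E = \int[nu]_y G y z.
  by apply: eq_integral => y _; rewrite /G addrAC.
have -> : \int[std_normal]_u (g (x + t * z + c * (Num.sqrt v * u))%R)%:E =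
    \int[std_normal]_u h (t * z + c * Num.sqrt v * u)%R.
  by apply: eq_integral => u _; rewrite /h addrA mulrA.
by [].
Qed.

End replacement.
End lindeberg.

(** * Weak convergence through logistic test functions *)

Section weak_convergence.
Context {R : realType}.

(* A smooth approximation of the indicator function of ]-oo, x0]. *)
Definition test (x0 e y : R) : R := logistic ((y - x0) / e).

Lemma test01 x0 e y : 0 <= test x0 e y <= 1.
Proof. by rewrite ltW ?logistic_gt0// ltW// logistic_lt1. Qed.

Lemma measurable_logistic : measurable_fun setT (@logistic R).
Proof.
rewrite (_ : @logistic R = (-%R) \o (fun t => - logistic t)); last first.
  by apply/funext => t /=; rewrite opprK.
apply: measurable_funN; apply: (nondecreasing_measurable measurableT) => x y xy.
by rewrite lerN2 logistic_ni.
Qed.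

Lemma measurable_test x0 e : measurable_fun setT (test x0 e).
Proof.
apply: (measurableT_comp measurable_logistic); apply: measurable_funM => //.
exact: measurable_funB.
Qed.

Lemma smooth_test_logistic x0 e : 0 < e -> smooth_test (e^-1 ^+ 3) (test x0 e).
Proof.
move=> e0; split; [exact: measurable_test|exact: test01|].
exists (fun x => let r := test x0 e x in r * (r - 1) / e).
exists (fun x => let r := test x0 e x in (2 * r - 1) * (r * (r - 1)) / e ^+ 2) => x h.
have := logistic_taylor ((x - x0) / e) (h / e).
rewrite /test (_ : (x + h - x0) / e = (x - x0) / e + h / e); last first.
  by rewrite -mulrDl addrAC.
rewrite normrM [`|e^-1|]gtr0_norm ?invr_gt0// => H.
rewrite [leRHS]mulrC -exprMn; apply: le_trans H; move: (logistic _) (logistic _) => r r'.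
rewrite le_eqVlt; apply/orP; left; apply/eqP; congr (`|_|).
by field; rewrite gt_eqF.
Qed.

Section bounds.
Context d (T : measurableType d) (P : probability T R) (S : T -> R).
Hypothesis mS : measurable_fun setT S.
Variables (x0 e dl eta : R).
Hypotheses (e0 : 0 < e) (eta0 : 0 < eta) (deta : logistic (dl / e) <= eta).

Let mI (x : R) : measurable [set w | S w <= x].
Proof. by apply: measurable_pred_set; exact: measurable_fun_ler. Qed.

Lemma measurable_test_comp : measurable_fun setT (fun w => (test x0 e (S w))%:E).
Proof. by apply/measurable_EFinP; apply: (measurableT_comp (measurable_test x0 e)). Qed.

Let mIf (x : R) : measurable_fun setT (fun w => ((S w <= x)%R%:R : R)%:E).
Proof.
apply/measurable_EFinP.
rewrite (_ : (fun w => _) = (fun w => if S w <= x then 1 else 0)); last first.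
  by apply/funext => w; case: (_ <= _).
by apply: measurable_fun_ifT => //; exact: measurable_fun_ler.
Qed.

Let IE (x : R) : (\int[P]_w ((S w <= x)%R%:R : R)%:E = P [set w | (S w <= x)%R])%E.
Proof. by apply: integral_pred; exact: measurable_fun_ler. Qed.

Lemma integral_test_le :
  (\int[P]_w (test x0 e (S w))%:E <= P [set w | (S w <= x0 + dl)%R] + eta%:E)%E.
Proof.
rewrite -IE -(integral_cst_probability P eta%:E) -ge0_integralD//; last first.
  by move=> w _; rewrite lee_fin ltW.
apply: ge0_le_integral => //.
- by move=> w _; rewrite lee_fin; have /andP[] := test01 x0 e (S w).
- exact: measurable_test_comp.
- exact: emeasurable_funD.
move=> w _; rewrite -EFinD lee_fin; have [H|H] := leP (S w) (x0 + dl).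
  by have /andP[_ H1] := test01 x0 e (S w); rewrite (le_trans H1)// lerDl ltW.
rewrite add0r; apply: le_trans deta; apply: logistic_ni.
by rewrite ler_pM2r ?invr_gt0// lerBrDl ltW.
Qed.

Lemma logistic_sym t : logistic (- t) = 1 - logistic t :> R.
Proof.
rewrite /logistic expRN; have e1 := expR_gt0 t.
by field; rewrite !gt_eqF// ?addr_gt0.
Qed.

Lemma le_integral_test :
  (P [set w | (S w <= x0 - dl)%R] <= \int[P]_w (test x0 e (S w))%:E + eta%:E)%E.
Proof.
rewrite -IE -(integral_cst_probability P eta%:E) -ge0_integralD//; first last.
- by move=> w _; rewrite lee_fin ltW.
- exact: measurable_test_comp.
- by move=> w _; rewrite lee_fin; have /andP[] := test01 x0 e (S w).
apply: ge0_le_integral => //.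
- by apply: emeasurable_funD => //; exact: measurable_test_comp.
move=> w _; rewrite -EFinD lee_fin; have /andP[t0 _] := test01 x0 e (S w).
have [H|H] := leP (S w) (x0 - dl); last by rewrite addr_ge0// ltW.
rewrite -lerBlDr; apply: le_trans (_ : 1 - logistic (dl / e) <= _).
  by rewrite lerD2l lerN2.
rewrite -logistic_sym; apply: logistic_ni.
by rewrite -mulNr ler_pM2r ?invr_gt0// lerBlDl.
Qed.

End bounds.

Lemma exists_sharp_test (dl eta : R) : 0 < dl -> 0 < eta ->
  exists2 e, 0 < e & logistic (dl / e) <= eta.
Proof.
(* Then [dl / e = eta^-1], and [expR eta^-1] is larger than [eta^-1]. *)
move=> dl0 eta0; exists (dl * eta); first exact: mulr_gt0.
rewrite invfM mulrA divff ?gt_eqF// mul1r.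
rewrite -[leRHS]invrK lef_pV2 ?posrE ?addr_gt0 ?expR_gt0 ?invr_gt0//.
have := expR_ge1Dx eta^-1; lra.
Qed.

(** The limit variable has a probability space of its own: only its law enters. *)
Definition weak_cvg d (T : measurableType d) (Q : probability T R) (S : nat -> T -> R)
    d' (T' : measurableType d') (P : probability T' R) (Z : T' -> R) : Prop :=
  forall x0 e : R, 0 < e ->
    (\int[Q]_w (test x0 e (S n w))%:E)%E @[n --> \oo] --> (\int[P]_w (test x0 e (Z w))%:E)%E.

Lemma test_fin_num d (T : measurableType d) (P : probability T R) (Y : T -> R) x0 e :
  measurable_fun setT Y -> (\int[P]_w (test x0 e (Y w))%:E)%E \is a fin_num.
Proof.
move=> mY; rewrite ge0_fin_numE; last first.
  by apply: integral_ge0 => w _; rewrite lee_fin; have /andP[] := test01 x0 e (Y w).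
apply: le_lt_trans (ltry 1); rewrite -(integral_cst_probability P 1%:E).
apply: ge0_le_integral => //.
- by move=> w _; rewrite lee_fin; have /andP[] := test01 x0 e (Y w).
- exact: measurable_test_comp.
- by move=> w _; rewrite lee_fin; have /andP[] := test01 x0 e (Y w).
Qed.

Lemma fine_le_eta (a b : \bar R) (r : R) : a \is a fin_num -> b \is a fin_num ->
  (a <= b + r%:E)%E -> fine a <= fine b + r.
Proof. by move=> fa fb; rewrite -{1}(fineK fa) -{1}(fineK fb) -EFinD lee_fin. Qed.

Let sandwich (eps q hx hu hl au bu al bl : R) : 0 < eps ->
  q <= au + eps / 4 -> bu <= hu + eps / 4 -> al <= q + eps / 4 -> hl <= bl + eps / 4 ->
  `|bu - au| <= eps / 4 -> `|bl - al| <= eps / 4 ->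
  hu <= hx + eps / 4 -> hx - eps / 4 <= hl -> `|hx - q| <= eps.
Proof.
move=> e0 h1 h2 h3 h4; rewrite !ler_norml => /andP[h5 h6] /andP[h7 h8] h9 h10.
by apply/andP; split; lra.
Qed.

Lemma weak_cvg_in_distribution d (T : measurableType d) (Q : probability T R) (S : nat -> T -> R)
    d' (T' : measurableType d') (P : probability T' R) (Z : T' -> R) :
  (forall n, measurable_fun setT (S n)) -> measurable_fun setT Z ->
  weak_cvg Q S P Z ->
  cvg_in_distribution Q S (fun A => P [set w | A (Z w)]).
Proof.
move=> mS mZ cS x cx.
have mSx n y : measurable [set w | S n w <= y].
  by apply: measurable_pred_set; exact: measurable_fun_ler.
have mZx y : measurable [set w | Z w <= y].
  by apply: measurable_pred_set; exact: measurable_fun_ler.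
pose h y := fine (P [set w | Z w <= y]).
have fZ y : P [set w | Z w <= y] \is a fin_num by exact: fin_num_measure.
have fS n y : Q [set w | S n w <= y] \is a fin_num by exact: fin_num_measure.
have E y : [set w | `]-oo, y]%classic (Z w)] = [set w | Z w <= y].
  by apply/seteqP; split => w /=; rewrite in_itv.
have ch : h y @[y --> x] --> h x.
  have -> : h = fun y => fine (P [set w | `]-oo, y]%classic (Z w)]).
    by apply/funext => y; rewrite E.
  by apply: fine_cvg; rewrite fineK; [exact: cx|rewrite E; exact: fZ].
rewrite E -(fineK (fZ x)); apply/fine_cvgP; split; first by near=> n; exact: fS.
apply/cvgrPdist_le => eps eps0.
pose eta := eps / 4; have eta0 : 0 < eta by rewrite divr_gt0.
move/cvgrPdist_le : ch => /(_ eta eta0) /nbhs_ballP[r r0 rx].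
(* Two shifts by [dl] are made on either side of [x]: one for the centre of the test function, one
   for its transition. The choice [r / 4] keeps both inside the ball where [h] varies by at most
   [eta]. *)
pose dl := r / 4; have dl0 : 0 < dl by rewrite divr_gt0.
have dlr : dl + dl < r by rewrite /dl; have := r0; rewrite /=; lra.
have [e e0 sharp] := exists_sharp_test dl0 eta0.
have hu : h (x + dl + dl) <= h x + eta.
  have : ball x r (x + dl + dl).
    have xE : x - (x + dl + dl) = - (dl + dl) by ring.
    by rewrite /ball /= xE normrN gtr0_norm// addr_gt0.
  by move=> /rx; rewrite ler_norml => /andP[+ _]; lra.
have hl : h x - eta <= h (x - dl - dl).
  have : ball x r (x - dl - dl).
    have xE : x - (x - dl - dl) = dl + dl by ring.
    by rewrite /ball /= xE gtr0_norm// addr_gt0.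
  by move=> /rx; rewrite ler_norml => /andP[_ +]; lra.
have := cS (x + dl) e e0; rewrite -(fineK (test_fin_num P (x + dl) e mZ)).
move=> /fine_cvgP[_ /cvgrPdist_le /(_ eta eta0) Cu].
have := cS (x - dl) e e0; rewrite -(fineK (test_fin_num P (x - dl) e mZ)).
move=> /fine_cvgP[_ /cvgrPdist_le /(_ eta eta0) Cl].
move: Cu Cl; apply: filterS2 => n /= Cu Cl.
have U1 := fine_le_eta (fS n _) (test_fin_num Q _ _ (mS n)) (le_integral_test Q (mS n) (x + dl) e0 eta0 sharp).
have U2 := fine_le_eta (test_fin_num P _ _ mZ) (fZ _) (integral_test_le P mZ (x + dl) e0 eta0 sharp).
have L1 := fine_le_eta (test_fin_num Q _ _ (mS n)) (fS n _) (integral_test_le Q (mS n) (x - dl) e0 eta0 sharp).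
have L2 := fine_le_eta (fZ _) (test_fin_num P _ _ mZ) (le_integral_test P mZ (x - dl) e0 eta0 sharp).
rewrite addrK in U1; rewrite subrK in L1.
exact: (sandwich eps0 U1 U2 L1 L2 Cu Cl hu hl).
Unshelve. all: by end_near. Qed.

(** The test function has Lipschitz constant [e^-1] and values in [0, 1]: one [eta] comes from the
    event where the variables are within [eta * e] of each other, the other from its complement. *)
Lemma close_within_test d (T : measurableType d) (Q : probability T R) (Y Y' : T -> R)
    x0 e eta : 0 < e -> 0 < eta -> measurable_fun setT Y -> measurable_fun setT Y' ->
  (Q [set w | (eta * e <= `|Y w - Y' w|)%R] <= eta%:E)%E ->
  close_within (eta + eta) (\int[Q]_w (test x0 e (Y w))%:E) (\int[Q]_w (test x0 e (Y' w))%:E).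
Proof.
move=> e0 eta0 mY mY' QD.
have mD (U W : T -> R) : measurable_fun setT U -> measurable_fun setT W ->
    measurable_fun setT (fun w => eta * e <= `|U w - W w|).
  move=> mU mW; apply: measurable_fun_ler => //; apply: measurableT_comp => //.
  exact: measurable_funB.
have half (U W : T -> R) : measurable_fun setT U -> measurable_fun setT W ->
    (Q [set w | (eta * e <= `|U w - W w|)%R] <= eta%:E)%E ->
    (\int[Q]_w (test x0 e (U w))%:E <= \int[Q]_w (test x0 e (W w))%:E + (eta + eta)%:E)%E.
  move=> mU mW QUW.
  have mI : measurable_fun setT (fun w => ((eta * e <= `|U w - W w|)%R%:R : R)%:E).
    apply/measurable_EFinP.
    rewrite (_ : (fun w => _) = (fun w => if eta * e <= `|U w - W w| then 1 else 0)).
      by apply: measurable_fun_ifT => //; exact: mD.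
    by apply/funext => w; case: (_ <= _).
  apply: (@le_trans _ _ (\int[Q]_w ((test x0 e (W w))%:E +
      (eta%:E + ((eta * e <= `|U w - W w|)%R%:R)%:E)))%E).
    apply: ge0_le_integral => //.
    - by move=> w _; rewrite lee_fin; have /andP[] := test01 x0 e (U w).
    - exact: measurable_test_comp.
    - by apply: emeasurable_funD; [exact: measurable_test_comp|exact: emeasurable_funD].
    move=> w _; rewrite -!EFinD lee_fin.
    have /andP[u0 u1] := test01 x0 e (U w); have /andP[w0 w1] := test01 x0 e (W w).
    have [H|H] := leP (eta * e) (`|U w - W w|); first by rewrite /=; lra.
    rewrite addr0 -lerBlDl; apply: le_trans (ler_norm _) _.
    apply: le_trans (logistic_lipschitz _ _) _.
    rewrite -mulrBl opprB addrA subrK normrM [`|e^-1|]gtr0_norm ?invr_gt0//.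
    by rewrite ler_pdivrMr// ltW.
  have nW w : [set: T] w -> (0 <= (test x0 e (W w))%:E)%E.
    by move=> _; rewrite lee_fin; have /andP[] := test01 x0 e (W w).
  have mW' := measurable_test_comp mW x0 e.
  have nI w : [set: T] w -> (0 <= eta%:E + ((eta * e <= `|U w - W w|)%R%:R)%:E)%E.
    by move=> _; rewrite -EFinD lee_fin addr_ge0// ltW.
  have mI' : measurable_fun setT
      (fun w => eta%:E + ((eta * e <= `|U w - W w|)%R%:R : R)%:E)%E.
    exact: emeasurable_funD.
  rewrite ge0_integralD//.
  rewrite ge0_integralD//; last by move=> w _; rewrite lee_fin ltW.
  rewrite integral_cst_probability integral_pred; last exact: mD.
  by rewrite EFinD leeD2l// leeD2l.
split; apply: half => //.
by under eq_set do rewrite distrC.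
Qed.

Lemma cvge_close (a b : nat -> \bar R) (l : R) :
  (forall eta : R, 0 < eta -> \forall n \near \oo, close_within eta (b n) (a n)) ->
  a @ \oo --> l%:E -> b @ \oo --> l%:E.
Proof.
move=> ab /fine_cvgP[fa ca].
have fb : \forall n \near \oo, b n \is a fin_num.
  have := ab _ ltr01; apply: filterS2 fa => n fa [b1 b2].
  rewrite fin_numElt; apply/andP; split.
    rewrite ltNye; apply/eqP => bn; rewrite bn addNye leeNy_eq in b2.
    by move: fa; rewrite (eqP b2).
  by apply: le_lt_trans b1 _; rewrite -(fineK fa) -EFinD ltry.
apply/fine_cvgP; split => //; apply/cvgrPdist_le => e e0.
have e20 : 0 < e / 2 by rewrite divr_gt0.
move/cvgrPdist_le : ca => /(_ _ e20) ca.
have fab : \forall n \near \oo, a n \is a fin_num /\ b n \is a fin_num.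
  by apply: filterS2 fa fb => n; split.
have cab : \forall n \near \oo, `|l - fine (a n)| <= e / 2 /\ close_within (e / 2) (b n) (a n).
  have := ab _ e20; apply: filterS2 ca => n; by split.
move: fab cab; apply: filterS2 => n [fan fbn] [].
move=> lan [b1 b2] /=.
have := fine_le_eta fbn fan b1; have := fine_le_eta fan fbn b2.
move: lan; rewrite !ler_norml => /andP[h1 h2] h3 h4.
by apply/andP; split; lra.
Qed.

Lemma weak_cvg_slutsky d (T : measurableType d) (Q : probability T R) (S S' : nat -> T -> R)
    d' (T' : measurableType d') (P : probability T' R) (Z : T' -> R) :
  (forall n, measurable_fun setT (S n)) -> (forall n, measurable_fun setT (S' n)) ->
  measurable_fun setT Z ->
  cvg_in_probability Q (fun n w => S n w - S' n w) 0 ->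
  weak_cvg Q S' P Z -> weak_cvg Q S P Z.
Proof.
move=> mS mS' mZ cSS' cS' x0 e e0.
rewrite -(fineK (test_fin_num P x0 e mZ)).
apply: cvge_close; last by rewrite fineK; [exact: cS'|exact: test_fin_num].
move=> eta eta0; have eta20 : 0 < eta / 2 by rewrite divr_gt0.
have /cvge0P := cSS' _ (mulr_gt0 eta20 e0).
move=> /(_ (fun=> measure_ge0 _ _) _ eta20); apply: filterS => n.
under eq_set do rewrite subr0.
move=> H; rewrite [eta]splitr; exact: close_within_test.
Qed.

End weak_convergence.

(** * Central limit theorem for triangular arrays of weights *)

Section clt.
Context {R : realType} {d : measure_display} {T : measurableType d}
  (Q : probability T R).
Variable E : nat -> {RV Q >-> R}.
Hypothesis hE : iid_std_exponential E.
Variables (s tau : R) (k : nat -> nat) (c : nat -> nat -> R).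
Hypotheses (s0 : 0 < s) (tau0 : 0 < tau).
Hypothesis c0 : forall n j, (0 < j)%N -> 0 <= c n j.
Hypothesis c2 : \forall n \near \oo,
  v_coef s * (\sum_(1 <= j < (k n).+1) c n j ^+ 2) = tau ^+ 2.
Hypothesis c3 : (fun n => \sum_(1 <= j < (k n).+1) c n j ^+ 3) @ \oo --> 0.

Lemma pow_law_moment_bound : exists2 M, 0 <= M & moment_bound (v_coef s) (pow_law s) M.
Proof.
have M3 := pow_law_cube s0; set I3 := (\int[_]_z _)%E in M3.
have I30 : (0 <= I3)%E by apply: integral_ge0 => z _; rewrite lee_fin exprn_ge0.
exists (fine I3); first exact: fine_ge0.
split; [exact: pow_law_integrable|exact: pow_law_mean|exact: pow_law_var|].
by rewrite fineK// ge0_fin_numE.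
Qed.

Lemma dot_map (cc y : nat -> R) (J : seq nat) :
  dot [seq cc j | j <- J] [seq y j | j <- J] = \sum_(j <- J) cc j * y j.
Proof.
by elim: J => [|j J IH]; rewrite ?big_nil// big_cons /= -IH.
Qed.

Lemma weighted_sum_weak_cvg :
  weak_cvg Q (fun n => weighted_sum E s (c n) 1 (k n).+1) std_normal (fun z => tau * z).
Proof.
move=> x0 e e0.
have e30 : 0 <= (e^-1) ^+ 3 by rewrite exprn_ge0// invr_ge0 ltW.
have [M M0 bM] := pow_law_moment_bound.
have [C C0 HC] := trotter e30 (smooth_test_logistic x0 e0) (ltW (v_coef_gt0 s0)) M0 bM.
have mZ : measurable_fun setT (fun z : R => tau * z) by exact: measurable_funM.
rewrite -(fineK (test_fin_num std_normal x0 e mZ)).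
apply: cvge_close (cvg_cst _) => eta eta0.
(* The denominator is [C + 1] because [C] may vanish. *)
have eC : 0 < eta / (C + 1) by rewrite divr_gt0// ltr_wpDl.
have c3' : \forall n \near \oo, \sum_(1 <= j < (k n).+1) c n j ^+ 3 <= eta / (C + 1).
  move/cvgrPdist_le : c3 => /(_ _ eC); apply: filterS => n.
  by rewrite sub0r normrN; apply: le_trans (ler_norm _).
move: c2 c3'; apply: filterS2 => n v2 v3.
rewrite fineK; last exact: test_fin_num.
pose J := index_iota 1 (k n).+1.
have J0 : {in J, forall i, (0 < i)%N} by move=> i; rewrite mem_index_iota => /andP[].
have := HC [seq c n j | j <- J] _ 0.
rewrite !big_map v2 sqrtr_sqr gtr0_norm// size_map.
have -> : all (fun x => 0 <= x) [seq c n j | j <- J].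
  by apply/allP => _ /mapP[j /J0 j0 ->]; exact: c0.
move=> /(_ isT).
rewrite -(integral_sample_pow hE s (iota_uniq _ _) J0) //; first last.
- by move=> l _; rewrite lee_fin; have /andP[] := test01 x0 e (0 + dot [seq c n j | j <- J] l).
- move=> d0 D g L _ mL; apply: measurable_test_comp; apply: measurable_funD => //.
  by apply: measurable_dot; rewrite size_map.
under eq_integral do rewrite dot_map add0r.
under [X in close_within _ _ X]eq_integral do rewrite add0r.
move=> [H1 H2].
have CC : C * (\sum_(j <- J) c n j ^+ 3) <= eta.
  apply: le_trans (_ : (C + 1) * (eta / (C + 1)) <= _); last first.
    by rewrite mulrC divfK// gt_eqF// ltr_wpDl.
  apply: ler_pM => //; last by rewrite lerDl.
  by rewrite big_seq; apply: sumr_ge0 => j /J0 j0; rewrite exprn_ge0// c0.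
split.
- by apply: le_trans H1 _; rewrite leeD2l// lee_fin.
- by apply: le_trans H2 _; rewrite leeD2l// lee_fin.
Qed.

End clt.

(** * Integrals of g(t)/t and perturbation of powers *)

Section calculus.
Context {R : realType}.
Local Notation mu := (@lebesgue_measure R).

(** The mean of a standard exponential variable. It makes [centered_pow 1 x] equal to [x - 1] for
    positive [x], so that the concentration of V_j is a case of weighted sums with exponent 1. *)
Lemma Gamma2 : Gamma (1 + 1) = 1 :> R.
Proof.
pose f (t : R) := t * expR (- t); pose F (t : R) := - ((1 + t) * expR (- t)).
have dE (t : R) : is_derive t (1 : R) (fun x => expR (- x)) (- expR (- t)).
  have := is_derive1_comp (is_derive_expR (- t)) (is_deriveN (is_derive_id t (1 : R))).
  by rewrite /= mulrN1.
have dF (t : R) : is_derive t (1 : R) F (f t).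
  have d1 := is_derive_fD (is_derive_fcst t 1) (is_derive_fid t).
  have := is_deriveN (is_derive_fM d1 (dE t)).
  have -> : - ((0 + 1) * expR (- t) + (1 + t) * - expR (- t)) = f t by rewrite /f; ring.
  exact.
have cF (t : R) : {for t, continuous F}.
  by apply/differentiable_continuous/derivable1_diffP; have [] := dF t.
have cf : continuous f.
  move=> t; apply/differentiable_continuous/derivable1_diffP.
  by have [] := is_derive_fM (is_derive_fid t) (dE t).
have F0 : F x @[x --> +oo%R] --> (0 : R).
  (* For x > 0, e^x is the square of e^(x/2) >= 1 + x/2, hence at least (1 + x)^2 / 4. *)
  have : (fun x : R => 4 / (1 + x)) x @[x --> +oo%R] --> (0 : R).
    rewrite -(mulr0 4); apply: cvgM; first exact: cvg_cst.
    apply/cvgr0Pnorm_le => e e0; near=> x.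
    have x0 : 0 < 1 + x by rewrite addr_gt0.
    rewrite normfV gtr0_norm// invf_ple ?posrE// -lerBlDl.
    by near: x; apply: nbhs_pinfty_ge; exact: num_real.
  move=> c4; apply: norm_cvg0; apply: (squeeze_cvgr _ (cvg_cst 0) c4).
  near=> x; rewrite normr_ge0 normrN ger0_norm; last first.
    by rewrite mulr_ge0 ?expR_ge0// addr_ge0.
  have x0 : 0 < 1 + x by rewrite addr_gt0.
  rewrite expRN ler_pdivrMr ?expR_gt0// mulrAC ler_pdivlMr//.
  have := expR_ge1Dx (x / 2); 
  have -> : expR x = expR (x / 2) * expR (x / 2) by rewrite -expRD -splitr.
  have xp : 0 < x by [].
  by move: (expR _) => r Hr; nra.
have := @ge0_continuous_FTC2y R f F 0 0.
move=> /(_ _ _ F0) H.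
rewrite /Gamma /Rintegral.
transitivity (fine (\int[mu]_(x in `[0%R, +oo[) (f x)%:E)%E).
  rewrite -integral_itv_obnd_cbnd//; last first.
    apply/measurable_EFinP; apply: measurable_funS (measurableT) _ _ => //.
    exact: continuous_measurable_fun.
  congr fine; apply: eq_integral => x; rewrite inE/= in_itv/= andbT => x0.
  by rewrite addrK powRr1 ?ltW.
rewrite H.
- by rewrite -EFinB /F sub0r opprK addr0 oppr0 expR0 mulr1.
- by move=> x x0; rewrite mulr_ge0 ?expR_ge0.
- by apply: continuous_subspaceT.
- by move=> x _; have [] := dF x.
- by apply: cvg_at_right_filter; exact: cF.
- by move=> x _; rewrite derive1E; have [_] := dF x.
Unshelve. all: by end_near. Qed.

Lemma integral_inv (u v : R) : 0 < u -> u <= v ->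
  mu.-integrable `]u, v]%classic (fun t => (t^-1)%:E) /\
  \int[mu]_(t in `]u, v]) t^-1 = ln v - ln u.
Proof.
move=> u0; rewrite le_eqVlt => /predU1P[<-|uv].
  rewrite set_itv_ge ?bnd_simp// Rintegral_set0 subrr; split => //.
  exact: integrable_set0.
have cI : {within `[u, v], continuous (fun t : R => t^-1)}.
  apply: continuous_in_subspaceT => t; rewrite inE/= in_itv/= => /andP[ut _].
  by apply: inv_continuous; rewrite gt_eqF// (lt_le_trans u0).
have iI : mu.-integrable `[u, v] (fun t : R => (t^-1)%:E).
  by apply: continuous_compact_integrable => //; exact: segment_compact.
have sub : `]u, v] `<=` `[u, v]%classic by exact: subset_itv_oc_cc.
have iI' : mu.-integrable `]u, v] (fun t : R => (t^-1)%:E) by exact: integrableS iI.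
split => //; rewrite Rintegral_itv_obnd_cbnd// /Rintegral.
rewrite (@continuous_FTC2 R _ (@ln R) u v uv cI)//.
- split.
  + move=> t; rewrite in_itv/= => /andP[ut _].
    by have [] := is_derive1_ln (lt_trans u0 ut).
  + by apply: cvg_at_right_filter; exact: continuous_ln.
  + by apply: cvg_at_left_filter; apply: continuous_ln; exact: lt_trans uv.
- move=> t; rewrite in_itv/= => /andP[ut _]; rewrite derive1E.
  by have [_ ->] := is_derive1_ln (lt_trans u0 ut).
Qed.

(** Used with [m = 0] for [b], and with [m] a value of the de Haan function for that function
    itself, whose integral is then nearly [m] times the logarithmic length. *)
Lemma logint_increment (g : R -> R) (u v m B : R) : log_integrable g -> 0 < u -> u <= v -> v < 1 ->
  (forall t, u < t <= v -> `|g t - m| <= B) ->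
  `|logint g u - logint g v - m * (ln v - ln u)| <= B * (ln v - ln u).
Proof.
move=> ig u0 uv v1 gB.
have iu : mu.-integrable `]u, 1[ (EFin \o (fun t => g t / t)).
  by apply: ig; rewrite u0 (le_lt_trans uv).
have iuv : mu.-integrable `]u, v] (fun t => (g t / t)%:E).
  apply: integrableS iu => //; apply: subset_itvl; by rewrite bnd_simp.
have iv : mu.-integrable `]v, 1[ (EFin \o (fun t => g t / t)).
  by apply: ig; rewrite (lt_le_trans u0 uv).
have -> : logint g u - logint g v = \int[mu]_(t in `]u, v]) (g t / t).
  rewrite /logint -(@Rintegral_itvB _ _ (BRight u) (BLeft 1) v iu) ?bnd_simp//.
  by rewrite subKr.
have mD : measurable (`]u, v]%classic : set (measurableTypeR R)) by exact: measurable_itv.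
have [i1 e1] := integral_inv u0 uv.
have iZ r : mu.-integrable `]u, v] (fun t => (r * t^-1)%:E).
  exact: (@integrableZl _ _ _ mu _ mD r _ i1).
have eZ r : \int[mu]_(t in `]u, v]) (r * t^-1) = r * (ln v - ln u).
  rewrite -e1 /Rintegral; under eq_integral do rewrite EFinM.
  rewrite integralZl// fineM//; exact: integrable_fin_num.
have iB := @integrableB _ _ _ mu _ mD _ _ iuv (iZ m).
rewrite -eZ -(RintegralB mD iuv (iZ m)) -(eZ B).
apply: le_trans (le_normr_Rintegral mD iB) _.
apply: (le_Rintegral mD _ (iZ B)); first exact: (integrable_abse iB).
move=> t; rewrite /= in_itv/= => /andP[ut tv].
have t0 : 0 < t by exact: lt_trans ut.
by rewrite -mulrBl normrM [`|t^-1|]gtr0_norm ?invr_gt0// ler_pM2r ?invr_gt0// gB// ut.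
Qed.

Let le_powR (s x y : R) : 0 < s -> 0 <= x -> x <= y -> x `^ s <= y `^ s.
Proof.
move=> s0 x0 xy; apply: ge0_ler_powR => //; first exact: ltW.
by rewrite nnegrE (le_trans x0).
Qed.

(** From y^s = x^s exp (- s (ln x - ln y)) and 1 - exp (- d) <= d, which treat s < 1 and s >= 1
    alike. The lower bound 1/2 on [y] turns the logarithmic difference into [2 * (x - y)]. *)
Lemma powR_lipschitz (s K x y : R) : 0 < s -> 2^-1 <= y -> y <= x -> x <= K ->
  x `^ s - y `^ s <= 2 * s * K `^ s * (x - y).
Proof.
move=> s0 y2 yx xK; have y0 : 0 < y by apply: lt_le_trans y2.
have x0 : 0 < x by exact: lt_le_trans yx.
have lnyx : ln x - ln y <= 2 * (x - y).
  rewrite -ln_div ?posrE// (_ : x / y = 1 + (x - y) / y); last by field; rewrite gt_eqF.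
  have xy0 : 0 <= (x - y) / y by rewrite divr_ge0 ?subr_ge0// ltW.
  apply: le_trans (le_ln1Dx _) _; first by apply: lt_le_trans xy0; lra.
  by rewrite mulrC ler_wpM2r ?subr_ge0// invf_ple ?posrE.
have xK' : x `^ s <= K `^ s by apply: le_powR => //; exact: ltW.
have -> : y `^ s = x `^ s * expR (- (s * (ln x - ln y))).
  by rewrite /powR !gt_eqF// -expRD; congr expR; ring.
have e1 := expR_ge1Dx (- (s * (ln x - ln y))).
have l0 : 0 <= ln x - ln y by rewrite subr_ge0 ler_ln.
have p0 := powR_ge0 x s; have d0 : 0 <= s * (ln x - ln y) by rewrite mulr_ge0// ltW.
apply: (@le_trans _ _ (x `^ s * (s * (ln x - ln y)))).
  rewrite -[X in X - _]mulr1 -mulrBr ler_wpM2l//; lra.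
apply: (@le_trans _ _ (K `^ s * (s * (2 * (x - y))))).
  by rewrite ler_pM// ler_wpM2l// ltW.
by rewrite le_eqVlt; apply/orP; left; apply/eqP; ring.
Qed.

(** The right side is a term of [remainder_sum] without its weight. Homogeneity reduces to a + r =
    1. If r is then small, both arguments lie between 1/2 and K + 1, where the power is Lipschitz;
    if not, both powers are bounded and r is bounded below. *)
Lemma powR_perturbation (s K : R) : 0 < s -> 1 <= K -> exists2 C : R, 0 <= C &
  forall a r rho : R, 0 < a -> 0 <= r -> `|rho| <= K * r -> 0 <= a + rho ->
  `|(a + rho) `^ s - a `^ s| <= C * (s * (a + r) `^ (s - 1) * r).
Proof.
move=> s0 K1; pose K' := K + 1; have K'0 : 0 < K' by rewrite /K'; lra.
pose C1 := 2 * s * K' `^ s * K; pose C2 := 2 * K' * (K' `^ s + 1).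
have p0 := powR_ge0 K' s.
have C10 : 0 <= C1 by rewrite /C1 !mulr_ge0// ltW//; lra.
have C20 : 0 <= C2 by rewrite /C2 mulr_ge0 ?addr_ge0// mulr_ge0// ltW.
(* the normalized inequality, where a + r = 1 *)
have key (al xi be : R) : 0 < al -> 0 <= xi -> 0 <= be -> al = 1 - be ->
    `|xi - al| <= K * be -> `|xi `^ s - al `^ s| <= (C1 + C2) * be.
  move=> al0 xi0 be0 alE; rewrite ler_norml => /andP[d1 d2].
  have [bs|bb] := leP (2 * K' * be) 1.
    have Kb : K * be + be <= 2^-1.
      have KE : K' * be = K * be + be by rewrite /K'; ring.
      by move: bs; rewrite -mulrA KE; lra.
    have Kb0 : 0 <= K * be by rewrite mulr_ge0//; lra.
    have al2 : 2^-1 <= al by lra.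
    have xi2 : 2^-1 <= xi by lra.
    have alK : al <= K' by rewrite /K'; lra.
    have xiK : xi <= K' by rewrite /K'; lra.
    have c0 : 0 <= 2 * s * K' `^ s by rewrite !mulr_ge0// ltW.
    apply: (@le_trans _ _ (C1 * be)); last by rewrite ler_wpM2r// lerDl.
    rewrite /C1 -mulrA; have [h|h] := leP al xi.
      rewrite ger0_norm ?subr_ge0; last by apply: le_powR => //; exact: ltW.
      by apply: le_trans (powR_lipschitz s0 al2 h xiK) _; rewrite ler_wpM2l.
    rewrite distrC ger0_norm ?subr_ge0; last by apply: le_powR => //; exact: ltW.
    apply: le_trans (powR_lipschitz s0 xi2 (ltW h) alK) _; rewrite ler_wpM2l//; lra.
  have al1 : al `^ s <= 1.
    have -> : 1 = 1 `^ s :> R by rewrite powR1.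
    by apply: le_powR; [|exact: ltW|lra].
  have Kb : K * be <= K * 1.
    have al0' := ltW al0.
    by rewrite ler_wpM2l//; lra.
  have xi1 : xi `^ s <= K' `^ s.
    by apply: le_powR => //; rewrite /K'; lra.
  have q0 := powR_ge0 xi s; have r0 := powR_ge0 al s.
  apply: (@le_trans _ _ (K' `^ s + 1)); first by rewrite ler_norml; apply/andP; split; lra.
  apply: (@le_trans _ _ (C2 * be)); last by rewrite ler_wpM2r// lerDr.
  rewrite /C2 mulrAC -[leLHS]mul1r ler_wpM2r// ?addr_ge0//; exact: ltW.
exists ((C1 + C2) / s); first by rewrite divr_ge0 ?addr_ge0// ltW.
move=> a r rho a0 r0 rhoK arho; pose A := a + r.
have A0 : 0 < A by rewrite /A ltr_wpDr.
have := key (a / A) ((a + rho) / A) (r / A).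
have -> : (a + rho) / A - a / A = rho / A by ring.
rewrite normrM [`|A^-1|]gtr0_norm ?invr_gt0// mulrA ler_pM2r ?invr_gt0// => H.
have AE (x : R) : 0 <= x -> x `^ s = A `^ s * (x / A) `^ s.
  move=> x0; have xA0 : 0 <= x / A by rewrite divr_ge0// ltW.
  by rewrite -(powRM _ (ltW A0) xA0) mulrC divfK// gt_eqF.
rewrite (AE _ arho) (AE a (ltW a0)) -mulrBr normrM ger0_norm ?powR_ge0//.
apply: (@le_trans _ _ (A `^ s * ((C1 + C2) * (r / A)))).
  rewrite ler_wpM2l ?powR_ge0//; apply: H => //.
  - exact: divr_gt0.
  - by rewrite divr_ge0// ltW.
  - by rewrite divr_ge0// ltW.
  - by rewrite /A; field; rewrite gt_eqF.
rewrite -/A (_ : A `^ s = A `^ (s - 1) * A).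
  by rewrite le_eqVlt; apply/orP; left; apply/eqP; field; rewrite !gt_eqF.
by rewrite -{3}(powRr1 (ltW A0)) -powRD ?subrK// gt_eqF ?implybT.
Qed.

End calculus.

(** * Spacings of the log-quantile under the two representations *)

Section spacings.
Context {R : realType}.

Lemma ln1D_bound (x : R) : `|x| <= 2^-1 -> `|ln (1 + x)| <= 2 * `|x|.
Proof.
move=> x2; have := x2; rewrite ler_norml => /andP[xl xu].
have := ler_norm x; have := ler_norm (- x); rewrite normrN => h1 h2.
have x1 : 0 < 1 + x by lra.
rewrite ler_norml; apply/andP; split; last first.
  by apply: le_trans (le_ln1Dx _) _; lra.
rewrite lerNl -lnV ?posrE// (_ : (1 + x)^-1 = 1 + (- x / (1 + x))); last first.
  by field; rewrite gt_eqF.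
have H : - x / (1 + x) <= 2 * `|x| by rewrite ler_pdivrMr//; have := normr_ge0 x; nra.
apply: le_trans H; apply: le_ln1Dx; rewrite ltr_pdivlMr//; lra.
Qed.

Lemma expR_increment (x : R) : `|x| <= 2^-1 -> `|expR x - 1| <= 2 * `|x|.
Proof.
rewrite ler_norml => /andP[xl xu].
have := ler_norm x; have := ler_norm (- x); rewrite normrN => h1 h2.
have := expR_ge1Dx x; have := expR_ge1Dx (- x); rewrite expRN => h3 h4.
have e0 := expR_gt0 x.
rewrite ler_norml; apply/andP; split; first by have := normr_ge0 x; lra.
have h5 : expR x * (1 - x) <= 1.
  by rewrite mulrC -ler_pdivlMr// mul1r; lra.
have [x0|x0] := leP 0 x; last first.
  have : expR x <= 1 by rewrite -expR0 ler_expR ltW.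
  have := normr_ge0 x; lra.
rewrite ger0_norm// in h1 h2 *; nra.
Qed.

Let scale_sub (x l A : R) : A != 0 -> A * (x / A - l) = x - A * l.
Proof. by move=> A0; rewrite mulrBr mulrCA divff// mulr1. Qed.

Section regular_variation.
Variables (p b : R -> R) (U pn bn : R).
Hypotheses (U1 : U < 1) (ib : log_integrable b).
Hypothesis pP : forall t, 0 < t -> t <= U -> `|p t| <= pn.
Hypothesis bP : forall t, 0 < t -> t <= U -> `|b t| <= bn.
Hypothesis pn2 : pn <= 2^-1.

Lemma log_increment u v : 0 < u -> u <= v -> v <= U ->
  `|(ln (1 + p u) + logint b u) - (ln (1 + p v) + logint b v)| <=
  4 * pn + bn * (ln v - ln u).
Proof.
move=> u0 uv vU.
have lnp t : 0 < t -> t <= U -> `|ln (1 + p t)| <= 2 * pn.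
  move=> t0 tU; apply: le_trans (ln1D_bound _) _; first exact: le_trans (pP t0 tU) pn2.
  by rewrite ler_pM2l// pP.
have := lnp _ u0 (le_trans uv vU); have := lnp _ (lt_le_trans u0 uv) vU.
have := @logint_increment R b u v 0 bn ib u0 uv (le_lt_trans vU U1).
rewrite mul0r subr0 => H; have {H} : `|logint b u - logint b v| <= bn * (ln v - ln u).
  apply: H => t /andP[ut tv]; rewrite subr0; apply: bP; first exact: lt_trans ut.
  exact: le_trans vU.
by rewrite !ler_norml => /andP[h1 h2] /andP[h3 h4] /andP[h5 h6]; apply/andP; split; lra.
Qed.

(** The logarithm of the quotient is the quantity bounded by [log_increment]; the smallness
    condition keeps it below 1/2, where the exponential is linear up to a factor 2. *)
Lemma dehaan_ratio c W u v : 0 < c -> (forall t, 0 < t -> t <= U -> 0 < 1 + p t) ->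
  0 <= bn -> 4 * pn + bn * W <= 2^-1 ->
  0 < u -> u <= U -> 0 < v -> v <= U -> `|ln u - ln v| <= W ->
  `|dehaan_a p b c u / dehaan_a p b c v - 1| <= 2 * (4 * pn + bn * `|ln u - ln v|).
Proof.
move=> c0 p1 bn0 small u0 uU v0 vU uvW.
have H : `|(ln (1 + p u) + logint b u) - (ln (1 + p v) + logint b v)| <=
    4 * pn + bn * `|ln u - ln v|.
  have [uv|/ltW vu] := leP u v.
    have -> : `|ln u - ln v| = ln v - ln u by rewrite distrC ger0_norm ?subr_ge0 ?ler_ln.
    exact: log_increment.
  have -> : `|ln u - ln v| = ln u - ln v by rewrite ger0_norm ?subr_ge0 ?ler_ln.
  by rewrite distrC; exact: log_increment.
have -> : dehaan_a p b c u / dehaan_a p b c v =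
    expR ((ln (1 + p u) + logint b u) - (ln (1 + p v) + logint b v)).
  rewrite expRB !expRD !lnK ?posrE ?p1// /dehaan_a.
  move: (expR _) (expR _) (1 + _) (1 + _) => y x t z.
  have -> : c * z * x / (c * t * y) = (c / c) * (z * x / (t * y)) by rewrite mulf_div !mulrA.
  by rewrite divff ?gt_eqF// mul1r.
apply: le_trans (expR_increment _) _; last by rewrite ler_pM2l.
apply: le_trans H (le_trans _ small); by rewrite lerD2l ler_wpM2l.
Qed.

Section auxiliary_function.
Variables (k0 W : R) (a : R -> R).
Hypotheses (k00 : 0 < k0) (k0U : k0 <= U) (W0 : 0 <= W) (bn0 : 0 <= bn).
Hypothesis small : 4 * pn + bn * W <= 2^-1.
Hypothesis a_gt0 : forall t, 0 < t -> t <= U -> 0 < a t.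
Hypothesis ratio : forall u v, 0 < u -> u <= U -> 0 < v -> v <= U -> `|ln u - ln v| <= W ->
  `|a u / a v - 1| <= 2 * (4 * pn + bn * `|ln u - ln v|).

(** The spacing is [a v - a u] plus the integral of a(t)/t from u to v. In units of [a k0] the
    integral is [ln v - ln u] up to the relative variation of [a], and the first part is small
    relative to [a u], itself at most twice [a k0]. *)
Lemma dehaan_spacing F D u v : log_integrable a ->
  (forall t, 0 < t < 1 -> log_quantile F t = D - a t + logint a t) ->
  0 < u -> u <= v -> v <= U ->
  `|ln u - ln k0| <= W -> `|ln v - ln k0| <= W -> ln v - ln u <= W ->
  `|(log_quantile F u - log_quantile F v) / a k0 - (ln v - ln u)| <=
   4 * (4 * pn + bn * (ln v - ln u)) + 2 * (4 * pn + bn * W) * (ln v - ln u).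
Proof.
move=> ia repr u0 uv vU uk vk uvW.
have v0 : 0 < v by exact: lt_le_trans uv.
have uU : u <= U by exact: le_trans vU.
have l0 : 0 <= ln v - ln u by rewrite subr_ge0 ler_ln.
have r1 : `|a v / a u - 1| <= 2 * (4 * pn + bn * (ln v - ln u)).
  by have := ratio v0 vU u0 uU; rewrite [`|ln v - _|]ger0_norm//; apply.
have k0W t : u <= t -> t <= v -> `|ln t - ln k0| <= W.
  move=> ut tv; have t0 : 0 < t by exact: lt_le_trans ut.
  move: uk vk; rewrite !ler_norml => /andP[h1 h2] /andP[h3 h4].
  have : ln u <= ln t by rewrite ler_ln.
  have : ln t <= ln v by rewrite ler_ln.
  by move=> h5 h6; apply/andP; split; lra.
have rk t : u <= t -> t <= v -> `|a t / a k0 - 1| <= 2 * (4 * pn + bn * W).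
  move=> ut tv; have t0 : 0 < t by exact: lt_le_trans ut.
  apply: le_trans (ratio t0 (le_trans tv vU) k00 k0U (k0W t ut tv)) _.
  by rewrite ler_pM2l// lerD2l ler_wpM2l// k0W.
have ak0 := a_gt0 k00 k0U; have au := a_gt0 u0 uU.
have I := @logint_increment R a u v (a k0) (a k0 * (2 * (4 * pn + bn * W))) ia u0 uv
  (le_lt_trans vU U1).
have uk2 : `|a u / a k0| <= 2.
  have H : 0 < a u / a k0 by rewrite divr_gt0.
  have := rk u (lexx _) uv; rewrite [`|a u / _|]gtr0_norm//.
  by rewrite ler_norml => /andP[_]; move: small; lra.
move: ak0 au I r1 rk uk2; rewrite !repr ?u0 ?v0 ?(le_lt_trans uU) ?(le_lt_trans vU)//.
move: (a k0) (a u) (a v) (logint a u) (logint a v) (ln v - ln u) l0.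
move=> A au av Iu Iv l l0 A0 au0 I r1 rk uk2.
have {}I : `|(Iu - Iv) / A - l| <= 2 * (4 * pn + bn * W) * l.
  rewrite -(ler_pM2l A0) -{1}(gtr0_norm A0) -normrM.
  rewrite scale_sub ?gt_eqF// [leRHS]mulrA; apply: I => t /andP[/ltW ut tv].
  have := rk t ut tv; rewrite -(ler_pM2l A0) -{1}(gtr0_norm A0) -normrM.
  by rewrite scale_sub ?gt_eqF// mulr1.
have J : `|(av - au) / A| <= 2 * (2 * (4 * pn + bn * l)).
  rewrite (_ : (av - au) / A = (au / A) * (av / au - 1)); last first.
    by rewrite mulrBr mulr1 mulrBl; congr (_ - _); rewrite [RHS]mulrC mulrA divfK ?gt_eqF.
  by rewrite normrM ler_pM.
rewrite (_ : _ / _ - _ = (av - au) / A + ((Iu - Iv) / A - l)); last by ring.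
apply: le_trans (ler_normD _ _) _; apply: lerD => //.
by apply: le_trans J _; rewrite mulrA; have -> : 2 * 2 = 4 :> R by lra.
Qed.

End auxiliary_function.

Lemma karamata_spacing F gamma c u v :
  (forall t, 0 < t < 1 -> 0 < 1 + p t /\
    log_quantile F t = ln c + ln (1 + p t) - gamma * ln t + logint b t) ->
  0 < u -> u <= v -> v <= U ->
  `|(log_quantile F u - log_quantile F v) - gamma * (ln v - ln u)| <=
  4 * pn + bn * (ln v - ln u).
Proof.
move=> repr u0 uv vU; have := log_increment u0 uv vU.
have v0 : 0 < v by exact: lt_le_trans uv.
have v1 : v < 1 by exact: le_lt_trans U1.
have [|_ ->] := repr u; first by rewrite u0 (le_lt_trans uv).
have [|_ ->] := repr v; first by rewrite v0.
by congr (`|_| <= _); ring.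
Qed.

End regular_variation.
End spacings.

(** * Deterministic bounds: the statistic and harmonic sums *)

Section paths.
Context {R : realType}.
Implicit Types (e f : nat -> R) (k n : nat).

(** One realization at a time, and for both cases: [g = gamma], [a0 = 1], [qn] = b_n under Karamata;
    [g = 1], [a0] = a(k/n), [qn] = m_n under de Haan. The constant depends on [s] and [K] only. *)
Lemma T_quantile_close (s K : R) : 0 < s -> 1 <= K -> exists2 C : R, 0 <= C &
  forall (g a0 pn qn : R) (q : R -> R) f e k n, 0 < g -> 0 < a0 -> 0 <= pn -> 0 <= qn ->
  (forall j, (0 < j)%N -> 0 <= f j) -> (forall j, (0 < j <= k)%N -> 0 < e j) ->
  let V j := \sum_(j <= m < n.+1) e m / m%:R in
  (forall j, (0 < j <= k)%N -> 0 <= q (V j) - q (V j.+1) /\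
     `|(q (V j) - q (V j.+1)) / a0 - g * (e j / j%:R)| <= K * (pn + e j / j%:R * qn)) ->
  `|T_quantile q f s k n e / a0 `^ s - g `^ s * a_coef f s k -
    \sum_(1 <= j < k.+1) g `^ s * (f j * j%:R `^ (- s)) * centered_pow s (e j)| <=
  C * remainder_sum f s k g pn qn e.
Proof.
move=> s0 K1; have [C C0 HC] := powR_perturbation s0 K1; exists C => // g a0 pn qn q f e k n.
move=> g0 a00 pn0 qn0 f0 e0 V HV.
rewrite /T_quantile -/V /a_coef /remainder_sum mulr_suml !mulr_sumr -!sumrB.
rewrite (eq_big_nat _ _ (F2 := fun j => f j *
  (((q (V j) - q (V j.+1)) / a0) `^ s - (g * (e j / j%:R)) `^ s))); last first.
  move=> j /andP[j1]; rewrite ltnS => jk.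
  have [|d0 _] := HV j; first by rewrite j1.
  have ej : 0 < e j by apply: e0; rewrite j1.
  have j0 : 0 < j%:R^-1 :> R by rewrite invr_gt0 ltr0n.
  have a0s : 0 <= a0^-1 by rewrite invr_ge0 ltW.
  rewrite (powRM _ d0 a0s) (powRM _ (ltW g0)); last by rewrite mulr_ge0// ltW.
  rewrite (powRM _ (ltW ej) (ltW j0)).
  have -> : a0^-1 `^ s = (a0 `^ s)^-1 by rewrite -powR_inv1 ?ltW// -powRrM mulN1r powRN.
  have -> : (j%:R^-1 : R) `^ s = j%:R `^ (- s) by rewrite -powR_inv1// -powRrM mulN1r.
  by rewrite /centered_pow; move: (_ `^ _) => X; ring.
apply: le_trans (ler_norm_sum _ _ _) _; apply: ler_sum_nat => j /andP[j1].
rewrite ltnS => jk.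
have [|d0 dK] := HV j; first by rewrite j1.
have ej : 0 < e j by apply: e0; rewrite j1.
have j0 : 0 < j%:R :> R by rewrite ltr0n.
have ejj : 0 < e j / j%:R by rewrite divr_gt0.
rewrite normrM ger0_norm ?f0//.
set a := g * (e j / j%:R); set rho := (q (V j) - q (V j.+1)) / a0 - a.
set r := pn + e j / j%:R * qn.
have aR : (q (V j) - q (V j.+1)) / a0 = a + rho by rewrite /rho subrKC.
rewrite aR.
have H := HC a r rho.
apply: (@le_trans _ _ (f j * (C * (s * (a + r) `^ (s - 1) * r)))).
  rewrite ler_wpM2l ?f0//; apply: H => //.
  - exact: mulr_gt0.
  - by rewrite addr_ge0// mulr_ge0// ltW.
  - by rewrite -aR divr_ge0// ltW.
have -> : g / j%:R * e j + r = a + r by rewrite /a; congr (_ + _); ring.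
by move: (_ `^ _) => X; rewrite le_eqVlt; apply/orP; left; apply/eqP; ring.
Qed.

(** Telescoping 1/m >= ln (m+1) - ln m gives ln ((n+1)/(k+1)); the term 1/k pays for replacing k + 1
    by k. *)
Lemma harmonic_lower k n : (0 < k)%N -> (k <= n)%N ->
  ln (n%:R / k%:R) - k%:R^-1 <= \sum_(k.+1 <= m < n.+1) m%:R^-1 :> R.
Proof.
move=> k0 kn; have n0 : (0 < n)%N by exact: leq_trans kn.
have step m : (0 < m)%N -> ln (m.+1%:R : R) - ln m%:R <= m%:R^-1.
  move=> m0; have m0' : 0 < m%:R :> R by rewrite ltr0n.
  rewrite -ln_div ?posrE ?ltr0n// (_ : m.+1%:R / m%:R = 1 + m%:R^-1); last first.
    by rewrite -natr1 mulrDl mul1r divff ?gt_eqF// addrC.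
  by apply: le_ln1Dx; apply: lt_trans (_ : 0 < _); rewrite ?invr_gt0// ltrN10.
have H : \sum_(k.+1 <= m < n.+1) (ln (m.+1%:R : R) - ln m%:R) <=
    \sum_(k.+1 <= m < n.+1) (m%:R^-1 : R).
  by apply: ler_sum_nat => m /andP[km _]; apply: step; exact: leq_trans km.
apply: le_trans H; rewrite telescope_sumr//.
have h1 : ln (n%:R : R) <= ln n.+1%:R by rewrite ler_ln ?posrE ?ltr0n// ler_nat.
have h2 := step k k0.
by rewrite ln_div ?posrE ?ltr0n//; lra.
Qed.

Lemma harmonic_upper n : (0 < n)%N ->
  \sum_(1 <= m < n.+1) m%:R^-1 <= ln n%:R + 1 :> R.
Proof.
elim: n => // -[_ _|n IH _]; first by rewrite big_nat1 invr1 ln1 add0r.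
rewrite big_nat_recr//=; have {}IH := IH isT.
have n0 : 0 < n.+2%:R :> R by rewrite ltr0n.
have : ln (1 + - (n.+2%:R^-1 : R)) <= - n.+2%:R^-1.
  by apply: le_ln1Dx; rewrite ltrN2 invf_lt1// ltr1n.
have -> : 1 + - (n.+2%:R^-1 : R) = n.+1%:R / n.+2%:R.
  move: n0; rewrite -(natr1 n.+1); move: (n.+1%:R : R) => x x0.
  by field; rewrite gt_eqF.
rewrite ln_div ?posrE ?ltr0n// => H.
apply: le_trans (lerD IH (lexx _)) _; move: H.
by move: (ln _) (ln _) (_^-1) => x y z; lra.
Qed.

(** Up to the factor [v_coef 1] this is the variance of V_(k+1); the bound telescopes 1/m^2 <=
    1/(m-1) - 1/m. *)
Lemma inv_square_tail k n : (0 < k)%N -> (k <= n)%N ->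
  \sum_(k.+1 <= m < n.+1) (m%:R^-1) ^+ 2 <= k%:R^-1 :> R.
Proof.
move=> k0 kn.
have step m : (0 < m)%N -> ((m.+1%:R : R)^-1) ^+ 2 <= m%:R^-1 - m.+1%:R^-1.
  move=> m0; have m0' : 0 < m%:R :> R by rewrite ltr0n.
  have m1 : 0 < m.+1%:R :> R by rewrite ltr0n.
  have -> : (m%:R : R)^-1 - m.+1%:R^-1 = m%:R^-1 * m.+1%:R^-1.
    by rewrite -natr1; field; rewrite natr1 !gt_eqF.
  by rewrite expr2 ler_pM2r ?invr_gt0// lef_pV2 ?posrE// ler_nat.
have H : \sum_(k.+1 <= m < n.+1) ((m%:R : R)^-1) ^+ 2 <=
    \sum_(k.+1 <= m < n.+1) (m.-1%:R^-1 - m%:R^-1 : R).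
  apply: ler_sum_nat => -[//|m] /andP[km _]; apply: step; exact: leq_trans k0 km.
apply: le_trans H _.
rewrite big_add1 /=.
have -> : \sum_(k <= m < n) ((m%:R : R)^-1 - m.+1%:R^-1) =
    - (\sum_(k <= m < n) ((m.+1%:R : R)^-1 - m%:R^-1)).
  by rewrite -sumrN; apply: eq_bigr => m _; rewrite opprB.
by rewrite telescope_sumr// opprB gerBl invr_ge0.
Qed.

End paths.

(** * Behaviour of p_n(lambda) and b_n(lambda) for large n *)

Section tail_sup.
Context {R : realType}.
Variables (k : nat -> nat) (g : R -> R) (lambda : R).
Hypothesis hk : forall n : nat, (1 < n)%N -> (1 <= k n < n)%N.
Hypothesis hkn : (k n)%:R / n%:R @[n --> \oo] --> (0 : R).
Hypotheses (g0 : g u @[u --> 0^'+] --> 0) (l0 : 0 < lambda).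

Lemma threshold_small (eps : R) : 0 < eps ->
  \forall n \near \oo, 0 < lambda * (k n)%:R / n%:R <= eps.
Proof.
move=> e0; have el : 0 < eps / lambda by rewrite divr_gt0.
near=> n.
have n1 : (1 < n)%N by near: n; exact: nbhs_infty_gt.
have /andP[k0 kn] := hk n1.
rewrite -mulrA !mulr_gt0 ?invr_gt0 ?ltr0n//; last by exact: ltn_trans n1.
rewrite mulrC -ler_pdivlMr//; near: n.
move/cvgrPdist_le : hkn => /(_ _ el); apply: filterS => n.
by rewrite sub0r normrN; apply: le_trans (ler_norm _).
Unshelve. all: by end_near. Qed.

(** [sup] dominates the values only if these are bounded; this holds once the interval lies in a
    neighbourhood of 0 where the absolute value of [g] is at most [eps]. *)
Lemma tail_sup_small (eps : R) : 0 < eps -> \forall n \near \oo,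
  [/\ 0 <= tail_sup g lambda (k n) n, tail_sup g lambda (k n) n <= eps &
   forall t, 0 < t -> t <= lambda * (k n)%:R / n%:R -> `|g t| <= tail_sup g lambda (k n) n].
Proof.
move=> e0; move/cvgrPdist_le : g0 => /(_ _ e0) [dl /= dl0 Hd].
have d20 : 0 < dl / 2 by rewrite divr_gt0.
have := threshold_small d20; apply: filterS => n /andP[U0 Ud].
have B t : 0 < t -> t <= lambda * (k n)%:R / n%:R -> `|g t| <= eps.
  move=> t0 tU; have := Hd t _ t0; rewrite sub0r normrN; apply.
  by rewrite /= sub0r normrN gtr0_norm//; have : 0 < dl by []; lra.
have ubS : ubound [set `|g t| | t in `]0, lambda * (k n)%:R / n%:R]%classic] eps.
  by move=> _ [t /= + <-]; rewrite in_itv/= => /andP[t0 tU]; exact: B.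
have leS t : 0 < t -> t <= lambda * (k n)%:R / n%:R -> `|g t| <= tail_sup g lambda (k n) n.
  move=> t0 tU; apply: ub_le_sup; first by exists eps.
  by exists t => //=; rewrite in_itv/= t0.
split => //; first exact: le_trans (leS _ U0 (lexx _)).
apply: ge_sup => //; exists (`|g (lambda * (k n)%:R / n%:R)|).
by exists (lambda * (k n)%:R / n%:R) => //=; rewrite in_itv/= U0 lexx.
Qed.

End tail_sup.

(** * Domination in probability and exceptional events *)

Section events.
Context {R : realType} {d : measure_display} {T : measurableType d}
  (Q : probability T R).

(** The constant may depend on the tolerated probability [eta], since both are fixed before [n]. In
    the de Haan case it does, through the bound [M] on the deviation of V_1. *)
Lemma cvg_in_probability_dominated (Y Z : nat -> T -> R) :
  (forall n, measurable_fun setT (Y n)) -> (forall n, measurable_fun setT (Z n)) ->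
  cvg_in_probability Q Z 0 ->
  (forall eta : R, 0 < eta -> exists2 C : R, 0 < C & exists bad : nat -> set T,
     \forall n \near \oo, [/\ measurable (bad n), (Q (bad n) <= eta%:E)%E &
       forall w, ~ bad n w -> `|Y n w| <= C * `|Z n w|]) ->
  cvg_in_probability Q Y 0.
Proof.
move=> mY mZ cZ dom eps eps0.
have mle (W : nat -> T -> R) n (r : R) : (forall n, measurable_fun setT (W n)) ->
    measurable [set w | r <= `|W n w - 0|].
  move=> mW; apply: measurable_pred_set; apply: measurable_fun_ler => //.
  by apply: measurableT_comp => //; exact: measurable_funB.
apply/cvge0P => [n|eta eta0]; first exact: measure_ge0.
have eta20 : 0 < eta / 2 by rewrite divr_gt0.
have [C C0 [bad Hbad]] := dom _ eta20.
have eC : 0 < eps / C by rewrite divr_gt0.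
have /cvge0P := cZ _ eC; move=> /(_ (fun=> measure_ge0 _ _) _ eta20) HZ.
move: Hbad HZ; apply: filterS2 => n [mb Qb Yb] QZ.
apply: (@le_trans _ _ (Q (bad n `|` [set w | eps / C <= `|Z n w - 0|]))).
  apply: le_measure; rewrite ?inE; [exact: mle|by apply: measurableU => //; exact: mle|].
  move=> w /= ew; have [bw|bw] := pselect (bad n w); [by left|right].
  rewrite /= subr0 ler_pdivrMr// mulrC; apply: le_trans (Yb w bw).
  by rewrite subr0 in ew.
apply: le_trans (measureU2 _ mb (mle Z n _ mZ)) _.
by rewrite [eta]splitr EFinD leeD.
Qed.

Variable E : nat -> {RV Q >-> R}.
Hypothesis hE : iid_std_exponential E.

(** The path estimates need positive variables; a variable of exponential law may fail this on a
    null set. *)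
Definition nonpositive n := [set w | exists2 j, (0 < j <= n)%N & E j w <= 0].

Lemma measurable_nonpositive n : measurable (nonpositive n).
Proof.
have -> : nonpositive n = \bigcup_(j in [set j | (0 < j <= n)%N]) [set w | E j w <= 0].
  by apply/seteqP; split => w [j jn Ej]; exists j.
apply: bigcup_measurable => j _; apply: measurable_pred_set.
by apply: measurable_fun_ler => //; exact: measurable_funP.
Qed.

Lemma nonpositive0 n : Q (nonpositive n) = 0%E.
Proof.
have mE j : measurable [set w | E j w <= 0].
  apply: measurable_pred_set.
  by apply: measurable_fun_ler => //; exact: measurable_funP.
have nE j : (0 < j)%N -> Q [set w | E j w <= 0] = 0%E.
  move=> j0; transitivity (expo (`]-oo, 0]%classic : set R)).
    rewrite expoE -(hE.2 j)//; congr (Q _).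
  by rewrite expo_cdf// oppr0 expR0 subrr.
apply/negligibleP; first exact: measurable_nonpositive.
elim: n => [|n IH].
  rewrite (_ : nonpositive 0 = set0); first exact: negligible_set0.
  by apply/seteqP; split => w // [j]; rewrite -ltnS => /andP[]; case: j.
have nU : Q.-negligible (nonpositive n `|` [set w | E n.+1 w <= 0]).
  by apply: negligibleU => //; apply/negligibleP => //; exact: nE.
apply: negligibleS nU.
move=> w [j /andP[j0]]; rewrite leq_eqVlt => /predU1P[->|]; first by right.
by rewrite ltnS => jn Ej; left; exists j; rewrite ?j0.
Qed.

Lemma measure_nonpositiveU n A : measurable A -> (Q (nonpositive n `|` A) <= Q A)%E.
Proof.
move=> mA; apply: le_trans (measureU2 _ (measurable_nonpositive n) mA) _.
by rewrite -[leRHS]add0e leeD2r// -(nonpositive0 n).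
Qed.

Let inv (m : nat) : R := m%:R^-1.

(** Outside [nonpositive] this compares a block of the sums of E_m / m with the same block of the
    harmonic sum. *)
Definition deviation N M r := [set w | r <= `|weighted_sum E 1 inv N M w|].

Lemma measurable_deviation N M r : measurable (deviation N M r).
Proof.
apply: measurable_pred_set; apply: measurable_fun_ler => //.
by apply: measurableT_comp => //; exact: measurable_weighted_sum.
Qed.

Lemma deviation_le N M r B : (0 < N <= M)%N -> 0 < r ->
  \sum_(N <= j < M) inv j ^+ 2 <= B ->
  (Q (deviation N M r) <= (v_coef 1 * B / r ^+ 2)%:E)%E.
Proof.
move=> NM r0 SB; apply: le_trans (weighted_sum_chebyshev hE inv ltr01 NM r0) _.
by rewrite lee_fin ler_pM2r ?invr_gt0 ?exprn_gt0// ler_pM2l// v_coef_gt0.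
Qed.

Lemma weighted_sum_inv N M w : (0 < N)%N -> (forall j, (N <= j < M)%N -> 0 < E j w) ->
  weighted_sum E 1 inv N M w = \sum_(N <= m < M) E m w / m%:R - \sum_(N <= m < M) m%:R^-1.
Proof.
move=> N0 Ej; rewrite /weighted_sum -sumrB; apply: eq_big_nat => j jNM.
by rewrite /centered_pow Gamma2 powRr1 ?ltW ?Ej// mulrBr mulr1 mulrC.
Qed.

Lemma lower_path k n r w : (0 < k < n)%N -> ~ nonpositive n w -> ~ deviation k.+1 n.+1 r w ->
  ln (n%:R / k%:R) - k%:R^-1 - r <= \sum_(k.+1 <= m < n.+1) E m w / m%:R.
Proof.
move=> /andP[k0 kn] pw; rewrite /deviation /= weighted_sum_inv//; last first.
  move=> j /andP[kj jn]; rewrite ltNge; apply/negP => Ej; apply: pw; exists j => //.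
  by rewrite (leq_trans _ kj).
move=> /negP; rewrite -ltNge ltr_norml => /andP[+ _].
have := @harmonic_lower R k n k0 (ltnW kn); lra.
Qed.

Lemma upper_path n r w : (0 < n)%N -> ~ nonpositive n w -> ~ deviation 1 n.+1 r w ->
  \sum_(1 <= m < n.+1) E m w / m%:R <= ln n%:R + 1 + r.
Proof.
move=> n0 pw; rewrite /deviation /= weighted_sum_inv//; last first.
  by move=> j jn; rewrite ltNge; apply/negP => Ej; apply: pw; exists j.
move=> /negP; rewrite -ltNge ltr_norml => /andP[_].
have := @harmonic_upper R n n0; lra.
Qed.

End events.

(** * Spacings along a path of the V_j *)

Section paths.
Context {R : realType}.
Variables (e : nat -> R) (n : nat).
Hypothesis e0 : forall j, (0 < j <= n)%N -> 0 < e j.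

Let V j := \sum_(j <= m < n.+1) e m / m%:R.

Lemma path_step j : (j <= n)%N -> V j = e j / j%:R + V j.+1.
Proof. by move=> jn; rewrite /V big_ltn. Qed.

Lemma path_le i j : (0 < i)%N -> (i <= j <= n.+1)%N -> V j <= V i.
Proof.
move=> i0 /andP[ij jn]; rewrite /V [leRHS](big_cat_nat (n := j))//= lerDr.
rewrite big_nat; apply: sumr_ge0 => m /andP[im mj].
rewrite divr_ge0// ltW// e0// (leq_trans i0 im)/= -ltnS; exact: leq_trans jn.
Qed.

Variable k : nat.
Hypothesis kn : (0 < k < n)%N.
Variable U : R.
Hypothesis VU : expR (- V k.+1) <= U.

(** With u = exp (- V_j) and v = exp (- V_(j+1)), estimates of log-quantile increments in terms of
    [ln v - ln u] become estimates in terms of [e j / j%:R]. *)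
Lemma path_points j : (0 < j <= k)%N -> [/\ 0 < e j / j%:R,
  expR (- V j) <= expR (- V j.+1), expR (- V j.+1) <= U &
  ln (expR (- V j.+1)) - ln (expR (- V j)) = e j / j%:R].
Proof.
move=> /andP[j0 jk]; have /andP[k0 kn'] := kn.
have jn : (j <= n)%N by apply: leq_trans jk (ltnW kn').
have ej : 0 < e j / j%:R by rewrite divr_gt0 ?ltr0n// e0// j0.
split => //.
- by rewrite ler_expR lerN2 [leRHS]path_step// lerDr ltW.
- by apply: le_trans VU; rewrite ler_expR lerN2 path_le// !ltnS jk ltnW.
- by rewrite !expRK opprK addrC path_step// addrK.
Qed.

Variable F : R -> R.
Hypothesis qni : forall u v, 0 < u -> u <= v -> log_quantile F v <= log_quantile F u.

Lemma karamata_path (p b : R -> R) pn bn gamma c : U < 1 -> log_integrable b ->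
  (forall t, 0 < t -> t <= U -> `|p t| <= pn) ->
  (forall t, 0 < t -> t <= U -> `|b t| <= bn) -> pn <= 2^-1 ->
  (forall t, 0 < t < 1 -> 0 < 1 + p t /\
    log_quantile F t = ln c + ln (1 + p t) - gamma * ln t + logint b t) ->
  0 <= bn -> let q t := log_quantile F (expR (- t)) in
  forall j, (0 < j <= k)%N -> 0 <= q (V j) - q (V j.+1) /\
     `|(q (V j) - q (V j.+1)) / 1 - gamma * (e j / j%:R)| <= 4 * (pn + e j / j%:R * bn).
Proof.
move=> U1 ib pP bP pn2 repr bn0 q j jk; have [ej uv vU dE] := path_points jk.
split; first by rewrite subr_ge0 qni// expR_gt0.
have := karamata_spacing U1 ib pP bP pn2 repr (expR_gt0 _) uv vU.
rewrite dE divr1 => /le_trans; apply; rewrite mulrDr lerD2l mulrC.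
have : 0 <= e j / j%:R * bn by rewrite mulr_ge0// ltW.
by move: (_ * bn) => x; lra.
Qed.

(** [W] bounds the logarithmic distances between [k0], [U] and exp (- V_1), hence those between all
    the arguments that occur. It is of order log k in the application, and the condition on [bn * W]
    is where m_n absorbs b_n log k. *)
Lemma dehaan_path (p b : R -> R) pn bn mn c D k0 W C : U < 1 -> log_integrable b ->
  (forall t, 0 < t -> t <= U -> `|p t| <= pn) ->
  (forall t, 0 < t -> t <= U -> `|b t| <= bn) -> pn <= 2^-1 ->
  0 < c -> (forall t, 0 < t -> t <= U -> 0 < 1 + p t) -> 0 <= pn -> 0 <= bn ->
  0 < k0 -> k0 <= U -> 0 <= W -> 4 * pn + bn * W <= 2^-1 ->
  log_integrable (dehaan_a p b c) ->
  (forall t, 0 < t < 1 -> log_quantile F t = D - dehaan_a p b c t + logint (dehaan_a p b c) t) ->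
  ln U - ln k0 <= W -> ln k0 + V 1 <= W -> ln U + V 1 <= W -> 0 <= C ->
  pn <= mn -> bn <= mn -> bn * W <= C * mn ->
  let q t := log_quantile F (expR (- t)) in
  forall j, (0 < j <= k)%N -> 0 <= q (V j) - q (V j.+1) /\
     `|(q (V j) - q (V j.+1)) / dehaan_a p b c k0 - 1 * (e j / j%:R)| <=
     (16 + 2 * C) * (pn + e j / j%:R * mn).
Proof.
move=> U1 ib pP bP pn2 c0 p1 pn0 bn0 k00 k0U W0 small ia repr W1 W2 W3 C0 pm bm bW q j jk.
have [ej uv vU dE] := path_points jk.
split; first by rewrite subr_ge0 qni// expR_gt0.
have /andP[j0 jk'] := jk; have /andP[_ kn'] := kn.
have jn : (j <= n)%N by apply: leq_trans jk' (ltnW kn').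
have V1 i : (0 < i <= j.+1)%N -> V i <= V 1.
  by move=> /andP[i0 ij]; apply: path_le => //; rewrite i0 (leq_trans ij).
have U0 : 0 < U by exact: lt_le_trans (expR_gt0 _) vU.
have lU t : expR t <= U -> t <= ln U by move=> tU; rewrite -(expRK t) ler_ln ?posrE ?expR_gt0.
have lv := lU _ vU; have lu := lU _ (le_trans uv vU).
have Vj := V1 j; have Vj1 := V1 j.+1; rewrite j0 leqnSn in Vj; rewrite leqnn in Vj1.
have {}Vj := Vj isT; have {}Vj1 := Vj1 isT.
have a_gt0 t : 0 < t -> t <= U -> 0 < dehaan_a p b c t.
  by move=> t0 tU; rewrite /dehaan_a !mulr_gt0 ?expR_gt0// p1.
have ratio u v := @dehaan_ratio R p b U pn bn U1 ib pP bP pn2 c W u v c0 p1 bn0 small.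
have H := dehaan_spacing U1 k00 k0U bn0 small a_gt0 ratio ia repr (expR_gt0 _) uv vU.
rewrite mul1r; rewrite dE !expRK in H; apply: le_trans (H _ _ _) _.
- by rewrite ler_norml; apply/andP; split; lra.
- by rewrite ler_norml; apply/andP; split; lra.
- by rewrite -dE !expRK; lra.
move: (e j / j%:R) ej bW bm pm pn0 C0 => x x0 bW bm pm pn0 C0.
have h1 : bn * x <= mn * x by rewrite ler_pM2r.
have h2 : pn * x <= mn * x by rewrite ler_pM2r.
have h3 : bn * W * x <= C * mn * x by rewrite ler_pM2r.
have h4 : 0 <= C * pn by rewrite mulr_ge0.
have h5 : 0 <= mn * x by rewrite mulr_ge0 ?(ltW x0)// (le_trans pn0).
have -> : 4 * (4 * pn + bn * x) + 2 * (4 * pn + bn * W) * x =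
  16 * pn + 4 * (bn * x) + 8 * (pn * x) + 2 * (bn * W * x) by ring.
have -> : (16 + 2 * C) * (pn + x * mn) =
  16 * pn + 2 * (C * pn) + 16 * (mn * x) + 2 * (C * mn * x) by ring.
lra.
Qed.

End paths.

(** * The statistic is close in probability to a weighted sum *)

Section approximation.
Context {R : realType} {d : measure_display} {T : measurableType d}
  (Q : probability T R).
Variable E : nat -> {RV Q >-> R}.
Hypothesis hE : iid_std_exponential E.
Variables (F : R -> R) (f : nat -> R) (s : R) (k : nat -> nat).
Hypothesis qni : forall u v, 0 < u -> u <= v -> log_quantile F v <= log_quantile F u.
Hypothesis f0 : forall j, (0 < j)%N -> 0 <= f j.
Hypothesis s0 : 0 < s.
Hypothesis hk : forall n : nat, (1 < n)%N -> (1 <= k n < n)%N.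
Hypothesis hkoo : k n @[n --> \oo] --> \oo.
Hypothesis hkn : (k n)%:R / n%:R @[n --> \oo] --> (0 : R).

Let q t := log_quantile F (expR (- t)).

Lemma measurable_T_quantile K n :
  measurable_fun setT (fun w => T_quantile q f s K n (fun i => E i w)).
Proof.
have mq : measurable_fun setT q.
  apply: nondecreasing_measurable => // x y xy; apply: qni; first exact: expR_gt0.
  by rewrite ler_expR lerN2.
have mV j : measurable_fun setT (fun w => \sum_(j <= m < n.+1) E m w / m%:R).
  by apply: measurable_sum => m; apply: measurable_funM => //; exact: measurable_funP.
apply: measurable_sum => j; apply: measurable_funM => //.
apply: (@measurableT_comp _ _ _ _ _ _ (fun x : R => x `^ s)) => //.
by apply: measurable_funB; apply: (measurableT_comp mq); exact: mV.
Qed.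

Lemma measurable_remainder K (g : R) pn qn :
  measurable_fun setT (fun w => remainder_sum f s K g pn qn (fun i => E i w)).
Proof.
apply: measurable_sum => j.
have mr : measurable_fun setT (fun w => pn + E j w / j%:R * qn).
  by apply: measurable_funD => //; apply: measurable_funM => //; exact: measurable_funM.
apply: measurable_funM => //; apply: measurable_funM => //.
apply: (@measurableT_comp _ _ _ _ _ _ (fun x : R => x `^ (s - 1))) => //; apply: measurable_funD => //.
exact: measurable_funM.
Qed.

Definition statistic_error (g : R) (a : nat -> R) n w : R :=
  T_quantile q f s (k n) n (fun i => E i w) / a n `^ s - g `^ s * a_coef f s (k n) -
  weighted_sum E s (fun j => g `^ s * (f j * j%:R `^ (- s))) 1 (k n).+1 w.

Lemma measurable_statistic_error g a n : measurable_fun setT (statistic_error g a n).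
Proof.
apply: measurable_funB; last exact: measurable_weighted_sum.
apply: measurable_funB => //; apply: measurable_funM => //; exact: measurable_T_quantile.
Qed.

Lemma near_k_ge (A : R) : \forall n \near \oo, A <= (k n)%:R.
Proof.
have [N NA] : exists N : nat, A <= N%:R.
  exists (Num.bound `|A|); apply: le_trans (ler_norm A) _.
  by apply: ltW; exact: archi_boundP.
move/cvgnyPge : hkoo => /(_ N); apply: filterS => n Nk.
by apply: le_trans NA _; rewrite ler_nat.
Qed.

Lemma deviation_small (r eta : R) : 0 < r -> 0 < eta ->
  \forall n \near \oo, (Q (deviation E (k n).+1 n.+1 r) <= eta%:E)%E.
Proof.
move=> r0 eta0; near=> n.
have n1 : (1 < n)%N by near: n; exact: nbhs_infty_gt.
have /andP[k0 kn] := hk n1.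
have NM : (0 < (k n).+1 <= n.+1)%N by rewrite /= ltnS ltnW.
apply: le_trans (deviation_le hE NM r0 (@inv_square_tail R _ _ k0 (ltnW kn))) _.
have k0' : 0 < (k n)%:R :> R by rewrite ltr0n.
rewrite lee_fin ler_pdivrMr ?exprn_gt0// ler_pdivrMr// mulrC -ler_pdivrMr; last first.
  by rewrite mulr_gt0// exprn_gt0.
near: n; exact: near_k_ge.
Unshelve. all: by end_near. Qed.

Section case_positive.
Variables (gamma : R) (p b : R -> R) (c : R).
Hypotheses (g0 : 0 < gamma) (kr : karamata_representation F gamma p b c).
Let pn n := tail_sup p 2 (k n) n.
Let bn n := tail_sup b 2 (k n) n.
Hypothesis rem : cvg_in_probability Q
  (fun n w => remainder_sum f s (k n) gamma (pn n) (bn n) (fun j => E j w)) 0.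

Lemma karamata_statistic_error : cvg_in_probability Q (statistic_error gamma (fun=> 1)) 0.
Proof.
have [[c0 p0 b0 ib] repr] := kr.
apply: (cvg_in_probability_dominated _ _ rem) => [n|n|eta eta0].
- exact: measurable_statistic_error.
- exact: measurable_remainder.
have [C C0 HC] := T_quantile_close s0 (ler1n R 4).
exists (C + 1); first by rewrite ltr_wpDl.
(* Here lambda = 2. Since exp (- V_(k+1)) is at most (k/n) exp (1/k + r), half of [ln 2] is allotted
   to 1/k and half to the deviation r. *)
have l2 : 0 < ln 2 / 2 :> R by rewrite divr_gt0// ln_gt0// ltr1n.
exists (fun n => nonpositive E n `|` deviation E (k n).+1 n.+1 (ln 2 / 2)).
near=> n.
have n1 : (1 < n)%N by near: n; exact: nbhs_infty_gt.
have kn := hk n1; have /andP[k0 kn'] := kn.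
have kR : 0 < (k n)%:R :> R by rewrite ltr0n.
have nR : 0 < n%:R :> R by rewrite ltr0n (ltn_trans _ n1).
split.
- by apply: measurableU; [exact: measurable_nonpositive|exact: measurable_deviation].
- apply: le_trans (measure_nonpositiveU hE n (measurable_deviation E _ _ _)) _.
  by near: n; exact: deviation_small.
move=> w /not_orP[pw dw].
have e0 j : (0 < j <= n)%N -> 0 < E j w.
  by move=> jn; rewrite ltNge; apply/negP => Ej; apply: pw; exists j.
have /andP[U0 U1] : 0 < (2 : R) * (k n)%:R / n%:R <= 2^-1.
  by near: n; exact: threshold_small.
have [pn0 pn2 pP] : [/\ 0 <= pn n, pn n <= 2^-1 &
    forall t, 0 < t -> t <= 2 * (k n)%:R / n%:R -> `|p t| <= pn n].
  by near: n; exact: tail_sup_small.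
have [bn0 bn2 bP] : [/\ 0 <= bn n, bn n <= 1 &
    forall t, 0 < t -> t <= 2 * (k n)%:R / n%:R -> `|b t| <= bn n].
  by near: n; exact: tail_sup_small.
have U1' : 2 * (k n)%:R / n%:R < 1 :> R by apply: le_lt_trans U1 _; lra.
have kl : (ln 2 / 2)^-1 <= (k n)%:R :> R by near: n; exact: near_k_ge.
have VU : expR (- \sum_((k n).+1 <= m < n.+1) E m w / m%:R) <= 2 * (k n)%:R / n%:R.
  have := lower_path kn pw dw.
  rewrite -[X in _ -> _ <= X]lnK ?posrE// ler_expR -mulrA ln_div ?posrE// lnM ?posrE ?divr_gt0//.
  rewrite ln_div ?posrE//.
  have : (k n)%:R^-1 <= ln 2 / 2 :> R by rewrite invf_ple ?posrE.
  by lra.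
have HV := karamata_path e0 kn VU qni U1' ib pP bP pn2 repr bn0.
have := HC gamma 1 (pn n) (bn n) q f (fun j => E j w) (k n) n g0 ltr01 pn0 bn0 f0 _ HV.
rewrite /statistic_error /weighted_sum => H.
apply: (@le_trans _ _ (C * remainder_sum f s (k n) gamma (pn n) (bn n) (fun j => E j w))).
  by apply: H => j /andP[j0 jk]; apply: e0; rewrite j0 (leq_trans jk)// ltnW.
apply: le_trans (ler_wpM2l C0 (ler_norm _)) _.
by rewrite ler_wpM2r// lerDl.
Unshelve. all: by end_near. Qed.

End case_positive.

Section case_zero.
Variables (p b : R -> R) (c D lambda : R).
Hypotheses (l1 : 1 < lambda) (dr : dehaan_representation F p b c D).
Let pn n := tail_sup p lambda (k n) n.
Let bn n := tail_sup b lambda (k n) n.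
Let mn n := Num.max (pn n) (bn n * ln (k n)%:R).
Hypothesis hb : bn n * ln (k n)%:R @[n --> \oo] --> (0 : R).
Hypothesis rem : cvg_in_probability Q
  (fun n w => remainder_sum f s (k n) 1 (pn n) (mn n) (fun j => E j w)) 0.

(** The series of 1/m^2 converges, so V_1 stays within O(1) of the harmonic sum, in probability and
    uniformly in [n]. *)
Lemma deviation_bounded (eta : R) : 0 < eta ->
  exists2 M, 0 < M & forall n, (0 < n)%N -> (Q (deviation E 1 n.+1 M) <= eta%:E)%E.
Proof.
move=> eta0; have v0 := @v_coef_gt0 R 1 ltr01.
have x0 : 0 <= v_coef 1 * 2 / eta by rewrite divr_ge0 ?mulr_ge0// ltW.
(* Chebyshev's inequality asks for [x <= M ^+ 2] with [x = v_coef 1 * 2 / eta]; taking [M = x + 1]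
   avoids a square root. *)
exists (v_coef 1 * 2 / eta + 1) => [|n n0]; first by rewrite ltr_wpDl.
have S : \sum_(1 <= j < n.+1) (j%:R^-1 : R) ^+ 2 <= 2.
  rewrite big_ltn// invr1 expr1n.
  have := @inv_square_tail R 1 n isT n0; rewrite invr1; move: (\sum_(_ <= _ < _) _) => x.
  by lra.
have NM : (0 < 1 <= n.+1)%N by [].
apply: le_trans (deviation_le hE NM _ S) _; first by rewrite ltr_wpDl.
rewrite lee_fin ler_pdivrMr ?exprn_gt0 ?ltr_wpDl// [leRHS]mulrC -ler_pdivrMr//.
move: x0; move: (_ / eta) => x x0; rewrite sqrrD expr1n; have := sqr_ge0 x; lra.
Qed.

Lemma dehaan_statistic_error : cvg_in_probability Q
  (statistic_error 1 (fun n => dehaan_a p b c ((k n)%:R / n%:R))) 0.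
Proof.
have [[c0 p0 b0 ib ia] repr] := dr.
have l0 : 0 < lambda by exact: lt_trans l1.
apply: (cvg_in_probability_dominated _ _ rem) => [n|n|eta eta0].
- exact: measurable_statistic_error.
- exact: measurable_remainder.
have eta20 : 0 < eta / 2 by rewrite divr_gt0.
(* [M] bounds the smallest argument of the quantile function below by
   [expR (- 1 - M) / n]; this range of length log k makes b_n log k appear. *)
have [M M0 HM] := deviation_bounded eta20.
have lnl : 0 < ln lambda by rewrite ln_gt0.
(* [W] below is log k + (ln lambda + 1 + M), which is at most CW log k as soon as log k >= 1. *)
pose CW := 1 + (ln lambda + 1 + M); have CW0 : 0 < CW by rewrite /CW; lra.
have K1 : 1 <= 16 + 2 * CW by lra.
have [C C0 HC] := T_quantile_close s0 K1.
exists (C + 1); first by rewrite ltr_wpDl.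
(* This bound on b_n log k makes b_n W at most 1/4, and p_n <= 1/16 makes 4 p_n at most 1/4;
   together they give the smallness condition. *)
have e4 : 0 < (4 * CW)^-1 by rewrite invr_gt0 mulr_gt0.
have l2 : 0 < ln lambda / 2 by rewrite divr_gt0.
exists (fun n => nonpositive E n `|`
  (deviation E (k n).+1 n.+1 (ln lambda / 2) `|` deviation E 1 n.+1 M)).
near=> n.
have n1 : (1 < n)%N by near: n; exact: nbhs_infty_gt.
have kn := hk n1; have /andP[k0 kn'] := kn.
have n0 : (0 < n)%N by exact: ltn_trans n1.
have kR : 0 < (k n)%:R :> R by rewrite ltr0n.
have nR : 0 < n%:R :> R by rewrite ltr0n.
have mD N K r := measurable_deviation E N K r.
split.
- by apply: measurableU; [exact: measurable_nonpositive|exact: measurableU].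
- apply: le_trans (measure_nonpositiveU hE n _) _; first exact: measurableU.
  apply: le_trans (measureU2 _ _ _) _ => //.
  rewrite [eta]splitr EFinD leeD//; last exact: HM.
  by near: n; exact: deviation_small.
move=> w /not_orP[pw /not_orP[dw uw]].
have e0 j : (0 < j <= n)%N -> 0 < E j w.
  by move=> jn; rewrite ltNge; apply/negP => Ej; apply: pw; exists j.
have /andP[U0 U1] : 0 < lambda * (k n)%:R / n%:R <= 2^-1.
  by near: n; exact: threshold_small.
have p160 : 0 < 16^-1 :> R by rewrite invr_gt0.
have [pn0 pn2 pP] : [/\ 0 <= pn n, pn n <= 16^-1 &
    forall t, 0 < t -> t <= lambda * (k n)%:R / n%:R -> `|p t| <= pn n].
  by near: n; exact: tail_sup_small.
have [bn0 bn2 bP] : [/\ 0 <= bn n, bn n <= 1 &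
    forall t, 0 < t -> t <= lambda * (k n)%:R / n%:R -> `|b t| <= bn n].
  by near: n; exact: tail_sup_small.
have U1' : lambda * (k n)%:R / n%:R < 1 by apply: le_lt_trans U1 _; lra.
have kl : (ln lambda / 2)^-1 <= (k n)%:R by near: n; exact: near_k_ge.
have lnk : 1 <= ln (k n)%:R :> R.
  rewrite -[leLHS]expRK ler_ln ?posrE ?expR_gt0//; near: n; exact: near_k_ge.
have bk : bn n * ln (k n)%:R <= (4 * CW)^-1.
  near: n; move/cvgrPdist_le : hb => /(_ _ e4); apply: filterS => n.
  by rewrite sub0r normrN; apply: le_trans (ler_norm _).
have VU : expR (- \sum_((k n).+1 <= m < n.+1) E m w / m%:R) <= lambda * (k n)%:R / n%:R.
  have := lower_path kn pw dw.
  rewrite -[X in _ -> _ <= X]lnK ?posrE// ler_expR -mulrA ln_div ?posrE// lnM ?posrE ?divr_gt0//.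
  rewrite ln_div ?posrE//.
  have : (k n)%:R^-1 <= ln lambda / 2 by rewrite invf_ple ?posrE.
  by lra.
have V1 := upper_path n0 pw uw.
have pn2' : pn n <= 2^-1 by lra.
have p1 t : 0 < t -> t <= lambda * (k n)%:R / n%:R -> 0 < 1 + p t.
  by move=> t0 tU; have := pP t t0 tU; rewrite ler_norml => /andP[]; lra.
have k00 : 0 < (k n)%:R / n%:R :> R by rewrite divr_gt0.
have k0U : (k n)%:R / n%:R <= lambda * (k n)%:R / n%:R.
  by rewrite -mulrA -[leLHS]mul1r ler_wpM2r// ltW.
pose W := ln (k n)%:R + (ln lambda + 1 + M).
have W0 : 0 <= W by rewrite /W; lra.
have bW : bn n * W <= CW * (bn n * ln (k n)%:R).
  rewrite mulrCA ler_wpM2l// /W /CW mulrDl mul1r lerD2l -[leLHS]mulr1 ler_wpM2l//.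
  by lra.
have small : 4 * pn n + bn n * W <= 2^-1.
  have : CW * (bn n * ln (k n)%:R) <= 4^-1.
    apply: le_trans (ler_wpM2l (ltW CW0) bk) _.
    by rewrite invfM mulrCA divff ?gt_eqF// mulr1.
  by lra.
have bm : bn n <= mn n.
  apply: (@le_trans _ _ (bn n * ln (k n)%:R)); last by rewrite le_max lexx orbT.
  by rewrite -[leLHS]mulr1 ler_wpM2l.
have pm : pn n <= mn n by rewrite le_max lexx.
have bWm : bn n * W <= CW * mn n.
  by apply: le_trans bW _; rewrite ler_wpM2l ?(ltW CW0)// le_max lexx orbT.
have a0 : 0 < dehaan_a p b c ((k n)%:R / n%:R).
  by rewrite /dehaan_a !mulr_gt0 ?expR_gt0// p1.
have W1 : ln (lambda * (k n)%:R / n%:R) - ln ((k n)%:R / n%:R) <= W.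
  rewrite -mulrA lnM ?posrE// addrK /W; lra.
have W2 : ln ((k n)%:R / n%:R) + \sum_(1 <= m < n.+1) E m w / m%:R <= W.
  rewrite ln_div ?posrE// /W; move: V1 lnl; lra.
have W3 : ln (lambda * (k n)%:R / n%:R) + \sum_(1 <= m < n.+1) E m w / m%:R <= W.
  rewrite -mulrA lnM ?posrE// ln_div ?posrE// /W; move: V1; lra.
have HV := dehaan_path e0 kn VU qni U1' ib pP bP pn2' c0 p1 pn0 bn0 k00 k0U W0 small ia repr
  W1 W2 W3 (ltW CW0) pm bm bWm.
have := HC 1 _ (pn n) (mn n) q f (fun j => E j w) (k n) n ltr01 a0 pn0 _ f0 _ HV.
rewrite /statistic_error /weighted_sum => H.
apply: (@le_trans _ _ (C * remainder_sum f s (k n) 1 (pn n) (mn n) (fun j => E j w))).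
  apply: H; first exact: le_trans pm.
  by move=> j /andP[j0 jk]; apply: e0; rewrite j0 (leq_trans jk)// ltnW.
apply: le_trans (ler_wpM2l C0 (ler_norm _)) _.
by rewrite ler_wpM2r// lerDl.
Unshelve. all: by end_near. Qed.

End case_zero.

End approximation.

(** * The two limit laws *)

Section limits.
Context {R : realType} {d : measure_display} {T : measurableType d}
  (Q : probability T R).
Variable E : nat -> {RV Q >-> R}.
Hypothesis hE : iid_std_exponential E.
Variables (f : nat -> R) (s : R) (k : nat -> nat).
Hypothesis f0 : forall j, (0 < j)%N -> 0 <= f j.
Hypothesis s0 : 0 < s.
Hypothesis hkoo : k n @[n --> \oo] --> \oo.

Let c j := f j * j%:R `^ (- s).
Let S m := \sum_(1 <= j < m.+1) c j ^+ 2.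

Let c0 j : (0 < j)%N -> 0 <= c j.
Proof. by move=> j0; rewrite mulr_ge0 ?f0 ?powR_ge0. Qed.

Let c_sqr j : c j ^+ 2 = f j ^+ 2 * j%:R `^ (- (2 * s)).
Proof. by rewrite exprMn -(powR_mulrn 2 (powR_ge0 _ _)) -powRrM mulNr [s * _]mulrC. Qed.

Let S_nd : nondecreasing_seq S.
Proof. by apply/nondecreasing_seqP => n; rewrite [leRHS]big_nat_recr//= lerDl sqr_ge0. Qed.

Let square_seriesE : square_series f s = (\sum_(1 <= j <oo) (c j ^+ 2)%:E)%E.
Proof. by apply: eq_eseriesr => j _; rewrite c_sqr. Qed.

Let sigmaE m : sigma_coef f s m = Num.sqrt (S m).
Proof. by congr Num.sqrt; apply: eq_bigr => j _; rewrite c_sqr. Qed.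

Lemma square_series_cvg : (square_series f s < +oo)%E -> exists l : R, S @ \oo --> l.
Proof.
move=> fin; exists (limn S); apply: nondecreasing_is_cvgn => //.
have c20 n : (1 <= n)%N -> true -> (0 <= (c n ^+ 2)%:E)%E by rewrite lee_fin sqr_ge0.
have pos : (0 <= square_series f s)%E by rewrite square_seriesE; apply: nneseries_ge0.
exists (fine (square_series f s)) => _ [m _ <-].
rewrite -lee_fin fineK ?ge0_fin_numE// square_seriesE -sumEFin.
exact: nneseries_lim_ge.
Qed.

Lemma square_series_unbounded (A : R) : square_series f s = +oo%E ->
  \forall n \near \oo, A <= S (k n).
Proof.
move=> inf.
have [N AN] : exists N, A <= S N.
  apply: contrapT => /forallNP H; suff : (square_series f s <= A%:E)%E by rewrite inf.
  rewrite square_seriesE; apply: lime_le.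
    by apply: is_cvg_nneseries => n _ _; rewrite lee_fin sqr_ge0.
  apply: nearW => -[|n]; rewrite sumEFin lee_fin.
    rewrite big_geq//; have := H 0%N; rewrite /S big_geq// => /negP; rewrite -ltNge.
    exact: ltW.
  by have /negP := H n; rewrite -ltNge => /ltW.
move/cvgnyPge : hkoo => /(_ N); apply: filterS => n Nk.
exact: le_trans AN (S_nd Nk).
Qed.

Lemma weak_cvg_cst_seq (Z : T -> R) : weak_cvg Q (fun=> Z) Q Z.
Proof. by move=> x0 e _; exact: cvg_cst. Qed.

Variables (g : R) (Y : nat -> T -> R).
Hypothesis g0 : 0 < g.
Hypothesis mY : forall n, measurable_fun setT (Y n).
Hypothesis hY : cvg_in_probability Q
  (fun n w => Y n w - weighted_sum E s (fun j => g `^ s * c j) 1 (k n).+1 w) 0.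

Let v0 : 0 < v_coef s := v_coef_gt0 s0.
Let gs0 : 0 < g `^ s. Proof. exact: powR_gt0. Qed.

Let mW n : measurable_fun setT (weighted_sum E s (fun j => g `^ s * c j) 1 (k n).+1).
Proof. exact: measurable_weighted_sum. Qed.

Lemma series_limit : (square_series f s < +oo)%E -> cvg_in_distribution Q Y
  (pushforward Q (fun w => g `^ s * v_coef s `^ (2^-1) * L_series f s (fun j => E j w))).
Proof.
move=> /square_series_cvg[l Sl].
pose r := v_coef s `^ (2^-1); have r0 : 0 < r by exact: powR_gt0.
(* [centered_pow] is not normalized: the division by the square root of [v_coef s] in the terms of
   the series is moved to the weights. *)
pose c' j := c j / r.
have S'l : (fun n => \sum_(1 <= j < n.+1) c' j ^+ 2) @ \oo --> l / r ^+ 2.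
  rewrite (_ : (fun n => _) = (fun n => S n / r ^+ 2)).
    by apply: cvgM => //; exact: cvg_cst.
  by apply/funext => n; rewrite /S mulr_suml; apply: eq_bigr => j _; rewrite exprMn exprVn.
pose L w := limn (fun n => weighted_sum E s c' 1 n.+1 w).
have mL : measurable_fun setT L by exact: (measurable_weighted_series E s c').
(* The partial sums coincide, so the two [lim] agree even at realizations where the series
   diverges. *)
have LE w : L_series f s (fun j => E j w) = L w.
  rewrite /L /L_series; set u := (fun m => _).
  suff -> : u = (fun n => weighted_sum E s c' 1 n.+1 w) by [].
  apply/funext => m.
  by apply: eq_bigr => j _; rewrite /c' /c /centered_pow mulrA mulrAC.
pose Z w := g `^ s * r * L w.
have mZ : measurable_fun setT Z by exact: measurable_funM.
rewrite (_ : pushforward _ _ = (fun A => Q [set w | A (Z w)])); last first.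
  by apply/funext => A; rewrite /pushforward; congr (Q _); apply/seteqP; split => w /=; rewrite LE.
apply: (weak_cvg_in_distribution mY mZ).
apply: (weak_cvg_slutsky mY mW mZ hY).
(* Convergence in probability to [Z] enters Slutsky's lemma through a constant sequence. *)
pose Zn (n : nat) := Z.
have mZn n : measurable_fun setT (Zn n) by [].
suff H : cvg_in_probability Q
    (fun n w => weighted_sum E s (fun j => g `^ s * c j) 1 (k n).+1 w - Z w) 0.
  exact: (@weak_cvg_slutsky _ _ _ Q _ Zn _ _ Q Z mW mZn mZ H (@weak_cvg_cst_seq Z)).
have cL : cvg_in_probability Q (fun n w => weighted_sum E s c' 1 (k n).+1 w - L w) 0.
  move=> e e0; have := weighted_series_cvg_in_probability hE s0 S'l e0.
  by move=> H; apply: (cvg_comp _ _ hkoo H).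
apply: (cvg_in_probability_dominated _ _ cL) => [n|n|eta eta0].
- exact: measurable_funB.
- by apply: measurable_funB => //; exact: measurable_weighted_sum.
exists (g `^ s * r); first exact: mulr_gt0.
exists (fun=> set0); near=> n; split => //; first by rewrite measure0 lee_fin ltW.
move=> w _; rewrite -[X in _ <= X * _]gtr0_norm ?mulr_gt0// -normrM mulrBr.
rewrite le_eqVlt; apply/orP; left; apply/eqP; congr (`|_ - _|).
rewrite /weighted_sum mulr_sumr; apply: eq_bigr => j _.
by rewrite /c'; field; rewrite gt_eqF.
Unshelve. all: by end_near. Qed.

Lemma normal_limit : square_series f s = +oo%E ->
  (fun n => B_coef f s (k n)) @ \oo --> 0 ->
  cvg_in_distribution Q (fun n w => (sigma_coef f s (k n))^-1 * Y n w)
    (normal_prob 0 (Num.sqrt (g `^ (2 * s) * v_coef s))).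
Proof.
move=> inf B0; pose tau := Num.sqrt (g `^ (2 * s) * v_coef s).
have t2 : 0 < g `^ (2 * s) * v_coef s by rewrite mulr_gt0// powR_gt0.
have tau0 : 0 < tau by rewrite sqrtr_gt0.
pose sg n := sigma_coef f s (k n).
(* Since the squared weights are not summable, sigma_n tends to infinity; the lower bound 1 allows
   to invert it and keeps the error in [hY] from growing on division. *)
have sg1 : \forall n \near \oo, 1 <= sg n.
  have := square_series_unbounded 1 inf; apply: filterS => n Sn.
  by rewrite /sg sigmaE -sqrtr1 ler_wsqrtr.
pose cn n j := (sg n)^-1 * (g `^ s * c j).
have sgn n : 0 <= sg n by exact: sqrtr_ge0.
have cn0 n j : (0 < j)%N -> 0 <= cn n j.
  by move=> j0; rewrite !mulr_ge0 ?invr_ge0// ?(ltW gs0) ?f0 ?powR_ge0.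
have g2 : (g `^ s) ^+ 2 = g `^ (2 * s).
  by rewrite -(powR_mulrn 2 (ltW gs0)) -powRrM mulrC.
have sumc2 n : 1 <= sg n -> \sum_(1 <= j < (k n).+1) cn n j ^+ 2 = g `^ (2 * s).
  move=> s1; have sn0 : 0 < sg n by exact: lt_le_trans s1.
  rewrite /cn; under eq_bigr do rewrite exprMn exprMn exprVn mulrA.
  rewrite -mulr_sumr -/(S (k n)) g2.
  have -> : S (k n) = sg n ^+ 2.
    by rewrite /sg sigmaE sqr_sqrtr//; apply: sumr_ge0 => j _; exact: sqr_ge0.
  by rewrite mulrAC mulVf ?mul1r// expf_neq0// gt_eqF.
have c2 : \forall n \near \oo, v_coef s * (\sum_(1 <= j < (k n).+1) cn n j ^+ 2) = tau ^+ 2.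
  by move: sg1; apply: filterS => n s1; rewrite sumc2// sqr_sqrtr ?ltW// mulrC.
have cnB n j : (0 < j)%N -> (j < (k n).+1)%N -> cn n j <= g `^ s * B_coef f s (k n).
  move=> j0 jk; rewrite /cn mulrCA ler_pM2l// mulrC.
  rewrite /B_coef -/(sg n).
  by apply: (@le_bigmax_seq _ _ _ _ _ j xpredT); rewrite ?mem_index_iota ?j0.
(* The sum of cubes is at most the largest weight times the sum of squares: the former is bounded by
   a multiple of B_n, the latter is eventually constant. *)
have c3 : (fun n => \sum_(1 <= j < (k n).+1) cn n j ^+ 3) @ \oo --> 0.
  apply: (@squeeze_cvgr _ _ _ _ (fun=> 0) (fun n => g `^ s * B_coef f s (k n) * g `^ (2 * s))).
  - move: sg1; apply: filterS => n s1; apply/andP; split.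
      by rewrite big_nat; apply: sumr_ge0 => j /andP[j0 _]; rewrite exprn_ge0// cn0.
    rewrite -(sumc2 _ s1) mulr_sumr; apply: ler_sum_nat => j /andP[j0 jk].
    by rewrite exprS ler_wpM2r ?sqr_ge0// cnB.
  - exact: cvg_cst.
  - have -> : 0 = g `^ s * 0 * g `^ (2 * s) :> R by rewrite mulr0 mul0r.
    by apply: cvgM; [apply: cvgM => //; exact: cvg_cst|exact: cvg_cst].
have clt := weighted_sum_weak_cvg hE s0 tau0 cn0 c2 c3.
have mZ : measurable_fun setT (fun z : R => tau * z) by exact: measurable_funM.
have mS n : measurable_fun setT (fun w => (sg n)^-1 * Y n w) by exact: measurable_funM.
have mWn n : measurable_fun setT (weighted_sum E s (cn n) 1 (k n).+1).
  exact: measurable_weighted_sum.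
have H : cvg_in_distribution Q (fun n w => (sg n)^-1 * Y n w)
    (fun A => std_normal [set z | A (tau * z)]).
  apply: (weak_cvg_in_distribution mS mZ).
  apply: (weak_cvg_slutsky mS mWn mZ _ clt).
  apply: (cvg_in_probability_dominated _ _ hY) => [n|n|eta eta0].
  - exact: measurable_funB.
  - exact: measurable_funB.
  exists 1 => //; exists (fun=> set0); near=> n; split => //.
    by rewrite measure0 lee_fin ltW.
  move=> w _; have s1 : 1 <= sg n by near: n.
  have sn0 : 0 < sg n by exact: lt_le_trans s1.
  have -> : weighted_sum E s (cn n) 1 (k n).+1 w =
      (sg n)^-1 * weighted_sum E s (fun j => g `^ s * c j) 1 (k n).+1 w.
    by rewrite /weighted_sum mulr_sumr; apply: eq_bigr => j _; rewrite [RHS]mulrA.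
  rewrite -mulrBr normrM ler_wpM2r// gtr0_norm ?invr_gt0//.
  by rewrite invf_le1.
have nE y : normal_prob 0 tau `]-oo, y]%classic = std_normal [set z | `]-oo, y]%classic (tau * z)].
  by apply: normal_prob_scale => //; exact: measurable_itv.
have fE : (fun y : R => normal_prob 0 tau `]-oo, y]%classic) =
    (fun y => std_normal [set z | `]-oo, y]%classic (tau * z)]) by exact/funext.
by move=> x cx; rewrite nE; apply: H; rewrite -fE.
Unshelve. all: by end_near. Qed.

End limits.

(** * Transfer to the original sample and conclusion *)

Lemma T_stat_in_distribution (R : realType)
    (d : measure_display) (T : measurableType d) (P : probability T R)
    (X : nat -> {RV P >-> R}) (F : R -> R)
    (d' : measure_display) (T' : measurableType d') (Q : probability T' R)
    (E : nat -> {RV Q >-> R}) (f : nat -> R) (s : R) (k : nat -> nat)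
    (phi : nat -> R -> R) (mu : set R -> \bar R) :
  mutually_independent X ->
  (forall i : nat, (0 < i)%N -> forall x : R, cdf (X i) x = (F x)%:E) ->
  (forall i : nat, (0 < i)%N -> {ae P, forall w, 1 < X i w}) ->
  iid_std_exponential E ->
  (forall n : nat, (1 < n)%N -> (1 <= k n < n)%N) ->
  (forall n, measurable_fun setT (phi n)) ->
  cvg_in_distribution Q (fun n w => phi n
    (T_quantile (fun t => log_quantile F (expR (- t))) f s (k n) n (fun i => E i w))) mu ->
  cvg_in_distribution P (fun n w => phi n (T_stat f s (k n) n (fun i => X i w))) mu.
Proof.
move=> indX cdfX X1 hE hk mphi H x cx; apply: cvg_trans (H x cx).
apply: near_eq_cvg; near=> n.
have /andP[k0 kn] : (1 <= k n < n)%N by apply: hk; near: n; exact: nbhs_infty_gt.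
apply/esym; apply: (T_stat_quantile indX cdfX X1 hE f s (B := [set t | phi n t <= x]) kn).
by apply: measurable_pred_set; exact: measurable_fun_ler.
Unshelve. all: by end_near. Qed.

Unset Implicit Arguments.

Theorem theorem3 (R : realType)
  (d : measure_display) (T : measurableType d) (P : probability T R)
  (X : nat -> {RV P >-> R}) (F : R -> R)
  (hXind : mutually_independent X)
  (hXF : forall i : nat, (0 < i)%N -> forall x : R, cdf (X i) x = (F x)%:E)
  (hX1 : forall i : nat, (0 < i)%N -> {ae P, forall w, 1 < X i w})
  (d' : measure_display) (T' : measurableType d') (Q : probability T' R)
  (E : nat -> {RV Q >-> R}) (hE : iid_std_exponential E)
  (gamma : R) (hgamma : 0 <= gamma) (hF : in_domain_of_attraction F gamma)
  (f : nat -> R) (hf : forall j : nat, (0 < j)%N -> 0 <= f j)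
  (s : R) (hs : 0 < s)
  (k : nat -> nat)
  (hk : forall n : nat, (1 < n)%N -> (1 <= k n < n)%N)
  (hkoo : k n @[n --> \oo] --> \oo)
  (hkn : (k n)%:R / n%:R @[n --> \oo] --> (0 : R)) :
  let Tn n w := T_stat f s (k n) n (fun i => X i w) in
  let an n := a_coef f s (k n) in
  let sigman n := sigma_coef f s (k n) in
  let Bn n := B_coef f s (k n) in
  let L w := L_series f s (fun j => E j w) in
  let v := v_coef s in
  (0 < gamma ->
   forall (p b : R -> R) (c : R), karamata_representation F gamma p b c ->
   (forall lambda : R, 1 < lambda ->
      cvg_in_probability Q
        (fun n w => remainder_sum f s (k n) gamma
           (tail_sup p lambda (k n) n) (tail_sup b lambda (k n) n)
           (fun j => E j w)) 0) ->
   ((square_series f s < +oo)%E ->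
      cvg_in_distribution P
        (fun n w => Tn n w - gamma `^ s * an n)
        (pushforward Q (fun w => gamma `^ s * v `^ (2^-1) * L w))) /\
   (square_series f s = +oo%E -> Bn n @[n --> \oo] --> 0 ->
      cvg_in_distribution P
        (fun n w => (sigman n)^-1 * (Tn n w - gamma `^ s * an n))
        (normal_prob 0 (Num.sqrt (gamma `^ (2 * s) * v)))))
  /\
  (gamma = 0 ->
   forall (p b : R -> R) (c D : R), dehaan_representation F p b c D ->
   let a := dehaan_a p b c in
   let mn lambda n := Num.max (tail_sup p lambda (k n) n)
                        (tail_sup b lambda (k n) n * ln (k n)%:R) in
   (exists2 lambda : R, 1 < lambda &
      tail_sup b lambda (k n) n * ln (k n)%:R @[n --> \oo] --> 0) ->
   (forall lambda : R, 1 < lambda ->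
      cvg_in_probability Q
        (fun n w => remainder_sum f s (k n) 1
           (tail_sup p lambda (k n) n) (mn lambda n)
           (fun j => E j w)) 0) ->
   ((square_series f s < +oo)%E ->
      cvg_in_distribution P
        (fun n w => Tn n w / a ((k n)%:R / n%:R) `^ s - an n)
        (pushforward Q (fun w => v `^ (2^-1) * L w))) /\
   (square_series f s = +oo%E -> Bn n @[n --> \oo] --> 0 ->
      cvg_in_distribution P
        (fun n w => (sigman n)^-1 *
           (Tn n w / a ((k n)%:R / n%:R) `^ s - an n))
        (normal_prob 0 (Num.sqrt v)))).
Proof.
move=> Tn an sigman Bn L v.
have qni (u w : R) : 0 < u -> u <= w -> log_quantile F w <= log_quantile F u.
  exact: (log_quantile_decreasing hXF hX1).
have mT n := measurable_T_quantile E f s qni (k n) n.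
(* One normalization for both cases: [A = 1] and [g = gamma] under Karamata, [A n] = a(k/n) and
   [g = 1] under de Haan. *)
pose phi (A : nat -> R) g n t := t / A n `^ s - g `^ s * a_coef f s (k n).
have mphi A g n : measurable_fun setT (phi A g n).
  by apply: measurable_funB => //; exact: measurable_funM.
have mphi' A g n : measurable_fun setT (fun t => (sigma_coef f s (k n))^-1 * phi A g n t).
  exact: measurable_funM.
have mY A g n : measurable_fun setT (fun w => phi A g n
    (T_quantile (fun t => log_quantile F (expR (- t))) f s (k n) n (fun i => E i w))).
  exact: (measurableT_comp (mphi A g n) (mT n)).
split=> [g0 p b c kr rem|g0 p b c D dr a mn [lambda l1 hb] rem].
- have hY := karamata_statistic_error hE qni hf hs hk hkoo hkn g0 kr (rem 2 (ltr1n R 2)).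
  split=> [fin|inf B0].
  + have H := series_limit hE hs hkoo g0 (mY (fun=> 1) gamma) hY fin.
    have := T_stat_in_distribution hXind hXF hX1 hE hk (mphi (fun=> 1) gamma) H.
    by rewrite /phi powR1; under eq_fun do under eq_fun do rewrite divr1.
  + have H := normal_limit hE hf hs hkoo g0 (mY (fun=> 1) gamma) hY inf B0.
    have := T_stat_in_distribution hXind hXF hX1 hE hk (mphi' (fun=> 1) gamma) H.
    by rewrite /phi powR1; under eq_fun do under eq_fun do rewrite divr1.
- have hY := dehaan_statistic_error hE qni hf hs hk hkoo hkn l1 dr hb (rem lambda l1).
  pose A n := a ((k n)%:R / n%:R).
  split=> [fin|inf B0].
  + have H := series_limit hE hs hkoo ltr01 (mY A 1) hY fin.
    have := T_stat_in_distribution hXind hXF hX1 hE hk (mphi A 1) H.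
    rewrite /phi powR1; under eq_fun do under eq_fun do rewrite mul1r.
    by under [X in pushforward _ X]eq_fun do rewrite mul1r.
  + have H := normal_limit hE hf hs hkoo ltr01 (mY A 1) hY inf B0.
    have := T_stat_in_distribution hXind hXF hX1 hE hk (mphi' A 1) H.
    by rewrite /phi !powR1 mul1r; under eq_fun do under eq_fun do rewrite mul1r.
Qed.
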